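(* Let $X\sim p$ and fix $\ell\in\{-1,0,1\}$ (with $\ell=0$ in the continuous case, $\ell\in\{-1,1\}$ in the discrete case). Let $\pmb{\ell}=(\ell_n)_{n\ge1}$ be a sequence such that $\ell_n=0$ for all $n$ if $\ell=0$, and otherwise $\ell_n\in\{-1,1\}$ arbitrarily chosen. Let $\mathbf{h}=(h_n)_{n\ge1}$ be a sequence of functions $h_i:\mathbb{R}\to\mathbb{R}$, $h_i\in\mathrm{dom}(\Delta^{-\ell_i})$, such that $\mathbb{P}[\Delta^{-\ell_i}h_i(X)>0]=1$ for all $i\ge1$. For $\mathbf{f}:\mathbb{R}\to\mathbb{R}^r$ define recursively $\mathbf{f}_0(x)=\mathbf{f}(x)$ and $$\mathbf{f}_i(x)=\frac{\Delta^{-\ell_i}\mathbf{f}_{i-1}(x)}{\Delta^{-\ell_i}h_i(x)},\qquad x\in\mathcal{S}(p),\ i\ge1.$$ Then for all $n\ge1$ and all vectors of functions $\mathbf{f}:\mathbb{R}\to\mathbb{R}^r$ (with $\mathbf{f}_{k-1}$ componentwise in $\mathrm{dom}(\Delta^{-\ell_k})$ for $1\le k\le n$) such that the expectations below exist, $$\mathrm{Cov}[\mathbf{f}(X)]=\sum_{k=1}^n(-1)^{k-1}\,\mathbb{E}\left[\Delta^{-\ell_k}\mathbf{f}_{k-1}(X)\,\Delta^{-\ell_k}\mathbf{f}_{k-1}'(X)\,\frac{\Gamma_k^{\pmb\ell}\mathbf{h}(X)}{\Delta^{-\ell_k}h_k(X)}\right]+(-1)^nR_n^{\pmb\ell}(\mathbf{h}),$$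 where the derivatives are taken componentwise, the weight sequences are $$\Gamma_k^{\pmb\ell}\mathbf{h}(x)=\mathbb{E}\Big[(h_k(X_{2k})-h_k(X_{2k-1}))\,\Phi_p^{\ell_k}(X_{2k-1},x,X_{2k})\,\Phi_{k-1}^{\pmb\ell}(X_1,X_3,\dots,X_{2k-1},X_{2k},\dots,X_4,X_2)\prod_{i=1}^{k-1}\Delta^{-\ell_i}h_i(X_{2i+1},X_{2i+2})\Big]$$ and \begin{align*} R_n^{\pmb\ell}(\mathbf{h})=\mathbb{E}\Big[&(\mathbf{f}_n(X_{2n+2})-\mathbf{f}_n(X_{2n+1}))(\mathbf{f}_n(X_{2n+2})-\mathbf{f}_n(X_{2n+1}))'\\ &\times\Phi_n^{\pmb\ell}(X_1,X_3,\dots,X_{2n+1},X_{2n+2},\dots,X_4,X_2)\prod_{i=1}^n\Delta^{-\ell_i}h_i(X_{2i+1},X_{2i+2})\Big]. \end{align*} Here $X_1,X_2,X_3,\dots$ are independent copies of $X$, $\Delta^{-\ell_i}h_i(x,y)=\Delta^{-\ell_i}h_i(x)\,\Delta^{-\ell_i}h_i(y)$, and an empty product equals $1$.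
   Context: A prime on a vector denotes transposition and $\mathrm{Cov}[\mathbf{f}(X)]$ is the $r\times r$ covariance matrix of the random vector $\mathbf{f}(X)$. $X$ is a real random variable with density $p$ with respect to a measure $\mu$, and $\mathcal{S}(p)=\{x:p(x)>0\}$. Standing assumption: either (discrete case) $\mu$ is the counting measure on $\mathbb{Z}$ and $\mathcal{S}(p)=[a,b]\cap\mathbb{Z}$ for some $a,b\in\mathbb{Z}\cup\{-\infty,\infty\}$; or (continuous case) $\mu$ is the Lebesgue measure on $\mathbb{R}$ and the closure of $\mathcal{S}(p)$ is $[a,b]$ for some $a,b\in\mathbb{R}\cup\{-\infty,\infty\}$. For $\ell\in\{-1,1\}$, $\Delta^{\ell}f(x)=(f(x+\ell)-f(x))/\ell$; $\Delta^0f=f'$ is the weak derivative, defined Lebesgue almost everywhere. $\Delta^\ell$ acts componentwise on vectors of functions. $\mathrm{dom}(\Delta^{\ell})$ is the set of functions for which $\Delta^\ell f$ exists and is finite $\mu$-almost surely: for $\ell=0$ this means the (locally) absolutely continuous functions, for $\ell=\pm1$ all functions on $\mathbb{Z}$. Set $a_\ell=\mathbb{I}[\ell=1]$ and $\chi^{\ell}(x,y)=\mathbb{I}[x\le y-a_\ell]$ for $\ell\in\{-1,0,1\}$ (so $\chi^{\ell^2}$ is $\chi^0$ if $\ell=0$ and $\chi^1$ if $\ell=\pm1$), and $$\Phi_p^{\ell}(u,x,v)=\frac{\chi^{\ell}(u,x)\chi^{-\ell}(x,v)}{p(x)}.$$ Set $\Phi_0^{\pmb\ell}(x_1,x_2)=1$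 and, for $n\ge1$, $$\Phi_n^{\pmb\ell}(x_1,x_3,\dots,x_{2n-1},x_{2n+1},x_{2n+2},x_{2n},\dots,x_2)=\frac{1}{\prod_{i=3}^{2n+2}p(x_i)}\,\chi^{\ell^2}(x_{2n+1},x_{2n+2})\prod_{i=1}^n\chi^{\ell_i}(x_{2i-1},x_{2i+1})\,\chi^{-\ell_i}(x_{2i+2},x_{2i}).$$
   Formalization: In the continuous case it is also required that p be positive Lebesgue-almost everywhere on the closure [a,b] of S(p); otherwise the identity fails, e.g. for p uniform on [0,1] minus a fat Cantor set with n=1 and f=h_1 the identity. *)

(* Defs.v *)
From HB Require Import structures.
From mathcomp Require Import all_boot all_order all_algebra.
From mathcomp Require Import all_classical all_reals all_analysis.

Set Implicit Arguments.
Unset Strict Implicit.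
Unset Printing Implicit Defensive.

Import Order.TTheory GRing.Theory Num.Theory.
Import numFieldNormedType.Exports.

Local Open Scope classical_set_scope.
Local Open Scope ring_scope.

Section reference_measure.
Context {R : realType}.

Definition integers : set R := range (fun m : int => m%:~R).

Lemma measurable_integers : @measurable _ (measurableTypeR R) integers.
Proof.
apply: countable_measurable => [x|]; first exact: (measurable_set1 (x : R)).
apply: (sub_countable (card_image_le _ _)); exact: countableP.
Qed.

(* Lebesgue measure if l = 0, counting measure on the integers (as a Borel
   measure on R) otherwise. *)
Definition refmeas (l : int) :
    {measure set (measurableTypeR R) -> \bar R} :=
  if l == 0 then
    [the {measure set (measurableTypeR R) -> \bar R} of @lebesgue_measure R]
  else
    [the {measure set (measurableTypeR R) -> \bar R} of
      mrestr (@counting (measurableTypeR R) R) measurable_integers].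

End reference_measure.

Section support.
Context {R : realType}.

Definition possupp (p : R -> R) : set R := [set x | 0 < p x].

Definition ereal_itv (a b : \bar R) : set R :=
  [set x | (a <= x%:E)%E /\ (x%:E <= b)%E].

Definition extended_integer (a : \bar R) : Prop :=
  [\/ a = -oo%E, a = +oo%E | exists m : int, a = (m%:~R)%:E].

Definition discrete_support (p : R -> R) : Prop :=
  exists a b : \bar R, [/\ extended_integer a, extended_integer b &
    possupp p = ereal_itv a b `&` integers].

(* The second clause is needed for densities whose zero set inside the interval
   closure (possupp p) is not negligible (e.g. a fat Cantor set): for them the
   expectation of Phi_p(u, X, v) f'(X) is not f v - f u, and the covariance
   expansion fails. *)
Definition continuous_support (p : R -> R) : Prop :=
  (exists a b : \bar R, closure (possupp p) = ereal_itv a b) /\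
  lebesgue_measure (closure (possupp p) `\` possupp p) = 0%E.

Definition standing_assumption (l : int) (p : R -> R) : Prop :=
  if l == 0 then continuous_support p else discrete_support p.

End support.

Section difference_operators.
Context {R : realType}.

(* For l = 0 this is the pointwise derivative; on the domain of Delta 0
   (locally absolutely continuous functions) it exists Lebesgue-almost
   everywhere and is the weak derivative. *)
Definition Delta (l : int) (f : R -> R) (x : R) : R :=
  if l == 0 then derive1 f x else (f (x + l%:~R) - f x) / l%:~R.

Definition abs_continuous (c d : R) (f : R -> R) : Prop :=
  forall e : R, 0 < e -> exists2 delta : R, 0 < delta &
    forall (m : nat) (u v : 'I_m -> R),
      (forall i, [/\ c <= u i, u i <= v i & v i <= d]) ->
      trivIset [set: 'I_m] (fun i => `]u i, v i[%classic) ->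
      \sum_(i < m) (v i - u i) < delta ->
      \sum_(i < m) `|f (v i) - f (u i)| < e.

Definition loc_abs_continuous (I : set R) (f : R -> R) : Prop :=
  forall c d : R, `[c, d] `<=` I -> abs_continuous c d f.

(* The iterated functions f_i are only determined on the support of p, so for
   l = 0 local absolute continuity is asked on the interior of the support
   interval; off it the values are irrelevant. *)
Definition in_dom (p : R -> R) (l : int) (f : R -> R) : Prop :=
  l = 0 -> loc_abs_continuous (interior (closure (possupp p))) f.

Definition vDelta r (l : int) (f : R -> 'cV[R]_r) (x : R) : 'cV[R]_r :=
  \col_j Delta l (fun y => f y j 0) x.

Definition in_vdom r (p : R -> R) (l : int) (f : R -> 'cV[R]_r) : Prop :=
  forall j, in_dom p l (fun y => f y j 0).

(* F i is a version of f_i: as weak derivatives are only defined almost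
   everywhere, so is the recursion.  For the counting measure this means at
   every point of the support. *)
Definition iterated_differences r (p : R -> R) (ell : int) (l : nat -> int)
    (h : nat -> R -> R) (f : R -> 'cV[R]_r) (F : nat -> R -> 'cV[R]_r) : Prop :=
  F 0%N = f /\
  forall i : nat, (1 <= i)%N ->
    \forall x \ae refmeas ell, possupp p x ->
      F i x = (Delta (- l i) (h i) x)^-1 *: vDelta (- l i) (F i.-1) x.

End difference_operators.

Section kernels.
Context {R : realType}.
Implicit Types (p : R -> R) (ell : int) (l : nat -> int) (h : nat -> R -> R).

Definition chi (l : int) (x y : R) : R :=
  if x <= y - (if l == 1 then 1 else 0) then 1 else 0.

Definition Phi_p p (l : int) (u x v : R) : R :=
  chi l u x * chi (- l) x v / p x.

(* The arguments are given as a sequence x indexed from 1 (x 0 is not used);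
   for n >= 1 only x 1, ..., x (2 n + 2) occur. *)
Definition Phi p ell l (n : nat) (x : nat -> R) : R :=
  if n == 0%N then 1 else
  (\prod_(3 <= i < (2 * n + 3)%N) p (x i))^-1 *
  chi (ell ^+ 2) (x (2 * n + 1)%N) (x (2 * n + 2)%N) *
  \prod_(1 <= i < n.+1)
    (chi (l i) (x (2 * i - 1)%N) (x (2 * i + 1)%N) *
     chi (- l i) (x (2 * i + 2)%N) (x (2 * i)%N)).

Definition hprod l h (n : nat) (x : nat -> R) : R :=
  \prod_(1 <= i < n.+1)
    (Delta (- l i) (h i) (x (2 * i + 1)%N) *
     Delta (- l i) (h i) (x (2 * i + 2)%N)).

End kernels.

Section probability_notions.
Local Open Scope ereal_scope.
Context d (T : measurableType d) (R : realType) (P : probability T R).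

Definition has_density (X : {RV P >-> R})
    (mu : {measure set (measurableTypeR R) -> \bar R}) (p : R -> R) : Prop :=
  [/\ measurable_fun [set: R] p, (forall x, (0 <= p x)%R) &
      forall A : set R, measurable A ->
        distribution P X A = \int[mu]_(x in A) (p x)%:E].

Definition mutually_independent (D : set nat) (Xs : nat -> {RV P >-> R}) : Prop :=
  forall (I : seq nat) (A : nat -> set R),
    uniq I -> (forall i, i \in I -> D i) -> (forall i, measurable (A i)) ->
    P (\bigcap_(i in [set` I]) (Xs i @^-1` A i)) =
    \prod_(i <- I) P (Xs i @^-1` A i).

(* The copies are Xs 1, Xs 2, ...; Xs 0 is not constrained. *)
Definition independent_copies (X : {RV P >-> R}) (Xs : nat -> {RV P >-> R}) : Prop :=
  mutually_independent [set i | (1 <= i)%N] Xs /\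
  forall i, (1 <= i)%N -> forall A : set R, measurable A ->
    distribution P (Xs i) A = distribution P X A.

Definition has_mean (Y : T -> R) : Prop :=
  P.-integrable [set: T] (EFin \o Y).

Definition has_mmean m n (M : T -> 'M[R]_(m, n)) : Prop :=
  forall i j, has_mean (fun w => M w i j).

Definition mmean m n (M : T -> 'M[R]_(m, n)) : 'M[R]_(m, n) :=
  (\matrix_(i, j) fine 'E_P[fun w => M w i j])%R.

Definition cov_mx r (Y : T -> 'cV[R]_r) : 'M[R]_r :=
  (\matrix_(i, j) fine (covariance P (fun w => Y w i 0) (fun w => Y w j 0)))%R.

Definition has_cov_mx r (Y : T -> 'cV[R]_r) : Prop :=
  has_mmean Y /\ has_mmean (fun w => (Y w *m (Y w)^T)%R).

End probability_notions.

Section expansion.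
Context d (T : measurableType d) (R : realType) (P : probability T R).
Context (X : {RV P >-> R}) (Xs : nat -> {RV P >-> R}).
Context (p : R -> R) (ell : int) (l : nat -> int) (h : nat -> R -> R).

Definition Gamma_integrand (k : nat) (x : R) (w : T) : R :=
  (h k (Xs (2 * k)%N w) - h k (Xs (2 * k - 1)%N w)) *
  Phi_p p (l k) (Xs (2 * k - 1)%N w) x (Xs (2 * k)%N w) *
  Phi p ell l k.-1 (fun i => Xs i w) *
  hprod l h k.-1 (fun i => Xs i w).

Definition Gamma (k : nat) (x : R) : R := fine 'E_P[Gamma_integrand k x].

Definition expansion_term r (g : R -> 'cV[R]_r) (k : nat) (w : T) : 'M[R]_r :=
  (Gamma k (X w) / Delta (- l k) (h k) (X w)) *:
  (vDelta (- l k) g (X w) *m (vDelta (- l k) g (X w))^T).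

Definition remainder_integrand r (g : R -> 'cV[R]_r) (n : nat) (w : T) : 'M[R]_r :=
  let dg := g (Xs (2 * n + 2)%N w) - g (Xs (2 * n + 1)%N w) in
  (Phi p ell l n (fun i => Xs i w) * hprod l h n (fun i => Xs i w)) *:
  (dg *m dg^T).

End expansion.

(* Main.v *)
Require Import Defs.
From HB Require Import structures.
From mathcomp Require Import all_boot all_order all_algebra.
From mathcomp Require Import all_classical all_reals all_analysis.
From mathcomp Require Import measurable_realfun zify ring lra.

Set Implicit Arguments.
Unset Strict Implicit.
Unset Printing Implicit Defensive.

Import Order.TTheory GRing.Theory Num.Theory.
Import numFieldNormedType.Exports.

Local Open Scope classical_set_scope.
Local Open Scope ring_scope.

(** The expansion is an alternating sum of nonnegative quantities. Write [nu] for
    the law of [X] and, for a real function [phi],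
    - [D_k phi] for the [k]-th remainder with [phi] in place of [f_k], that is,
      the mean of [(phi (X_(2k+2)) - phi (X_(2k+1))) ^ 2] weighted by the
      kernels and the differences of [h_1], ..., [h_k];
    - [E_k] for the [k]-th term of the expansion of the variance of a real
      function [f].
    Exchanging two independent copies shows that the variance of [f (X)] is
    [D_0 f_0], and the heart of the proof is the identity
    [D_(k-1) f_(k-1) + D_k f_k = E_k], which is [dispersion_step].

    That identity is Lagrange's form of the Cauchy-Schwarz inequality. For fixed
    [u <= v], the measure with density [Phi_p u x v] with respect to [nu] turns
    differences back into increments ([kernel_version]): it integrates the
    difference [a] of [f_(k-1)] to [f_(k-1) v - f_(k-1) u] and the difference [b]
    of [h_k] to [h_k v - h_k u]. Lagrange's identity for this measure,
    mass of [b] times integral of [a ^ 2 / b], equals the square of the integral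
    of [a] plus half the double integral of
    [b x * b y * (a y / b y - a x / b x) ^ 2] ([lagrange_identity]).
    As [a / b = f_k], integrating over [u] and [v] with the weight of order
    [k - 1] gives the three terms of the step; the nested order indicators of the
    remainder appear because of [chi_nested]. Since all integrands are
    nonnegative, Tonelli's theorem applies and the step holds in the extended
    reals. The terms [E_k] are finite by assumption, hence so are all the
    [D_k f_k], and the steps telescope to the expansion of the variance
    ([variance_expansion]). Covariances follow by polarization
    ([covariance_expansion]), and matrices entry by entry.

    Two things need care. The functions in the statement are not assumed
    measurable, and their differences are determined only almost everywhere, so
    they are replaced by Borel functions that agree with them on a set of full
    law. In the discrete case any function has such a version and the kernel
    integral is a telescoping sum; in the continuous case it is the fundamental
    theorem of calculus for locally absolutely continuous functions, obtained
    from the Radon-Nikodym theorem because the Lebesgue-Stieltjes measure of a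
    nondecreasing absolutely continuous function does not charge null sets
    ([ac_density]). Then, the expectations over [2 n + 2] independent copies have
    to become iterated integrals over pairs: each pair is independent of the
    preceding ones, so that the expectation is computed by the recursion
    [weight] ([expectation_path_weight]). *)

(** * Absolute continuity on finite families of intervals *)

Section absolute_continuity.
Context {R : realType}.
Implicit Types (c d u v : R) (f : R -> R) (s t : seq (R * R)).

Definition sep (x y : R * R) := (x.2 <= y.1) || (y.2 <= x.1).

Definition inside c d (x : R * R) := [&& c <= x.1, x.1 <= x.2 & x.2 <= d].

Definition total_length s := \sum_(x <- s) (x.2 - x.1).

Definition jumps f s := \sum_(x <- s) `|f x.2 - f x.1|.

(** Absolute continuity over lists of intervals, which can be cut, concatenated
    and mapped; lists have the advantage over indexed families that a partition
    of one interval can be spliced into the family. *)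
Definition ac_seq c d f := forall e : R, 0 < e -> exists2 delta : R, 0 < delta &
  forall s, all (inside c d) s -> pairwise sep s ->
    total_length s < delta -> jumps f s < e.

Lemma total_length_cons x s : total_length (x :: s) = (x.2 - x.1) + total_length s.
Proof. by rewrite /total_length big_cons. Qed.

Lemma jumps_cons f x s : jumps f (x :: s) = `|f x.2 - f x.1| + jumps f s.
Proof. by rewrite /jumps big_cons. Qed.

Lemma total_length_cat s t : total_length (s ++ t) = total_length s + total_length t.
Proof. by rewrite /total_length big_cat. Qed.

Lemma jumps_cat f s t : jumps f (s ++ t) = jumps f s + jumps f t.
Proof. by rewrite /jumps big_cat. Qed.

Lemma sep_sym : symmetric sep.
Proof. by move=> x y; rewrite /sep orbC. Qed.

(** Intervals lying side by side have disjoint interiors, so the definition by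
    families with disjoint open intervals covers them. *)
Lemma abs_continuous_seq c d f : abs_continuous c d f -> ac_seq c d f.
Proof.
move=> acf e /acf[delta delta0 H]; exists delta => // s cds ss sd.
have nthP (i : 'I_(size s)) : nth (0, 0) s i \in s by rewrite mem_nth.
pose u (i : 'I_(size s)) := (nth (0, 0) s i).1.
pose v (i : 'I_(size s)) := (nth (0, 0) s i).2.
have uv i : [/\ c <= u i, u i <= v i & v i <= d].
  by have /and3P := allP cds _ (nthP i).
rewrite /jumps (big_nth (0, 0)) big_mkord; apply: (H _ u v) => //; last first.
  by move: sd; rewrite /total_length (big_nth (0, 0)) big_mkord.
have sepij (i j : 'I_(size s)) : (i < j)%N -> v i <= u j \/ v j <= u i.
  move=> ij; apply/orP.
  have /(pairwiseP (0, 0)) H' := ss; exact: (H' i j (ltn_ord i) (ltn_ord j) ij).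
have wl (i j : 'I_(size s)) : (i < j)%N ->
    `]u i, v i[ `&` `]u j, v j[ !=set0 -> i = j.
  move=> ij [z /=[]]; rewrite !in_itv /= => /andP[uz zv] /andP[uz' zv'].
  have [vu|vu] := sepij _ _ ij.
    by have := lt_trans uz' (lt_le_trans zv vu); rewrite ltxx.
  by have := lt_trans uz (lt_le_trans zv' vu); rewrite ltxx.
move=> i j _ _ ijn0; have [ij|ji|/val_inj//] := ltngtP i j.
- exact: wl ij ijn0.
- by apply/esym/(wl _ _ ji); rewrite setIC.
Qed.

Definition pieces (a : R) (s : seq R) := zip (a :: s) s.

Lemma piecesP (a : R) (s : seq R) : path <%R a s ->
  [/\ all (inside a (last a s)) (pieces a s), pairwise sep (pieces a s) &
      total_length (pieces a s) = last a s - a].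
Proof.
elim: s a => [|x s IH] a /=.
  by move=> _; rewrite /total_length big_nil subrr.
move=> /andP[ax /IH[allx sx tx]].
have xl : x <= last x s.
  by rewrite -subr_ge0 -tx /total_length big_seq sumr_ge0// => y /(allP allx)/and3P[_ ? _];
    rewrite subr_ge0.
split.
- apply/andP; split; first by rewrite /inside /= lexx (ltW ax) xl.
  apply/allP => y /(allP allx) /and3P[xy y12 yl].
  by rewrite /inside (le_trans (ltW ax) xy) y12 yl.
- apply/andP; split => //; apply/allP => y /(allP allx) /and3P[xy _ _].
  by rewrite /sep /= xy.
- by rewrite total_length_cons tx /= addrC subrKA.
Qed.

Lemma variation_pieces (a b : R) f (s : seq R) : itv_partition a b s ->
  variation a b f s = jumps f (pieces a s).
Proof.
elim: s a => [|x s IH] a abs.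
  by rewrite /variation big_nil /jumps big_nil.
have xbs := itv_partition_cons abs.
rewrite /pieces /= jumps_cons -(IH _ xbs) /variation /=.
by rewrite big_nat_recl//=.
Qed.

Local Notation TV := total_variation.

(** Refining one interval of the family by a partition changes neither the
    total length nor the separation, so the increment of [f] on it can be
    replaced by the supremum over its partitions. Doing this for one interval at
    a time bounds the sum of the total variations; [t] lists the intervals
    already treated, [s] the others. *)
Lemma ac_total_variation c d f (e : R) (delta : R) :
  (forall s, all (inside c d) s -> pairwise sep s ->
    total_length s < delta -> jumps f s < e) ->
  forall t s, all (inside c d) (t ++ s) -> pairwise sep (t ++ s) ->
    total_length (t ++ s) < delta ->
    (\sum_(x <- t) TV x.1 x.2 f + (jumps f s)%:E <= e%:E)%E.
Proof.
move=> H; elim=> [s cds ss sd|x t IH s].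
  by rewrite big_nil add0e lee_fin ltW// H.
rewrite cat_cons => /= /andP[xcd cdts] /andP[xts tss].
rewrite total_length_cons => xlen.
have /and3P[cx x12 xd] := xcd.
have sub (p : seq R) : itv_partition x.1 x.2 p ->
    (\sum_(y <- t) TV y.1 y.2 f + (jumps f (pieces x.1 p ++ s))%:E <= e%:E)%E.
  move=> [xp /eqP lp]; have [pin psep ptot] := piecesP xp.
  rewrite lp in pin ptot; apply: IH.
  - rewrite !all_cat; move: cdts; rewrite all_cat => /andP[-> ->].
    rewrite !andbT /=; apply/allP => y /(allP pin) /and3P[xy y12 yx].
    by rewrite /inside (le_trans cx xy) y12 (le_trans yx xd).
  - rewrite pairwise_cat; move: tss; rewrite pairwise_cat => /and3P[ts tt ss'].
    rewrite tt pairwise_cat psep ss' /= !andbT.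
    have pxts y z : y \in pieces x.1 p -> z \in t ++ s -> sep y z.
      move=> /(allP pin)/and3P[xy _ yx] /(allP xts); rewrite /sep.
      by move=> /orP[h|h]; apply/orP; [left|right];
        [apply: le_trans h|apply: le_trans xy].
    rewrite allrel_catr ts andbT; apply/andP; split.
      apply/allrelP => y z yt zp; rewrite sep_sym.
      by apply: (pxts _ _ zp); rewrite mem_cat yt.
    apply/allrelP => y z yp zs; apply: (pxts _ _ yp).
    by rewrite mem_cat zs orbT.
  - by move: xlen; rewrite !total_length_cat ptot addrCA.
have S0 : (0 <= \sum_(y <- t) TV y.1 y.2 f)%E.
  rewrite big_seq; apply: sume_ge0 => y yt; apply: total_variation_ge0.
  have yts : y \in t ++ s by rewrite mem_cat yt.
  by have /and3P[] := allP cdts y yts.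
have TVlen : (TV x.1 x.2 f <= (e - jumps f s)%:E - \sum_(y <- t) TV y.1 y.2 f)%E.
  apply: ge_ereal_sup => _ [_ [p xp <-] <-]; have := sub p xp.
  rewrite variation_pieces// jumps_cat.
  move: S0; case: (\sum_(y <- t) TV y.1 y.2 f)%E => [w| |] //= _.
  by rewrite -EFinD -EFinB !lee_fin => ?; lra.
have T0 : (0 <= TV x.1 x.2 f)%E by apply: total_variation_ge0.
rewrite big_cons; move: S0 T0 TVlen.
case: (\sum_(y <- t) TV y.1 y.2 f)%E => [w| |] //;
  case: (TV x.1 x.2 f) => [w'| |] //= _ _.
by rewrite -EFinB -!EFinD !lee_fin => ?; lra.
Qed.

Lemma ac_seq_subitv c d c' d' f : c <= c' -> d' <= d ->
  ac_seq c d f -> ac_seq c' d' f.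
Proof.
move=> cc dd acf e /acf[delta d0 H]; exists delta => // s sin; apply: H.
apply/allP => x /(allP sin)/and3P[cx x12 xd].
by rewrite /inside (le_trans cc cx) x12 (le_trans xd dd).
Qed.

(** The interval is covered by finitely many steps shorter than the [delta] of
    [e = 1], on each of which the variation is at most 1. *)
Lemma ac_bounded_variation c d f : c <= d -> ac_seq c d f ->
  TV c d f \is a fin_num.
Proof.
move=> cd acf; have [delta d0 H] := acf 1 ltr01.
have step u v : c <= u -> u <= v -> v <= d -> v - u < delta ->
    TV u v f \is a fin_num.
  move=> cu uv vd uvd; rewrite ge0_fin_numE ?total_variation_ge0//.
  have := @ac_total_variation c d f _ _ H [:: (u, v)] [::].
  rewrite /= /inside /total_length /jumps !big_seq1 !big_nil /= cu uv vd.
  by rewrite adde0 => /(_ isT isT uvd) /le_lt_trans; apply; rewrite ltry.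
pose m := (Num.bound ((d - c) / (delta / 2))).
(* The step [delta / 2] keeps every piece strictly shorter than [delta]. *)
have main (k : nat) u : c <= u -> u <= d -> d - u < (delta / 2) * k%:R ->
    TV u d f \is a fin_num.
  elim: k u => [|k IH] u cu ud.
    by rewrite mulr0 subr_lt0 ltNge ud.
  have [small _|big] := ltP (d - u) delta; first exact: step.
  rewrite -[k.+1]addn1 natrD mulrDr mulr1 => dk.
  have uu : u <= u + delta / 2 by rewrite lerDl ltW// divr_gt0.
  have ud' : u + delta / 2 <= d by lra.
  rewrite (total_variationD f uu ud') fin_numD; apply/andP; split.
    by apply: step => //; lra.
  by apply: IH => //; lra.
apply: (main m) => //; rewrite mulrC -ltr_pdivrMr ?divr_gt0//.
by apply: archi_boundP; rewrite divr_ge0 ?subr_ge0// ltW// divr_gt0.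
Qed.

End absolute_continuity.

(** * Densities of absolutely continuous functions *)

(** The Lebesgue-Stieltjes measure of a nondecreasing absolutely continuous
    function does not charge Lebesgue null sets, so it has a Radon-Nikodym
    density, which then integrates to the increments of the function. The
    function is first extended to the line by clamping its argument to [c, d],
    to have a cumulative function. *)
Section nondecreasing_density.
Context {R : realType} (c d : R) (F : R -> R).
Hypotheses (cd : c <= d) (ndF : {in `[c, d] &, {homo F : x y / x <= y}}).
Hypothesis acF : ac_seq c d F.

Let clamp (x : R) := Num.max c (Num.min d x).

Let clampP x : c <= clamp x <= d.
Proof. by rewrite /clamp le_max lexx ge_max cd ge_min lexx. Qed.

Let clamp_id x : c <= x <= d -> clamp x = x.
Proof. by move=> /andP[cx xd]; rewrite /clamp (min_idPr xd) (max_idPr cx). Qed.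

Let clamp_nd x y : x <= y -> clamp x <= clamp y.
Proof.
move=> xy; rewrite /clamp ge_max !le_max lexx/=.
by apply/orP; right; rewrite le_min !ge_min lexx xy orbT.
Qed.

Let clamp_le x y : x <= y -> clamp y - clamp x <= y - x.
Proof.
by move=> xy; rewrite /clamp /Num.max /Num.min; do 4! case: ifPn => //;
  rewrite -?leNgt; lra.
Qed.

Let G x := F (clamp x).

Let G_nd : nondecreasing G.
Proof.
by move=> x y xy; apply: ndF; rewrite ?in_itv/= ?clampP//; exact: clamp_nd.
Qed.

Let G_cont : continuous G.
Proof.
move=> x; apply/cvgrPdist_lt => e e0; have [delta d0 H] := acF e0.
have wl u v : u <= v -> v - u < delta -> `|G v - G u| < e.
  move=> uv uvd; have := H [:: (clamp u, clamp v)].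
  rewrite /jumps /total_length !big_seq1 /= /inside /= clamp_nd// andbT.
  have /andP[-> _] := clampP u; have /andP[_ ->] := clampP v.
  by apply => //; apply: le_lt_trans uvd; exact: clamp_le.
near=> y; have yx : `|x - y| < delta.
  by near: y; apply: cvgr_dist_lt => //; exact: cvg_id.
have [xy|yx'] := leP x y.
  by rewrite distrC wl// (le_lt_trans _ yx)// distrC ler_norm.
by rewrite wl ?(ltW yx')// (le_lt_trans _ yx)// ler_norm.
Unshelve. all: by end_near. Qed.

Let Gc : cumulative R R :=
  HB.pack G (isCumulative.Build R _ R G G_nd (right_continuousW G_cont)).

Let muG : {measure set (measurableTypeR R) -> \bar R} :=
  [the {measure set (measurableTypeR R) -> \bar R} of
   lebesgue_stieltjes_measure Gc].

Local Notation mu := (@lebesgue_measure R).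

Let muG_itv a b : a <= b -> muG `]a, b]%classic = (G b - G a)%:E.
Proof.
move=> ab; have -> : muG `]a, b]%classic = (wlength Gc)^*%mu `]a, b]%classic by [].
rewrite measurable_mu_extE; first exact: wlength_itv_bnd.
exact: is_ocitv.
Qed.

Let mu_itv (a b : R) : a <= b -> mu `]a, b]%classic = (b - a)%:E.
Proof.
move=> ab; have -> : mu `]a, b]%classic = (wlength idfun)^*%mu `]a, b]%classic by [].
rewrite measurable_mu_extE; first exact: wlength_itv_bnd.
exact: is_ocitv.
Qed.

(** A finite union of half-open intervals is a finite disjoint union of such
    intervals, and disjoint half-open intervals lie side by side: absolute
    continuity applies to their clamped ends. *)
Let muG_small (e delta : R) (I : nat -> set (ocitv_type R)) (N : nat) :
  (forall s, all (inside c d) s -> pairwise sep s ->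
    total_length s < delta -> jumps F s < e) ->
  (forall k, measurable (I k)) ->
  (mu (\big[setU/set0]_(k < N) I k : set R) < delta%:E)%E ->
  (muG (\big[setU/set0]_(k < N) I k) <= e%:E)%E.
Proof.
move=> H mI.
have : (measurable : set (set (SetRing.type (ocitv_type R))))
    (\big[setU/set0]_(k < N) I k).
  apply: bigsetU_measurable => k _.
  by apply: SetRing.measurable_subring; exact: mI.
move=> /SetRing.ring_finite_set[B [finB neB tB mB ->]].
have mB' X : B X -> (measurable : set (set (measurableTypeR R))) X.
  by move=> BX; apply: sub_sigma_algebra; apply: mB; rewrite inE.
have BE (X : set R) : B X -> {ab : R * R | ab.1 <= ab.2 & X = `]ab.1, ab.2]%classic}.
  move=> /mem_set /mB /ocitvP BX; apply: cid2; case: BX => [->|[x x12 ->]].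
    by exists (0, 0) => //=; rewrite set_itvoc0.
  by exists x => //; exact: ltW.
pose pk (X : set R) : R * R :=
  if pselect (B X) is left BX then s2val (BE X BX) else (0, 0).
have pkP X : B X -> (pk X).1 <= (pk X).2 /\ X = `](pk X).1, (pk X).2]%classic.
  by rewrite /pk; case: pselect => // BX _; case: (BE X BX).
rewrite !measure_fin_bigcup//.
rewrite !fsbig_finite//=.
have BfP (X : set R) : X \in finmap.enum_fset (fset_set B) -> B X.
  by move=> h; have : X \in B by [rewrite -(in_fset_set finB)]; rewrite inE.
set L := finmap.enum_fset (fset_set B) in BfP *.
have uL : uniq L := finmap.fset_uniq _.
rewrite (eq_big_seq (fun X => ((pk X).2 - (pk X).1)%:E)); last first.
  by move=> X /BfP /pkP[h] {1}->; exact: mu_itv.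
rewrite sumEFin lte_fin => ltd.
rewrite (eq_big_seq (fun X => (G (pk X).2 - G (pk X).1)%:E)); last first.
  by move=> X /BfP /pkP[h] {1}->; exact: muG_itv.
rewrite sumEFin lee_fin.
pose cpk X := (clamp (pk X).1, clamp (pk X).2).
have := H [seq cpk X | X <- L].
rewrite /jumps /total_length !big_map => H'.
apply: le_trans (ltW (H' _ _ _)).
- by apply: ler_sum => X _; exact: ler_norm.
- rewrite all_map; apply/allP => X /BfP /pkP[h _] /=.
  rewrite /inside /= clamp_nd//.
  by have /andP[-> _] := clampP (pk X).1; have /andP[_ ->] := clampP (pk X).2.
- rewrite pairwise_map; move: uL; rewrite uniq_pairwise.
  apply: (@sub_in_pairwise _ [pred X | X \in L]); last by apply/allP.
  move=> X Y /BfP BX /BfP BY /= XY.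
  have [h XE] := pkP _ BX; have [h' YE] := pkP _ BY.
  suff : sep (pk X) (pk Y).
    by move=> /orP[] /clamp_nd h''; apply/orP; [left|right].
  rewrite /sep; apply/negPn/negP; rewrite negb_or -!ltNge => /andP[h1 h2].
  move/eqP: XY; apply; apply: tB => //.
  have X12 : (pk X).1 < (pk X).2.
    have := neB _ BX; rewrite {1}XE => -[z /=]; rewrite in_itv/= => /andP[z1 z2].
    exact: lt_le_trans z1 z2.
  have Y12 : (pk Y).1 < (pk Y).2.
    have := neB _ BY; rewrite {1}YE => -[z /=]; rewrite in_itv/= => /andP[z1 z2].
    exact: lt_le_trans z1 z2.
  exists (Num.min (pk X).2 (pk Y).2); rewrite {1}XE {1}YE; split; rewrite /= in_itv/=.
    by rewrite lt_min X12 h2 ge_min lexx.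
  by rewrite lt_min h1 Y12 ge_min lexx orbT.
- apply: le_lt_trans ltd; rewrite big_seq [leRHS]big_seq.
  by apply: ler_sum => X /BfP /pkP[h _]; exact: clamp_le.
Qed.

(** A null set is covered by countably many intervals of small total length;
    the finite unions have small measure and increase to the whole union. *)
Let muG_dominated (A : set (measurableTypeR R)) :
  measurable A -> mu A = 0%E -> muG A = 0%E.
Proof.
move=> mA A0; apply/eqP; rewrite eq_le measure_ge0 andbT.
apply/lee_addgt0Pr => e e0; rewrite add0e.
have [delta d0 H] := acF e0.
have /ereal_inf_lt[_ [I [mI AI] <-] Id] : (mu A < delta%:E)%E by rewrite A0 lte_fin.
pose U N : set (measurableTypeR R) := \big[setU/set0]_(k < N) I k.
have mI' k : (measurable : set (set (measurableTypeR R))) (I k).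
  by apply: sub_sigma_algebra; exact: mI.
have mU N : measurable (U N) by apply: bigsetU_measurable => k _; exact: mI'.
have Usup : \bigcup_N U N = \bigcup_k I k.
  apply/seteqP; split=> x.
    by move=> [N _]; rewrite /U -bigcup_mkord => -[k _ Ik]; exists k.
  by move=> [k _ Ik]; exists k.+1 => //; rewrite /U -bigcup_mkord; exists k => /=.
have mUs : measurable (\bigcup_N U N) by apply: bigcup_measurable => k _.
apply: (@le_trans _ _ (muG (\bigcup_N U N))).
  by apply: le_measure; rewrite ?inE// Usup.
have Ucvg : (muG \o U) N @[N --> \oo] --> muG (\bigcup_N U N).
  apply: nondecreasing_cvg_mu => // i j ij; rewrite subsetEset.
  exact: subset_bigsetU.
have <- := cvg_lim (@ereal_hausdorff R) Ucvg.
apply: lime_le; first by apply/cvg_ex; eexists; exact: Ucvg.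
apply: nearW => N; apply: (muG_small H) => //.
apply: le_lt_trans Id.
apply: (@le_trans _ _ (\sum_(k < N) mu (I k))%E).
  by apply: Boole_inequality => // k; exact: mI'.
have -> : (\sum_(k < N) mu (I k) = \sum_(0 <= k < N) wlength idfun (I k))%E.
  rewrite big_mkord; apply: eq_bigr => k _.
  have -> : mu (I k) = (wlength idfun)^*%mu (I k) by [].
  by rewrite measurable_mu_extE.
by apply: nneseries_lim_ge => k _ _; exact: wlength_ge0.
Qed.

Let mcd : (measurable : set (set (measurableTypeR R))) `]c, d]%classic.
Proof. exact: measurable_itv. Qed.

Let nu0 : set (measurableTypeR R) -> \bar R := mrestr muG mcd.

HB.instance Definition _ := Measure.on nu0.

Let nu0_fin : fin_num_fun nu0.
Proof.
move=> A mA; rewrite ge0_fin_numE//.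
apply: (@le_lt_trans _ _ (muG `]c, d]%classic)).
  by apply: le_measure; rewrite ?inE//; exact: measurableI.
by rewrite muG_itv// ltry.
Qed.

HB.instance Definition _ := Measure_isFinite.Build _ _ _ nu0 nu0_fin.

Let nu : {finite_measure set (measurableTypeR R) -> \bar R} :=
  [the {finite_measure set (measurableTypeR R) -> \bar R} of nu0].

Lemma nondecreasing_ac_density : exists g : R -> R,
  mu.-integrable [set: R] (EFin \o g) /\
  forall u v, c <= u -> u <= v -> v <= d ->
    (\int[mu]_(x in `]u, v]) (g x)%:E = (F v - F u)%:E)%E.
Proof.
have numu : charge_of_finite_measure nu `<< mu.
  apply/null_content_dominatesP => A mA A0.
  apply/eqP; rewrite eq_le measure_ge0 andbT -(muG_dominated mA A0).
  by apply: le_measure; rewrite ?inE//; exact: measurableI.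
pose f := Radon_Nikodym (charge_of_finite_measure nu) mu.
have ffin x : f x \is a fin_num by exact: Radon_Nikodym_fin_num.
have intf : mu.-integrable [set: R] f by exact: Radon_Nikodym_integrable.
exists (fine \o f); have ff : EFin \o (fine \o f) = f.
  by apply/funext => x /=; rewrite fineK.
split; first by rewrite ff.
move=> u v cu uv vd.
under eq_integral do rewrite fineK//.
rewrite -(Radon_Nikodym_integral numu)//.
transitivity (muG `]u, v]%classic).
  change (muG (`]u, v]%classic `&` `]c, d]%classic) = muG `]u, v]%classic).
  congr (muG _).
  apply/setIidl => x /=; rewrite !in_itv /= => /andP[ux xv].
  by rewrite (le_lt_trans cu ux) (le_trans xv vd).
by rewrite muG_itv// /G !clamp_id ?cu ?vd ?(le_trans cu uv) ?(le_trans uv vd).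
Qed.

End nondecreasing_density.

Section ac_density.
Context {R : realType}.
Implicit Types (c d u v : R) (f : R -> R).
Local Notation TV := total_variation.
Local Notation mu := (@lebesgue_measure R).

(** The total variation [F] of an absolutely continuous function is itself
    absolutely continuous, so [f = F - (F - f)] is a difference of nondecreasing
    absolutely continuous functions and the density is the difference of theirs.
    Lebesgue differentiation identifies it with the derivative. *)
Lemma ac_density c d f : c <= d -> ac_seq c d f -> exists g : R -> R,
  [/\ mu.-integrable [set: R] (EFin \o g),
    forall u v, c <= u -> u <= v -> v <= d ->
      (\int[mu]_(x in `]u, v]) (g x)%:E = (f v - f u)%:E)%E &
    {ae mu, forall x, c < x < d -> derivable f x 1 /\ derive1 f x = g x}].
Proof.
move=> cd acf; have TVfin u v : c <= u -> u <= v -> v <= d ->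
    TV u v f \is a fin_num.
  by move=> cu uv vd; apply: ac_bounded_variation => //;
    exact: ac_seq_subitv acf.
pose F x := fine (TV c x f).
have FB u v : c <= u -> u <= v -> v <= d -> F v - F u = fine (TV u v f).
  move=> cu uv vd; rewrite /F (total_variationD f cu uv) fineD ?TVfin//.
    by rewrite addrC addKr.
  exact: le_trans uv vd.
have TVge u v : c <= u -> u <= v -> v <= d -> `|f v - f u| <= fine (TV u v f).
  move=> cu uv vd; rewrite -lee_fin fineK ?TVfin//.
  exact: total_variation_ge.
have ndF : {in `[c, d] &, {homo F : x y / x <= y}}.
  move=> x y; rewrite !in_itv/= => /andP[cx xd] /andP[cy yd] xy.
  by rewrite -subr_ge0 FB// (le_trans _ (TVge _ _ _ _ _)).
have ndFf : {in `[c, d] &, {homo (F \- f) : x y / x <= y}}.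
  move=> x y; rewrite !in_itv/= => /andP[cx xd] /andP[cy yd] xy.
  rewrite -subr_ge0 [X in 0 <= X](_ : _ = (F y - F x) - (f y - f x)); last first.
    by rewrite /=; ring.
  by rewrite FB// subr_ge0 (le_trans (ler_norm _))// TVge.
have acF : ac_seq c d F.
  move=> e e0; have [delta d0 H] := acf _ (divr_gt0 e0 (ltr0Sn _ 1)).
  exists delta => // s sin ssep slen.
  have := @ac_total_variation _ c d f _ _ H s [::].
  rewrite cats0 => /(_ sin ssep slen); rewrite /jumps big_nil adde0.
  have -> : (\sum_(x <- s) TV x.1 x.2 f = (\sum_(x <- s) `|F x.2 - F x.1|)%:E)%E.
    rewrite -sumEFin; apply: eq_big_seq => x /(allP sin)/and3P[cx x12 xd].
    rewrite ger0_norm ?FB// ?fineK ?TVfin//.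
    by rewrite (le_trans _ (TVge _ _ _ _ _)).
  by rewrite lee_fin => /le_lt_trans; apply; lra.
have acFf : ac_seq c d (F \- f).
  move=> e e0; have e20 := divr_gt0 e0 (ltr0Sn R 1).
  have [delta d0 H] := acf _ e20; have [delta' d0' H'] := acF _ e20.
  exists (Num.min delta delta'); first by rewrite lt_min d0.
  move=> s sin ssep; rewrite lt_min => /andP[sd sd'].
  have := H _ sin ssep sd; have := H' _ sin ssep sd'; rewrite /jumps => h h'.
  apply: (@le_lt_trans _ _ (jumps F s + jumps f s)); last by rewrite /jumps; lra.
  rewrite /jumps -big_split/=; apply: ler_sum => x _.
  rewrite [X in `|X|](_ : _ = (F x.2 - F x.1) - (f x.2 - f x.1)); last by ring.
  exact: ler_normB.
have [g1 [int1 g1E]] := nondecreasing_ac_density cd ndF acF.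
have [g2 [int2 g2E]] := nondecreasing_ac_density cd ndFf acFf.
pose g := g1 \- g2.
have intg : mu.-integrable [set: R] (EFin \o g).
  have -> : EFin \o g = (fun x => (EFin \o g1) x - (EFin \o g2) x)%E.
    by apply/funext => x.
  exact: integrableB.
have gE u v : c <= u -> u <= v -> v <= d ->
    (\int[mu]_(x in `]u, v]) (g x)%:E = (f v - f u)%:E)%E.
  move=> cu uv vd; under eq_integral do rewrite /g EFinB.
  rewrite integralB//; [|exact: integrableS int1|exact: integrableS int2].
  by rewrite g1E// g2E// -EFinB; congr EFin; rewrite /=; ring.
exists g; split => //.
have locg : locally_integrable [set: R] g.
  by apply: open_integrable_locally => //; exact: openT.
have := @FTC1 R g (BRight c).
have intgy y : mu.-integrable [set` Interval (BRight c) (BRight y)] (EFin \o g).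
  exact: integrableS intg.
move=> /(_ intgy locg); apply: filterS; first exact: (ae_filter_ringOfSetsType mu).
move=> x H /andP[cx xd]; have /H[] : (BRight c < BRight x)%O by rewrite bnd_simp.
set Fg := (F in derivable F x 1) => dF FE.
have fE : \forall y \near x, Fg y = f y - f c.
  near=> y; rewrite /Fg /Rintegral gE//=.
    by apply: ltW; near: y; exact: lt_nbhsr.
  by apply: ltW; near: y; exact: lt_nbhsl.
have dFg : is_derive x 1 Fg (g x) by apply: DeriveDef => //; rewrite -derive1E.
have dFc : is_derive x 1 (Fg + cst (f c)) (g x + 0) by exact: is_deriveD.
have dfg : is_derive x 1 f (g x).
  rewrite addr0 in dFc; apply: near_eq_is_derive dFc.
  by near=> y; rewrite fctE /= (near fE y)// subrK.
by split; [exact: ex_derive|rewrite derive1E; exact: derive_val].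
Unshelve. all: by end_near. Qed.

End ac_density.

(** * Borel versions of weak derivatives *)

Lemma ae_eq_integrable d (T : measurableType d) (R : realType)
    (mu : {measure set T -> \bar R}) (D : set T) (f g : T -> \bar R) :
  measurable D -> measurable_fun D g -> ae_eq mu D f g ->
  mu.-integrable D f -> mu.-integrable D g.
Proof.
move=> mD mg fg intf; have mf := measurable_int mu intf.
apply/integrableP; split => //; move/integrableP : intf => [_].
apply: le_lt_trans; rewrite le_eqVlt; apply/orP; left; apply/eqP.
apply: ae_eq_integral => //; try exact: measurableT_comp.
by apply: (ae_eq_comp (fun x : \bar R => `|x|%E)); exact: ae_eq_sym.
Qed.

Section ac_version.
Context {R : realType}.
Implicit Types (u v x : R) (f : R -> R) (J : set R).
Local Notation mu := (@lebesgue_measure R).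

(** Difference quotients along [1 / (n + 1)]: a sequence of Borel functions,
    whose limit is the derivative wherever it exists. *)
Definition diff_quotient (f : R -> R) (x : R) (n : nat) : R :=
  n.+1%:R * (f (x + n.+1%:R^-1) - f x).

Lemma cvg_diff_quotient f x : derivable f x 1 ->
  diff_quotient f x n @[n --> \oo] --> derive1 f x.
Proof.
move=> df; rewrite derive1E.
have : h^-1 *: ((f \o shift x) (h *: 1) - f x) @[h --> 0^'+] --> 'D_1 f x.
  exact: cvg_dnbhs_at_right.
move/cvg_at_rightP => /(_ (fun n => n.+1%:R^-1)) H.
have : ((n.+1%:R : R)^-1)^-1 *: ((f \o shift x) (n.+1%:R^-1 *: 1) - f x) @[n --> \oo] --> 'D_1 f x.
  by apply: H; split => //; exact: cvg_harmonic.
apply: cvg_trans; apply: near_eq_cvg; apply: nearW => n /=.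
rewrite /diff_quotient invrK; congr (_ * (f _ - _)).
by rewrite addrC; congr (_ + _); rewrite /GRing.scale/= mulr1.
Qed.

Lemma loc_abs_continuous_cont J f x : open J -> loc_abs_continuous J f ->
  J x -> {for x, continuous f}.
Proof.
move=> oJ acf Jx; have [e /= e0 eJ] := (@nbhs_ballP _ _ _ _).1 (oJ _ Jx).
pose c := x - e / 2; pose d := x + e / 2.
have cdJ : `[c, d] `<=` J.
  move=> y /=; rewrite in_itv/= => /andP[cy yd]; apply: eJ.
  by rewrite /ball/= ltr_norml; apply/andP; split; rewrite /c /d in cy yd *; lra.
have /abs_continuous_seq acs := acf _ _ cdJ.
apply/cvgrPdist_lt => eps eps0; have [delta d0 H] := acs _ eps0.
near=> y; have yx : `|x - y| < delta.
  by near: y; apply: cvgr_dist_lt => //; exact: cvg_id.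
have yx2 : `|x - y| < e / 2.
  by near: y; apply: cvgr_dist_lt; rewrite ?divr_gt0//; exact: cvg_id.
have wl u v : c <= u -> u <= v -> v <= d -> v - u < delta -> `|f v - f u| < eps.
  move=> cu uv vd uvd; have := H [:: (u, v)].
  rewrite /jumps /total_length !big_seq1 /= /inside /= cu uv vd.
  exact.
move: yx2; rewrite ltr_norml => /andP[h1 h2].
have [xy|yx'] := leP x y.
  by rewrite distrC wl// ?(le_lt_trans _ yx)// 1?distrC ?ler_norm// /c /d; lra.
by rewrite wl ?(ltW yx')// ?(le_lt_trans _ yx)// ?ler_norm// /c /d; lra.
Unshelve. all: by end_near. Qed.

(** The upper limit of the difference quotients is a Borel function that equals
    the derivative wherever there is one. A point of the open interval [J] lies
    in a subinterval with rational ends, of which there are countably many, so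
    almost everywhere differentiability passes from compact intervals to [J]. *)
Lemma loc_abs_continuous_version J f : open J -> is_interval J ->
  loc_abs_continuous J f -> exists D : R -> R,
  [/\ measurable_fun setT D, measurable_fun setT (f \_ J),
    {ae mu, forall x, J x -> derive1 f x = D x} &
    forall u v, J u -> J v -> u <= v ->
      mu.-integrable `]u, v] (EFin \o D) /\
      (\int[mu]_(x in `]u, v]) (D x)%:E = (f v - f u)%:E)%E].
Proof.
move=> oJ iJ acf; have mJ : measurable J by exact: open_measurable.
have mfJ : measurable_fun setT (f \_ J).
  have : measurable_fun J f.
    apply: open_continuous_measurable_fun => // x; rewrite inE => Jx.
    exact: loc_abs_continuous_cont Jx.
  by move/(measurable_restrictT f mJ).
pose fJ := f \_ J.
pose D x := fine (limn_esup (fun n => (diff_quotient fJ x n)%:E)).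
have DE x : J x -> derivable f x 1 -> derive1 f x = D x.
  move=> Jx df; have nJ : \near x, f x = fJ x.
    by near=> y; rewrite /fJ patchE mem_set//; near: y; exact: oJ.
  have dfJ : derivable fJ x 1 by exact: near_eq_derivable df.
  rewrite derive1E (near_eq_derive _ nJ) -derive1E.
  have cq : (diff_quotient fJ x n)%:E @[n --> \oo] --> (derive1 fJ x)%:E.
    by apply/fine_cvgP; split; [exact: nearW|exact: cvg_diff_quotient].
  rewrite /D is_cvg_limn_esupE; last by apply/cvg_ex; exists (derive1 fJ x)%:E.
  by rewrite (cvg_lim (@ereal_hausdorff R) cq).
have aed : {ae mu, forall x, J x -> derivable f x 1}.
  pose P n x := if (unpickle n : option (rat * rat)) is Some q then
     `[ratr q.1, ratr q.2] `<=` J -> ratr q.1 < x < ratr q.2 -> derivable f x 1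
     else True.
  have /ae_foralln : forall n, {ae mu, forall x, P n x}.
    move=> n; rewrite /P; case: unpickle => [[a b] /=|]; last exact: aeW.
    have [abJ|abJ] := pselect (`[ratr a, ratr b] `<=` J); last exact: aeW.
    have [ab|ba] := leP (ratr a : R) (ratr b); last first.
      by apply: aeW => x _ /andP[ax xb]; have := lt_trans (lt_trans ax xb) ba;
        rewrite ltxx.
    have [g [_ _]] := ac_density ab (abs_continuous_seq (acf _ _ abJ)).
    apply: filterS; first exact: (ae_filter_ringOfSetsType mu).
    by move=> x H _ /H[].
  apply: filterS => x H Jx; have [e /= e0 eJ] := (@nbhs_ballP _ _ _ _).1 (oJ _ Jx).
  have [a /[!in_itv]/= /andP[a1 a2]] := @rat_in_itvoo R (x - e) x ltac:(lra).
  have [b /[!in_itv]/= /andP[b1 b2]] := @rat_in_itvoo R x (x + e) ltac:(lra).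
  have := H (pickle (a, b)); rewrite /P pickleK /= a2 b1; apply => //.
  move=> y /=; rewrite in_itv/= => /andP[ay yb]; apply: eJ.
  by rewrite /ball/= ltr_norml; apply/andP; split; lra.
have aeD : {ae mu, forall x, J x -> derive1 f x = D x}.
  move: aed; apply: filterS; first exact: (ae_filter_ringOfSetsType mu).
  by move=> x H Jx; apply: DE => //; exact: H.
have mD : measurable_fun setT D.
  apply: measurableT_comp; first exact: fine_measurable.
  apply: measurable_fun_limn_esup => n.
  apply/measurable_EFinP; apply: measurable_funM => //.
  apply: measurable_funB => //.
  by apply: measurableT_comp => //; exact: measurable_funD.
exists D; split => // u v Ju Jv uv.
have uvJ : `[u, v] `<=` J.
  by move=> y /=; rewrite in_itv/= => /andP[uy yv]; apply: (iJ u v) => //; rewrite uy.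
have [g [intg gE gd]] := ac_density uv (abs_continuous_seq (acf _ _ uvJ)).
have Dg : ae_eq mu `]u, v]%classic (EFin \o D) (EFin \o g).
  have ae1 : {ae mu, forall x, x != v}.
    exists [set v]; split => //; first exact: lebesgue_measure_set1.
    by move=> x /= /negP; rewrite negbK => /eqP.
  move: ae1 aeD gd; apply: filterS3; first exact: (ae_filter_ringOfSetsType mu).
  move=> x xv DJ gx /=; rewrite in_itv/= => /andP[ux xv'].
  have xv2 : x < v by rewrite lt_neqAle xv.
  have /gx[_ <-] : u < x < v by rewrite ux.
  by rewrite DJ//; apply: uvJ; rewrite /= in_itv/= (ltW ux).
have intg' : mu.-integrable `]u, v] (EFin \o g) by exact: integrableS intg.
split.
  apply: ae_eq_integrable (ae_eq_sym Dg) intg' => //.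
  by apply/measurable_EFinP; exact: measurable_funTS.
rewrite -gE//; apply: ae_eq_integral => //.
- by apply/measurable_EFinP; exact: measurable_funTS.
- exact: measurable_int intg'.
Unshelve. all: by end_near. Qed.

End ac_version.

(** * Integration against a law with a density *)

Lemma measurable_invr (R : realType) :
  measurable_fun [set: R] (fun x : R => x^-1).
Proof.
have -> : [set: R] = [set 0] `|` ~` [set 0] by rewrite setUv.
apply/measurable_funU => //; first exact: measurableC.
split; first exact: measurable_fun_set1.
apply: open_continuous_measurable_fun.
  by apply: closed_openC; exact: closed_eq.
by move=> x; rewrite inE => /eqP x0; apply: inv_continuous.
Qed.

Lemma measurable_fun_inv d (T : measurableType d) (R : realType) (D : set T)
    (f : T -> R) :
  measurable_fun D f -> measurable_fun D (fun x => (f x)^-1).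
Proof. by move=> mf; apply: measurableT_comp mf; exact: measurable_invr. Qed.

Section density.
Context d (T : measurableType d) (R : realType).
Context (mu nu : {measure set T -> \bar R}) (p : T -> R).
Hypotheses (mp : measurable_fun setT p) (p0 : forall x, 0 <= p x).
Hypothesis nuE : forall A, measurable A -> nu A = (\int[mu]_(x in A) (p x)%:E)%E.
Import HBNNSimple.

Local Open Scope ereal_scope.

(** For simple functions this is the definition of the density; monotone
    convergence does the rest. *)
Lemma ge0_integral_density (f : T -> \bar R) : measurable_fun setT f ->
  (forall x, 0 <= f x) -> \int[nu]_x f x = \int[mu]_x (f x * (p x)%:E).
Proof.
move=> mf f0; pose g := EFin \o p.
have mg : measurable_fun setT g by exact/measurable_EFinP.
have g0 x : 0 <= g x by rewrite lee_fin.
pose h := nnsfun_approx measurableT mf.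
have -> : \int[nu]_x f x = lim (\int[nu]_x (EFin \o h n) x @[n --> \oo]).
  have fE x : f x = lim ((EFin \o h n) x @[n --> \oo]).
    by apply/esym/cvg_lim => //; exact: cvg_nnsfun_approx.
  under eq_integral => x _ do rewrite fE.
  apply: monotone_convergence => //.
  - by move=> n; apply/measurable_EFinP.
  - by move=> n x _ /=; rewrite lee_fin.
  - by move=> x _ a b ab; rewrite lee_fin; exact/lefP/nd_nnsfun_approx.
have -> : \int[mu]_x (f x * (p x)%:E) =
    lim (\int[mu]_x ((EFin \o h n) \* g) x @[n --> \oo]).
  have fg x : f x * g x = lim (((EFin \o h n) \* g) x @[n --> \oo]).
    by apply/esym/cvg_lim => //; apply: cvgeZr => //; exact: cvg_nnsfun_approx.
  under eq_integral => x _ do rewrite (fg x).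
  apply: monotone_convergence => [//| | |].
  - by move=> n; apply/emeasurable_funM => //; exact/measurable_EFinP.
  - by move=> n x _ /=; rewrite mule_ge0 ?lee_fin.
  - by move=> x _ a b ab/=; rewrite lee_wpmul2r ?lee_fin//; exact/lefP/nd_nnsfun_approx.
suff suf n : \int[mu]_x ((EFin \o h n) x * g x) = \int[nu]_x (EFin \o h n) x.
  by under [in RHS]eq_fun do rewrite suf.
transitivity (\int[nu]_x
   (\sum_(y \in range (h n)) (y * \1_(h n @^-1` [set y]) x)%:E)); last first.
  by apply: eq_integral => t _; rewrite /= fimfunE -fsumEFin.
have indich m r : measurable_fun setT (fun x => (r * \1_(h m @^-1` [set r]) x)%:E).
  by apply: (measurable_comp measurableT) => //; exact: measurable_funM.
rewrite ge0_integral_fsum//; last by move=> m y _; exact: nnfun_muleindic_ge0.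
transitivity (\int[mu]_x (\sum_(y \in range (h n))
    (y * \1_(h n @^-1` [set y]) x)%:E * g x)).
  under [RHS]eq_integral => x xE.
    rewrite -ge0_mule_fsuml => [|y]; last exact: nnfun_muleindic_ge0.
    rewrite fsumEFin // -(fimfunE _ x); over.
  by [].
rewrite ge0_integral_fsum//; last 2 first.
  - by move=> y; apply: emeasurable_funM.
  - by move=> m y _; rewrite mule_ge0// nnfun_muleindic_ge0.
apply: eq_fsbigr => r rhn.
under [RHS]eq_integral do rewrite EFinM.
rewrite integralZl_indic_nnsfun => //.
under eq_integral do rewrite EFinM -muleA.
rewrite ge0_integralZl//.
- under eq_integral do rewrite muleC.
  rewrite (eq_integral (g \_ (h n @^-1` [set r]))); last first.
    by move=> x xE; rewrite epatch_indic.
  by rewrite -integral_mkcond -nuE// integral_indic// setIT.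
- by apply: emeasurable_funM => //; exact/measurable_EFinP.
- by move=> t _; rewrite mule_ge0 ?lee_fin.
- by move: rhn; rewrite inE => -[t _ <-]; rewrite lee_fin.
Qed.

Lemma density_negligible (A : set T) : measurable A -> mu A = 0 -> nu A = 0.
Proof.
move=> mA A0; rewrite nuE//.
rewrite (ge0_negligible_integral mA mA) ?setDv ?integral_set0//.
  by apply/measurable_EFinP; exact: measurable_funTS.
by move=> x _; rewrite lee_fin.
Qed.

(** Dividing by [p] compensates the density only where [p] is positive, hence
    the condition on the zeros of [f]. The absolute value and the positive and
    negative parts are treated alike: they are positively homogeneous functions
    of [f]. *)
Lemma integral_density (f : T -> R) : measurable_fun setT f ->
  {ae mu, forall x, f x != 0%R -> (0 < p x)%R} ->
  mu.-integrable setT (EFin \o f) ->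
  nu.-integrable setT (fun x => (f x / p x)%:E) /\
  \int[nu]_x (f x / p x)%:E = \int[mu]_x (f x)%:E.
Proof.
move=> mf fp intf; pose q x := (f x / p x)%R.
have mq : measurable_fun setT q.
  by apply: measurable_funM => //; exact: measurable_fun_inv.
have key (F : R -> R) : measurable_fun setT F -> (forall x, 0 <= F x)%R ->
    F 0%R = 0%R -> (forall a b, 0 <= b -> F (a * b) = F a * b)%R ->
    \int[nu]_x (F (q x))%:E = \int[mu]_x (F (f x))%:E.
  move=> mF F0 F00 FM; rewrite ge0_integral_density//; last 2 first.
    by apply/measurable_EFinP; exact: measurableT_comp.
    by move=> x; rewrite lee_fin.
  have mFq : measurable_fun setT (F \o q) by exact: measurableT_comp.
  apply: ge0_ae_eq_integral => //.
  - by apply: emeasurable_funM; exact/measurable_EFinP.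
  - by apply/measurable_EFinP; exact: measurableT_comp.
  - by move=> x _; rewrite mule_ge0// lee_fin.
  - by move=> x _; rewrite lee_fin.
  move: fp; apply: filterS => x fp _; rewrite -EFinM -FM// /q.
  have [->|/fp px] := eqVneq (f x) 0%R; first by rewrite !mul0r F00.
  by rewrite divfK// gt_eqF.
have intq : nu.-integrable setT (EFin \o q).
  apply/integrableP; split; first exact/measurable_EFinP.
  have /integrableP[_] := intf; rewrite /=; under eq_integral do rewrite /=.
  rewrite -[in X in X -> _](key Num.norm)//.
  - exact: normr0.
  - by move=> a b b0; rewrite normrM (ger0_norm b0).
split => //.
rewrite [LHS]integralE [RHS]integralE; congr (_ - _).
- under eq_integral do rewrite funeposE -EFin_max.
  under [RHS]eq_integral do rewrite funeposE -EFin_max.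
  apply: (key (fun y => Num.max y 0)%R).
  + exact: measurable_maxr.
  + by move=> x; rewrite le_max lexx orbT.
  + by rewrite maxxx.
  + by move=> a b b0; rewrite maxr_pMl// mul0r.
- under eq_integral do rewrite funenegE -EFinN -EFin_max.
  under [RHS]eq_integral do rewrite funenegE -EFinN -EFin_max.
  apply: (key (fun y => Num.max (- y) 0)%R).
  + by apply: measurable_maxr => //; exact: measurable_funN.
  + by move=> x; rewrite le_max lexx orbT.
  + by rewrite oppr0 maxxx.
  + by move=> a b b0; rewrite maxr_pMl// mul0r mulNr.
Qed.

End density.

(** The law of a real random variable and the reference measure live on two
    displays of the Borel sets of the line; pushing the latter forward along the
    identity brings both to the same one. *)
Section law_density.
Context {R : realType} (mu : {measure set (measurableTypeR R) -> \bar R}).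
Context (nu : probability R R) (p : R -> R).
Hypotheses (mp : measurable_fun [set: R] p) (p0 : forall x, 0 <= p x).
Hypothesis nuE : forall A : set R, measurable A ->
  nu A = (\int[mu]_(x in A) (p x)%:E)%E.

Let toR : measurableTypeR R -> R := idfun.

Let mtoR : measurable_fun [set: measurableTypeR R] toR.
Proof. by move=> _ A mA; rewrite setTI. Qed.

Let muR : set R -> \bar R := pushforward mu toR.

Let muR0 : muR set0 = 0%E. Proof. exact: (measure0 mu). Qed.

Let muR_ge0 A : (0 <= muR A)%E. Proof. exact: (measure_ge0 mu). Qed.

Let muR_sigma_additive : semi_sigma_additive muR.
Proof. by move=> F mF tF mUF; apply: (@measure_semi_sigma_additive _ _ _ mu F). Qed.

HB.instance Definition _ :=
  isMeasure.Build _ _ _ muR muR0 muR_ge0 muR_sigma_additive.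

Let nuRE (A : set R) : measurable A -> nu A = (\int[muR]_(x in A) (p x)%:E)%E.
Proof.
move=> mA; rewrite nuE// /muR [RHS]ge0_integral_pushforward//.
  by apply/measurable_EFinP; exact: measurable_funTS.
by move=> x _; rewrite lee_fin.
Qed.

Lemma law_negligible (A : set R) : measurable A -> mu A = 0%E -> nu A = 0%E.
Proof. by move=> mA A0; apply: (density_negligible mp p0 nuRE mA). Qed.

Lemma law_integral (f : R -> R) : measurable_fun [set: R] f ->
  {ae mu, forall x, f x != 0 -> 0 < p x} ->
  mu.-integrable [set: R] (EFin \o f) ->
  nu.-integrable [set: R] (fun x => (f x / p x)%:E) /\
  (\int[nu]_x (f x / p x)%:E = \int[mu]_x (f x)%:E)%E.
Proof.
move=> mf fp intf.
have intfR : muR.-integrable [set: R] (EFin \o f).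
  apply: (integrable_pushforward mtoR) => //; exact/measurable_EFinP.
have [? ->] := integral_density mp p0 nuRE mf fp intfR; split => //.
have mEf : measurable_fun [set: R] (EFin \o f) by exact/measurable_EFinP.
exact: (integral_pushforward mtoR mEf intf measurableT).
Qed.

End law_density.

(** * The counting measure on the integers *)

Section counting_integral.
Context {R : realType}.
Variable ell : int.
Hypothesis ell0 : ell != 0.
Local Notation mu := (@refmeas R ell).

Lemma refmeas_counting (A : set R) : mu A = counting (A `&` integers).
Proof. by rewrite /refmeas (negbTE ell0). Qed.

Lemma refmeas_set1 (i : int) : mu [set i%:~R : R] = 1%E.
Proof.
have -> : mu [set i%:~R : R] = counting [set i%:~R : R].
  rewrite refmeas_counting; congr (counting _); apply/setIidl => _ ->.
  by exists i.
rewrite /counting asboolT; last exact: finite_set1.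
by have := finmap.cardfs1 (i%:~R : R); rewrite fset_set1 => ->.
Qed.

Lemma ae_integers : {ae mu, forall x, integers x}.
Proof.
exists (~` integers); split => //; first exact: measurableC measurable_integers.
rewrite [LHS]refmeas_counting setICl /counting asboolT; last exact: finite_set0.
by rewrite fset_set0.
Qed.

(** The only integer of the unit interval from [i] to [i + 1] that is closed on
    the left if [b] holds and on the right otherwise. *)
Let site (b : bool) (i : int) : int := i + (~~ b)%:Z.

Let unit_itv (b : bool) (i : int) : set (measurableTypeR R) :=
  [set` Interval (BSide b (i%:~R : R)) (BSide b ((i + 1)%:~R))].

Let unit_itv_integers b i : unit_itv b i `&` integers = [set (site b i)%:~R].
Proof.
rewrite /unit_itv /site; case: b => /=; apply/seteqP; split => x /=.
- rewrite addr0 in_itv/= => -[/andP[+ +] [j _ jx]]; rewrite -jx ler_int ltr_int.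
  by rewrite ltzD1 => ij ji; congr (_%:~R); apply/le_anti; rewrite ij ji.
- by rewrite addr0 => ->; rewrite in_itv/= lexx ltr_int ltrDl; split => //; exists i.
- rewrite in_itv/= => -[/andP[+ +] [j _ jx]]; rewrite -jx ler_int ltr_int.
  by rewrite -lezD1 => ij ji; congr (_%:~R); apply/le_anti; rewrite ij ji.
- by move=> ->; rewrite in_itv/= lexx ltr_int ltrDl; split => //; exists (i + 1)%R.
Qed.

Lemma integral_integers (b : bool) (i : int) (k : nat) (phi : R -> \bar R) :
  measurable_fun [set: measurableTypeR R] phi ->
  (forall x, ~ integers x -> phi x = 0%E) ->
  (\int[mu]_(x in [set` Interval (BSide b (i%:~R : R)) (BSide b ((i + k%:Z)%:~R))]) phi x =
   \sum_(m < k) phi ((i + m%:Z + (~~ b)%:Z)%:~R))%E.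
Proof.
move=> mphi phi0; elim: k => [|k IH].
  by rewrite big_ord0 addr0 set_itv_ge ?integral_set0// bnd_simp ltxx.
rewrite (@itv_bndbnd_setU _ _ _ (BSide b ((i + k%:Z)%:~R))) ?bnd_simp ?ler_int; last 2 first.
- by rewrite lerDl.
- by rewrite lerD2l lez_nat.
rewrite integral_setU//; last 2 first.
- exact: measurable_funTS.
- apply/disj_setPS => x [] /=; rewrite !itv_boundlr => /andP[_ h] /andP[h' _].
  by have := le_trans h h'; rewrite bnd_simp ltxx.
rewrite IH big_ord_recr /=; congr (_ + _)%E.
have -> : i + k.+1%:Z = i + k%:Z + 1 by rewrite -addrA -PoszD addn1.
rewrite -/(unit_itv b (i + k%:Z)).
transitivity (\int[mu]_(x in unit_itv b (i + k%:Z)) (phi \_ integers) x)%E.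
  apply: eq_integral => x _; rewrite patchE; case: ifPn => //.
  by rewrite notin_setE => /phi0.
rewrite -integral_mkcondr unit_itv_integers.
transitivity (\int[mu]_(x in [set (site b (i + k%:Z))%:~R])
    cst (phi ((site b (i + k%:Z))%:~R)) x)%E.
  by apply: eq_integral => x; rewrite inE => ->.
by rewrite integral_cst// [X in (_ * X)%E]refmeas_set1 mule1.
Qed.

Lemma measurable_fun_integers (f : R -> R) : measurable_fun [set: R] (f \_ integers).
Proof.
have mZ : measurable (integers : set R) := @measurable_integers R.
apply/(measurable_restrictT f mZ) => _ B mB; apply: countable_measurable => //.
apply: (@sub_countable _ _ _ (integers : set R)).
  by apply: subset_card_le; exact: subIsetl.
by apply: (sub_countable (card_image_le _ _)); exact: countableP.
Qed.

End counting_integral.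

(** * The kernel integrates a difference to an increment *)

Section kernel_versions.
Context {R : realType} (nu : probability R R) (p : R -> R).

(** The functions of the statement need not be Borel, even off a null set that
    depends on them; [g] and [D] are Borel functions that equal [f] and its
    difference on the full set [G]. The last field is the reason for the kernel:
    it turns a difference operator back into an increment. *)
Record kernel_version (l : int) (f g D : R -> R) (G : set R) : Prop := {
  kv_measurable_set : measurable G;
  kv_full : nu (~` G) = 0%E;
  kv_measurable_fun : measurable_fun [set: R] g;
  kv_measurable_diff : measurable_fun [set: R] D;
  kv_fun : forall x, G x -> f x = g x;
  kv_diff : forall x, G x -> Delta (- l) f x = D x;
  kv_integral : forall u v, G u -> G v -> u <= v ->
    nu.-integrable [set: R] (fun x => (Phi_p p l u x v * D x)%:E) /\
    (\int[nu]_x (Phi_p p l u x v * D x)%:E = (g v - g u)%:E)%E }.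

Lemma measurable_chi d (T : measurableType d) (l : int) (f g : T -> R) :
  measurable_fun setT f -> measurable_fun setT g ->
  measurable_fun setT (fun x => chi l (f x) (g x)).
Proof.
move=> mf mg; apply: measurable_fun_ifT => //.
by apply: measurable_fun_ler => //; exact: measurable_funB.
Qed.

Lemma chi_ge0 (l : int) (x y : R) : 0 <= chi l x y.
Proof. by rewrite /chi; case: ifP. Qed.

Variable ell : int.
Local Notation mu := (@refmeas R ell).
Hypothesis supp_p : standing_assumption ell p.
Hypotheses (mp : measurable_fun [set: R] p) (p0 : forall x, 0 <= p x).
Hypothesis nuE : forall A : set R, measurable A ->
  nu A = (\int[mu]_(x in A) (p x)%:E)%E.

(** The indicators in the kernel select the set [S] of points between [u] and
    [v], and the factor [1 / p] turns the law into the reference measure. *)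
Lemma kernel_integral (l : int) (D : R -> R) (S : set R) (u v c : R) :
  measurable S -> measurable_fun [set: R] D ->
  {ae mu, forall x, chi l u x * chi (- l) x v * D x = (D \_ S) x} ->
  {ae mu, forall x, S x -> 0 < p x} ->
  mu.-integrable S (EFin \o D) ->
  (\int[mu]_(x in S) (D x)%:E = c%:E)%E ->
  nu.-integrable [set: R] (fun x => (Phi_p p l u x v * D x)%:E) /\
  (\int[nu]_x (Phi_p p l u x v * D x)%:E = c%:E)%E.
Proof.
move=> mS mD aeS aep intD cE.
pose phi x := chi l u x * chi (- l) x v * D x.
have mphi : measurable_fun [set: R] phi.
  by apply: measurable_funM => //; apply: measurable_funM; exact: measurable_chi.
have DS : ae_eq mu setT (EFin \o (D \_ S)) (EFin \o phi).
  apply: (@filterS _ _ (ae_filter_ringOfSetsType mu) _ _ _ aeS) => x /= xE _.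
  by rewrite -xE.
have intDS : mu.-integrable setT (EFin \o (D \_ S)).
  have mS' : (measurable : set (set (measurableTypeR R))) S by [].
  have := (@integrable_mkcond _ (measurableTypeR R) R mu S (EFin \o D) mS').1 intD.
  by rewrite restrict_EFin.
have intphi : mu.-integrable setT (EFin \o phi).
  by apply: ae_eq_integrable DS intDS => //; exact/measurable_EFinP.
have aephi : {ae mu, forall x, phi x != 0 -> 0 < p x}.
  apply: (@filterS2 _ _ (ae_filter_ringOfSetsType mu) _ _ _ _ aeS aep) => x xE xp.
  rewrite /phi xE patchE.
  by case: ifPn => [|_]; [rewrite inE => /xp|rewrite eqxx].
have [intq qE] := law_integral mp p0 nuE mphi aephi intphi.
have PhiE x : Phi_p p l u x v * D x = phi x / p x by rewrite /Phi_p /phi mulrAC.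
split; first by under eq_fun do rewrite PhiE.
under eq_integral do rewrite PhiE.
rewrite qE -cE [RHS]integral_mkcond restrict_EFin.
apply: ae_eq_integral => //; [exact/measurable_EFinP| |exact: ae_eq_sym].
exact: measurable_int intDS.
Qed.

Lemma measurable_possupp : measurable (possupp p).
Proof.
have -> : possupp p = setT `&` p @^-1` `]0, +oo[.
  by apply/seteqP; split => x /=; rewrite in_itv/= andbT; [split|case].
exact: mp.
Qed.

Lemma law_outside_support (A : set R) : measurable A ->
  A `<=` ~` possupp p -> nu A = 0%E.
Proof.
move=> mA Ap; rewrite nuE//; apply: integral0_eq => x /Ap.
rewrite /possupp/= => /negP; rewrite -leNgt => px.
by congr EFin; apply/le_anti; rewrite px p0.
Qed.

(** The kernel selects the integers from [u] to [v - 1] if [l = -1], for which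
    the forward difference is summed, and those from [u + 1] to [v] if [l = 1],
    for which the backward difference is: both sums telescope. All integers
    between two points of the support belong to it, so [p] is positive there. *)
Lemma discrete_kernel_version (l : int) (f : R -> R) :
  ell != 0 -> l = -1 \/ l = 1 -> exists g D G, kernel_version l f g D G.
Proof.
move=> ell0 l1; pose Z := @integers R.
exists (f \_ Z), (Delta (- l) f \_ Z), (possupp p).
have mD : measurable_fun [set: R] (Delta (- l) f \_ Z).
  exact: measurable_fun_integers.
have [a [b [_ _ suppE]]] : discrete_support p.
  by move: supp_p; rewrite /standing_assumption (negbTE ell0).
have pZ x : possupp p x -> Z x by rewrite suppE => -[].
split => //.
- exact: measurable_possupp.
- by apply: law_outside_support => //; apply: measurableC; exact: measurable_possupp.
- exact: measurable_fun_integers.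
- by move=> x px; rewrite patchE mem_set//; exact: pZ.
- by move=> x px; rewrite patchE mem_set//; exact: pZ.
move=> u v pu pv uv.
have [i _ iu] := pZ _ pu; have [j _ jv] := pZ _ pv.
have [k jE] : exists k : nat, j = i + k%:Z.
  exists `|j - i|%N; rewrite gez0_abs ?subrKC// subr_ge0.
  by move: uv; rewrite -iu -jv ler_int.
(* Half-open interval, closed at [u] for the forward difference. *)
pose c := (l == -1); pose S := [set` Interval (BSide c u) (BSide c v)] : set R.
have SE : S = [set` Interval (BSide c (i%:~R : R)) (BSide c ((i + k%:Z)%:~R))].
  by rewrite /S -iu -jv jE.
have DZ : forall x, ~ Z x -> (Delta (- l) f \_ Z) x = 0.
  by move=> x Zx; rewrite patchE memNset.
have DE (m : nat) : (Delta (- l) f \_ Z) ((i + m%:Z + (~~ c)%:Z)%:~R) =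
    f ((i + m.+1%:Z)%:~R) - f ((i + m%:Z)%:~R).
  rewrite patchE mem_set; last by eexists.
  have -> : i + m.+1%:Z = i + m%:Z + 1 by rewrite -[m.+1]addn1 PoszD addrA.
  rewrite /c /Delta; case: l1 => -> /=.
    by rewrite opprK !addr0 divr1 -intrD.
  rewrite mulrN1z invrN1 mulrN1 opprB.
  by rewrite [in X in _ - f X]intrD addrK.
apply: (kernel_integral (S := S)) => //.
- exact: measurable_itv.
- apply: (@filterS _ _ (ae_filter_ringOfSetsType mu) _ _ _ (ae_integers ell0)).
  move=> _ [m _ <-].
  have memS : ((m%:~R : R) \in S) = (chi l u m%:~R * chi (- l) m%:~R v == 1).
    rewrite /S mem_setE /c /chi -iu -jv.
    have e (y : int) : y%:~R - 1 = (y - 1)%:~R :> R by rewrite intrB.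
    case: l1 => -> /=; rewrite ?opprK /= in_itv/= ?subr0 e !ler_int ltr_int.
      by rewrite lerBrDr lezD1; case: (i <= m); case: (m < j); rewrite ?mulr0 ?mulr1 ?eqxx// eq_sym oner_eq0.
    by rewrite lerBrDr lezD1; case: (i < m); case: (m <= j);
      rewrite ?mulr0 ?mulr1 ?mul0r ?eqxx// eq_sym oner_eq0.
  have chi01 : chi l u m%:~R * chi (- l) m%:~R v = 0 \/ chi l u m%:~R * chi (- l) m%:~R v = 1.
    by rewrite /chi; do 2 case: ifP => _; rewrite ?mulr0 ?mulr1 ?mul0r; [right|left|left|left].
  rewrite [RHS]patchE memS; case: chi01 => ->; first by rewrite mul0r eq_sym oner_eq0.
  by rewrite mul1r eqxx.
- apply: (@filterS _ _ (ae_filter_ringOfSetsType mu) _ _ _ (ae_integers ell0)).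
  move=> x Zx Sx; suff : possupp p x by [].
  have [ux xv] : u <= x /\ x <= v.
    move: Sx; rewrite /S /= /c; case: l1 => -> /=; rewrite in_itv/= => /andP[ux xv].
      by split => //; exact: ltW.
    by split => //; exact: ltW.
  move: pu pv; rewrite suppE => -[[au _] _] [[_ vb] _]; split => //; split.
    by rewrite (le_trans au)// lee_fin.
  by rewrite (le_trans _ vb)// lee_fin.
- apply/integrableP; split; first by apply/measurable_EFinP; exact: measurable_funTS.
  rewrite SE integral_integers//; last 2 first.
  + by apply: measurableT_comp => //; exact/measurable_EFinP.
  + by move=> x /DZ /= ->; rewrite normr0.
  by rewrite sumEFin ltry.
- rewrite SE integral_integers//; last 2 first.
  + exact/measurable_EFinP.
  + by move=> x /DZ ->.
  under eq_bigr do rewrite DE.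
  rewrite sumEFin -(big_mkord xpredT (fun m => f ((i + m.+1%:Z)%:~R) - f ((i + m%:Z)%:~R))).
  rewrite telescope_sumr// addr0 -jE iu jv.
  by rewrite !patchE !mem_set//; apply: pZ.
Qed.

Lemma ereal_itv_interval (a b : \bar R) : is_interval (ereal_itv a b).
Proof.
move=> x y [ax _] [_ yb] z /andP[xz zy]; split.
  by rewrite (le_trans ax)// lee_fin.
by rewrite (le_trans _ yb)// lee_fin.
Qed.

Lemma interior_interval (E : set R) : is_interval E -> is_interval (interior E).
Proof.
move=> iE x y Ex Ey z /andP[]; rewrite le_eqVlt => /orP[/eqP<-//|xz].
rewrite le_eqVlt => /orP[/eqP->//|zy].
have xE := interior_subset Ex; have yE := interior_subset Ey.
have zxy : z \in `]x, y[ by rewrite in_itv/= xz.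
near=> t; apply: (iE x y) => //; apply/andP; split; apply: ltW.
  by near: t; exact: lt_nbhsr.
by near: t; exact: lt_nbhsl.
Unshelve. all: by end_near. Qed.

(** A point of an interval off its interior is an end, and the end is finite. *)
Lemma ereal_itv_boundary (a b : \bar R) (x : R) :
  ereal_itv a b x -> ~ interior (ereal_itv a b) x -> x = fine a \/ x = fine b.
Proof.
move=> [ax xb] nx; apply: contrapT => /not_orP[xa xb']; apply: nx.
have {}ax : (a < x%:E)%E.
  rewrite lt_neqAle ax andbT; apply/eqP => h; apply: xa; by rewrite h.
have {}xb : (x%:E < b)%E.
  rewrite lt_neqAle xb andbT; apply/eqP => h; apply: xb'; by rewrite -h.
have na : \forall t \near x, (a < t%:E)%E.
  move: ax; case: (a) => [a'| |] //=; last by move=> _; near=> t; exact: ltNyr.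
  by rewrite lte_fin => h; near=> t; rewrite lte_fin; near: t; exact: lt_nbhsr.
have nb : \forall t \near x, (t%:E < b)%E.
  move: xb; case: (b) => [b'| |] //=; last by move=> _; near=> t; exact: ltry.
  by rewrite lte_fin => h; near=> t; rewrite lte_fin; near: t; exact: lt_nbhsl.
by near=> t; split; apply: ltW; near: t.
Unshelve. all: by end_near. Qed.

(** The fundamental theorem of calculus for a function that is locally absolutely
    continuous inside the support interval. The law charges neither the ends of
    the interval, nor its complement, nor the null set off which the derivative
    has a Borel version. *)
Lemma continuous_kernel_version (f : R -> R) :
  ell = 0 -> in_dom p 0 f -> exists g D G, kernel_version 0 f g D G.
Proof.
move=> ell0 /(_ erefl) acf; pose C := closure (possupp p); pose J := interior C.
have [[a [b CE]] Cp] : continuous_support p.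
  by move: supp_p; rewrite /standing_assumption ell0.
have muE : mu = [the {measure set (measurableTypeR R) -> \bar R} of @lebesgue_measure R].
  by rewrite /refmeas ell0.
have mC : measurable C by apply: closed_measurable; exact: closed_closure.
have oJ : open J by exact: open_interior.
have mJ : measurable J by exact: open_measurable.
have JC : J `<=` C by exact: interior_subset.
have iJ : is_interval J.
  by apply: interior_interval; rewrite /C CE; exact: ereal_itv_interval.
have [D [mD mg [N [mN N0 ND]] intD]] := loc_abs_continuous_version oJ iJ acf.
have mN' : measurable (N : set R) by [].
have mCp : measurable (C `\` possupp p).
  by apply: measurableD => //; exact: measurable_possupp.
have muCp : mu (C `\` possupp p) = 0%E by rewrite muE.
exists (f \_ J), D, (J `\` N); split => //.
- exact: measurableD.
- rewrite setCD; apply/eqP; rewrite eq_le measure_ge0 andbT.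
  have mCJ : measurable (C `\` J) by exact: measurableD.
  apply: (@le_trans _ _ (nu ((~` C `|` (C `\` J)) `|` N))).
    apply: le_measure; rewrite ?inE//.
    + by apply: measurableU => //; exact: measurableC.
    + by do 2 apply: measurableU => //; exact: measurableC.
    + move=> x [Jx|Nx]; last by right.
      by left; have [Cx|Cx] := pselect (C x); [right|left].
  have mCc := measurableC mC.
  have nuN : nu N = 0%E by apply: (law_negligible mp p0 nuE mN'); rewrite muE.
  have nuC : nu (~` C) = 0%E.
    by apply: law_outside_support => //; apply: subsetC; exact: subset_closure.
  suff nuCJ : nu (C `\` J) = 0%E.
    apply: (@le_trans _ _ (nu (~` C `|` (C `\` J)) + nu N)%E).
      by apply: measureU2 => //; exact: measurableU.
    rewrite nuN adde0 -[leRHS]adde0 -{1}nuC -nuCJ.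
    exact: measureU2.
  apply: (law_negligible mp p0 nuE mCJ); rewrite muE.
  have mab : (measurable : set (set (measurableTypeR R))) [set fine a; fine b].
    by apply: measurableU; exact: measurable_set1.
  have mCJ' : (measurable : set (set (measurableTypeR R))) (C `\` J) by [].
  apply: (subset_measure0 mCJ' mab).
    by move=> x [Cx Jx]; apply: ereal_itv_boundary; rewrite -CE.
  apply/eqP; rewrite eq_le measure_ge0 andbT.
  apply: (@le_trans _ _ (lebesgue_measure [set fine a] + lebesgue_measure [set fine b])%E).
    by apply: measureU2; exact: measurable_set1.
  by rewrite !lebesgue_measure_set1 adde0.
- by move=> x [Jx _]; rewrite patchE mem_set.
- by move=> x [Jx Nx]; apply: contrapT => h; apply: Nx; apply: ND => /(_ Jx).
move=> u v [Ju _] [Jv _] uv; have [intDuv DE] := intD u v Ju Jv uv.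
have uvJ : `[u, v] `<=` J.
  by move=> y /=; rewrite in_itv/= => /andP[uy yv]; apply: (iJ u v) => //; rewrite uy.
rewrite !patchE !mem_set//; apply: (kernel_integral (S := `]u, v])) => //.
- exists [set u]; split => //; first by rewrite muE; exact: lebesgue_measure_set1.
  move=> x /= h; apply: contrapT => xu; apply: h; rewrite /chi /= !subr0.
  rewrite patchE mem_setE in_itv/= lt_neqAle.
  have -> /= : u != x by apply/eqP => ux; exact: xu.
  by case: (u <= x); case: (x <= v); rewrite /= ?mulr0 ?mulr1 ?mul0r ?mul1r.
- exists (C `\` possupp p); split => //.
  move=> x /=; rewrite in_itv/= => h; split.
    apply: JC; apply: uvJ; rewrite /= in_itv/=; apply: contrapT => h'; apply: h.
    by move=> /andP[ux xv]; exfalso; apply: h'; rewrite (ltW ux).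
  by move=> px; apply: h => _.
- by rewrite muE.
- by rewrite muE.
Qed.

End kernel_versions.

(** * Lagrange's identity *)

Section linear_combination.
Context d (T : measurableType d) (R : realType) (mu : {measure set T -> \bar R}).
Local Open Scope ereal_scope.

Lemma integrable_lin3 (c1 c2 c3 : R) (f1 f2 f3 : T -> R) :
  mu.-integrable setT (EFin \o f1) -> mu.-integrable setT (EFin \o f2) ->
  mu.-integrable setT (EFin \o f3) ->
  mu.-integrable setT (fun x => (c1 * f1 x + c2 * f2 x + c3 * f3 x)%:E).
Proof.
move=> i1 i2 i3; under eq_fun do rewrite !EFinD !EFinM.
have j1 : mu.-integrable setT (fun x => c1%:E * (f1 x)%:E) by exact: integrableZl.
have j2 : mu.-integrable setT (fun x => c2%:E * (f2 x)%:E) by exact: integrableZl.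
have j3 : mu.-integrable setT (fun x => c3%:E * (f3 x)%:E) by exact: integrableZl.
by apply: integrableD => //; exact: integrableD.
Qed.

Lemma integral_lin3 (c1 c2 c3 : R) (f1 f2 f3 : T -> R) (I1 I2 I3 : R) :
  mu.-integrable setT (EFin \o f1) -> mu.-integrable setT (EFin \o f2) ->
  mu.-integrable setT (EFin \o f3) ->
  \int[mu]_x (f1 x)%:E = I1%:E -> \int[mu]_x (f2 x)%:E = I2%:E ->
  \int[mu]_x (f3 x)%:E = I3%:E ->
  \int[mu]_x (c1 * f1 x + c2 * f2 x + c3 * f3 x)%:E =
    (c1 * I1 + c2 * I2 + c3 * I3)%:E.
Proof.
move=> i1 i2 i3 E1 E2 E3.
under eq_integral do rewrite !EFinD !EFinM.
have j1 : mu.-integrable setT (fun x => c1%:E * (f1 x)%:E) by exact: integrableZl.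
have j2 : mu.-integrable setT (fun x => c2%:E * (f2 x)%:E) by exact: integrableZl.
have j3 : mu.-integrable setT (fun x => c3%:E * (f3 x)%:E) by exact: integrableZl.
rewrite integralD//; last exact: integrableD.
by rewrite integralD// !integralZl// E1 E2 E3 !EFinD !EFinM.
Qed.

End linear_combination.

Section lagrange_identity.
Context {R : realType} (nu : probability R R).
Local Open Scope ereal_scope.

Lemma ae_full (G : set R) : measurable G -> nu (~` G) = 0 ->
  {ae nu, forall x, G x}.
Proof.
by move=> mG nG; exists (~` G); split => //; exact: measurableC.
Qed.

Lemma measurable_inner (F : R * R -> R) :
  measurable_fun setT F -> (forall x y, 0 <= F (x, y))%R ->
  measurable_fun setT (fun x => \int[nu]_y (F (x, y))%:E).
Proof.
move=> mF F0; apply: (measurable_fun_fubini_tonelli_F (EFin \o F)).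
  exact/measurable_EFinP.
by move=> [x y]; rewrite lee_fin.
Qed.

(** Exchanging the two variables swaps the two sides of the diagonal, on which
    the integrand vanishes; [c] is the indicator of one side. *)
Lemma integral_half (c : R -> R -> R) (F : R * R -> R) (G : set R) :
  measurable G -> nu (~` G) = 0 ->
  measurable_fun setT (fun z : R * R => c z.1 z.2) -> (forall x y, 0 <= c x y)%R ->
  measurable_fun setT F -> (forall z, 0 <= F z)%R ->
  (forall x y, F (x, y) = F (y, x)) -> (forall x, F (x, x) = 0%R) ->
  (forall x y, G x -> G y -> x != y -> c x y + c y x = 1)%R ->
  \int[nu]_x \int[nu]_y (F (x, y))%:E =
  \int[nu]_x \int[nu]_y (c x y * F (x, y))%:E +
  \int[nu]_x \int[nu]_y (c x y * F (x, y))%:E.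
Proof.
move=> mG nG mc c0 mF F0 Fsym F00 c1.
have cF0 x y : (0 <= c x y * F (x, y))%R by rewrite mulr_ge0.
have cF0' x y : (0 <= c y x * F (x, y))%R by rewrite mulr_ge0.
have mcF : measurable_fun setT (fun z : R * R => c z.1 z.2 * F z)%R.
  exact: measurable_funM.
have mcF' : measurable_fun setT (fun z : R * R => c z.2 z.1 * F z)%R.
  apply: measurable_funM => //.
  exact: (measurableT_comp mc (@measurable_swap _ _ R R)).
have -> : \int[nu]_x \int[nu]_y (c x y * F (x, y))%:E +
    \int[nu]_x \int[nu]_y (c x y * F (x, y))%:E =
    \int[nu]_x \int[nu]_y (c x y * F (x, y))%:E +
    \int[nu]_x \int[nu]_y (c y x * F (x, y))%:E.
  congr (_ + _); rewrite [RHS](fubini_tonelli (fun z => (c z.2 z.1 * F z)%:E)).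
  - by apply: eq_integral => x _; apply: eq_integral => y _; rewrite Fsym.
  - exact/measurable_EFinP.
  - by move=> [x y]; rewrite lee_fin.
rewrite -ge0_integralD//; last 4 first.
- by move=> x _; apply: integral_ge0 => y _; rewrite lee_fin.
- exact: (measurable_inner mcF).
- by move=> x _; apply: integral_ge0 => y _; rewrite lee_fin.
- exact: (measurable_inner mcF').
apply: ge0_ae_eq_integral => //.
- exact: measurable_inner.
- by apply: emeasurable_funD; [exact: (measurable_inner mcF)|exact: (measurable_inner mcF')].
- by move=> x _; apply: integral_ge0 => y _; rewrite lee_fin.
- by move=> x _; apply: adde_ge0; apply: integral_ge0 => y _; rewrite lee_fin.
move: (ae_full mG nG); apply: filterS => x Gx _.
have msec (f : R * R -> R) : measurable_fun setT f ->
    measurable_fun setT (fun y => (f (x, y))%:E).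
  by move=> mf; apply/measurable_EFinP; exact: (measurableT_comp mf (pair1_measurable x)).
rewrite -ge0_integralD//; last 4 first.
- by move=> y _; rewrite lee_fin.
- exact: (msec _ mcF).
- by move=> y _; rewrite lee_fin.
- exact: (msec _ mcF').
apply: ge0_ae_eq_integral => //.
- exact: msec.
- by apply: emeasurable_funD; [exact: (msec _ mcF)|exact: (msec _ mcF')].
- by move=> y _; rewrite lee_fin.
- by move=> y _; rewrite -EFinD lee_fin addr_ge0.
move: (ae_full mG nG); apply: filterS => y Gy _.
rewrite -EFinD -mulrDl; have [<-|xy] := eqVneq x y; first by rewrite F00 mulr0.
by rewrite c1// mul1r.
Qed.

(** With [phi = a / b] and the measure [q b nu], the equality form of the
    Cauchy-Schwarz inequality reads: total mass times the integral of [phi ^ 2]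
    is the square of the integral of [phi], plus half the double integral of
    [(phi y - phi x) ^ 2]. The cut [c] replaces the factor one half. *)
Variables (c : R -> R -> R) (G : set R) (q a b : R -> R) (H K : R).
Hypotheses (mG : measurable G) (nG : nu (~` G) = 0).
Hypotheses (mc : measurable_fun setT (fun z : R * R => c z.1 z.2))
  (c0 : forall x y, (0 <= c x y)%R)
  (c1 : forall x y, G x -> G y -> x != y -> (c x y + c y x = 1)%R).
Hypotheses (mq : measurable_fun setT q) (ma : measurable_fun setT a)
  (mb : measurable_fun setT b).
Hypotheses (q0 : forall x, (0 <= q x)%R) (b0 : forall x, (0 <= b x)%R)
  (bG : forall x, G x -> (0 < b x)%R).
Hypotheses (iqb : nu.-integrable setT (EFin \o (q \* b)%R))
  (iqa : nu.-integrable setT (EFin \o (q \* a)%R)).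
Hypotheses (HE : \int[nu]_x (q x * b x)%:E = H%:E)
  (KE : \int[nu]_x (q x * a x)%:E = K%:E).

Let phi x : R := (a x / b x)%R.
Let F (z : R * R) : R :=
  (q z.1 * q z.2 * (b z.1 * b z.2) * (phi z.2 - phi z.1) ^+ 2)%R.
Let u1 x : R := (q x * (a x ^+ 2 / b x))%R.

Let mphi : measurable_fun setT phi.
Proof. by apply: measurable_funM => //; exact: measurable_fun_inv. Qed.

Let mu1 : measurable_fun setT u1.
Proof.
apply: measurable_funM => //; apply: measurable_funM; first exact: measurable_funX.
exact: measurable_fun_inv.
Qed.

Let u10 x : (0 <= u1 x)%R.
Proof. by rewrite mulr_ge0// divr_ge0// sqr_ge0. Qed.

Let F0 z : (0 <= F z)%R.
Proof. by rewrite mulr_ge0 ?sqr_ge0// mulr_ge0// mulr_ge0. Qed.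

Let mF : measurable_fun setT F.
Proof.
have m1 (f : R -> R) : measurable_fun setT f ->
    measurable_fun setT (fun z : R * R => f z.1).
  by move=> mf; exact: measurableT_comp.
have m2 (f : R -> R) : measurable_fun setT f ->
    measurable_fun setT (fun z : R * R => f z.2).
  by move=> mf; exact: measurableT_comp.
apply: measurable_funM; last first.
  by apply: measurable_funX; apply: measurable_funB; [exact: m2|exact: m1].
by apply: measurable_funM; apply: measurable_funM; (exact: m1 || exact: m2).
Qed.

Let S := \int[nu]_x \int[nu]_y (c x y * F (x, y))%:E.

Let S0 : 0 <= S.
Proof.
by apply: integral_ge0 => x _; apply: integral_ge0 => y _; rewrite lee_fin mulr_ge0.
Qed.

Let fullE : \int[nu]_x \int[nu]_y (F (x, y))%:E = S + S.
Proof.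
apply: (integral_half mG nG mc c0 mF F0) => //.
- by move=> x y; rewrite /F /=; ring.
- by move=> x; rewrite /F /= subrr expr0n mulr0.
Qed.

Let H0 : (0 <= H)%R.
Proof. by rewrite -lee_fin -HE; apply: integral_ge0 => x _; rewrite lee_fin mulr_ge0. Qed.

Let u1E x : G x -> u1 x = (q x * b x * phi x ^+ 2)%R.
Proof. by move=> /bG bx; rewrite /u1 /phi; field; rewrite gt_eqF. Qed.

Let FE x y : G x -> G y -> F (x, y) =
  (q x * b x * u1 y + (- 2%:R * (q x * a x)) * (q y * a y) + u1 x * (q y * b y))%R.
Proof.
move=> /bG bx /bG by_; rewrite /u1 /F /phi /=; field.
by rewrite !gt_eqF.
Qed.

(** If the integral of [phi ^ 2] is finite, the square can be expanded and
    integrated term by term. *)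
Let lagrange_fin (A : R) : \int[nu]_x (u1 x)%:E = A%:E ->
  H%:E * \int[nu]_x (u1 x)%:E = (K ^+ 2)%:E + S.
Proof.
move=> AE; have iu1 : nu.-integrable setT (EFin \o u1).
  apply/integrableP; split; first exact/measurable_EFinP.
  under eq_integral do rewrite /= ger0_norm//.
  by rewrite AE ltry.
have : S + S = (A * H + (- 2%:R * K) * K + H * A)%:E.
  rewrite -fullE -(integral_lin3 _ _ _ iqb iqa iu1 HE KE AE).
  apply: ae_eq_integral => //.
  - exact: measurable_inner.
  - apply/measurable_EFinP; apply: measurable_funD; first apply: measurable_funD.
    + by apply: measurable_funM => //; exact: measurable_funM.
    + by apply: measurable_funM => //; exact: measurable_funM.
    + exact: measurable_funM.
  move: (ae_full mG nG); apply: filterS => x Gx _.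
  have -> : (A * (q x * b x) + - 2%:R * K * (q x * a x) + H * u1 x =
     q x * b x * A + (- 2%:R * (q x * a x)) * K + u1 x * H)%R by ring.
  rewrite -(integral_lin3 _ _ _ iu1 iqa iqb AE KE HE).
  apply: ae_eq_integral => //.
  - by apply/measurable_EFinP; exact: (measurableT_comp mF (pair1_measurable x)).
  - apply/measurable_EFinP; apply: measurable_funD; first apply: measurable_funD.
    + exact: measurable_funM.
    + by apply: measurable_funM => //; exact: measurable_funM.
    + by apply: measurable_funM => //; exact: measurable_funM.
  by move: (ae_full mG nG); apply: filterS => y Gy _; rewrite FE.
rewrite AE; move: S0; case: S => [s| |] //= _ [] sE.
by rewrite -EFinM -EFinD; congr EFin; lra.
Qed.

Let integral0_ae (f : R -> R) : measurable_fun setT f -> (forall x, 0 <= f x)%R ->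
  \int[nu]_x (f x)%:E = 0 -> {ae nu, forall x, f x = 0%R}.
Proof.
move=> mf f0 I0.
have mEf : measurable_fun setT (EFin \o f) by exact/measurable_EFinP.
have : ae_eq nu setT (EFin \o f) (cst 0).
  apply/(ae_eq_integral_abs nu measurableT mEf).
  by under eq_integral do rewrite /= ger0_norm//.
by apply: filterS => x /(_ I)[].
Qed.

(** If the integral of [phi ^ 2] is infinite, so is the double integral: were it
    finite, one of its sections at a point [x] charged by [q b nu] would be
    finite too, and [phi y ^ 2 <= 2 (phi y - phi x) ^ 2 + 2 phi x ^ 2] would
    bound the integral of [phi ^ 2]. *)
Lemma lagrange_identity :
  H%:E * \int[nu]_x (u1 x)%:E = (K ^+ 2)%:E + S.
Proof.
have A0 : 0 <= \int[nu]_x (u1 x)%:E by apply: integral_ge0 => x _; rewrite lee_fin.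
case AE : (\int[nu]_x (u1 x)%:E) => [A| |]; last by move: A0; rewrite AE.
  by rewrite -AE; exact: (lagrange_fin AE).
have u3n0 : ~ {ae nu, forall x, (q x * b x)%R = 0%R}.
  move=> u30; suff : \int[nu]_x (u1 x)%:E = 0 by rewrite AE.
  rewrite (@ae_eq_integral _ _ _ nu setT (cst 0))// ?integral0//.
    exact/measurable_EFinP.
  move: u30 (ae_full mG nG); apply: filterS2 => x + Gx _.
  move/eqP; rewrite mulf_eq0 => /orP[/eqP qx|/eqP bx].
    by rewrite /= /u1 qx mul0r.
  by have := bG Gx; rewrite bx ltxx.
have H_gt0 : (0 < H)%R.
  rewrite lt_neqAle H0 andbT; apply/eqP => H00; apply: u3n0.
  apply: integral0_ae; [exact: measurable_funM|by move=> x; rewrite mulr_ge0|].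
  by rewrite HE -H00.
rewrite gt0_muley ?lte_fin//; apply/esym; suff -> : S = +oo by [].
apply: contrapT => Snoo; apply: u3n0.
have Sfin : S \is a fin_num by rewrite ge0_fin_numE// lt_neqAle leey andbT; apply/eqP.
have inner_fin : {ae nu, forall x, \int[nu]_y (F (x, y))%:E \is a fin_num}.
  have : nu.-integrable setT (fun x => \int[nu]_y (F (x, y))%:E).
    apply/integrableP; split; first exact: measurable_inner.
    under eq_integral.
      move=> x _; rewrite gee0_abs; last by apply: integral_ge0 => y _; rewrite lee_fin.
      over.
    by rewrite fullE ltey_eq fin_numD Sfin.
  by move/(integrable_ae measurableT); apply: filterS => x /(_ I).
move: inner_fin (ae_full mG nG); apply: filterS2 => x xfin Gx.
apply: contrapT => /eqP u3x.
have {}u3x : (0 < q x * b x)%R by rewrite lt_neqAle eq_sym u3x mulr_ge0.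
pose C1 := (2%:R * phi x ^+ 2)%R; pose C2 := (2%:R / (q x * b x))%R.
have C10 : (0 <= C1)%R by rewrite mulr_ge0// sqr_ge0.
have C20 : (0 <= C2)%R by rewrite divr_ge0// ltW.
have mFx : measurable_fun setT (fun y => F (x, y)).
  exact: (measurableT_comp mF (pair1_measurable x)).
have mqb : measurable_fun setT (q \* b)%R by exact: measurable_funM.
have : \int[nu]_y (u1 y)%:E <=
    \int[nu]_y (C1%:E * (q y * b y)%:E + C2%:E * (F (x, y))%:E).
  apply: ae_ge0_le_integral => //.
  - by move=> y _; rewrite lee_fin.
  - exact/measurable_EFinP.
  - by move=> y _; rewrite -!EFinM -EFinD lee_fin addr_ge0// mulr_ge0// mulr_ge0.
  - apply: emeasurable_funD; apply: measurable_funeM; exact/measurable_EFinP.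
  move: (ae_full mG nG); apply: filterS => y Gy _.
  rewrite -!EFinM -EFinD lee_fin u1E//.
  have -> : (C2 * F (x, y) = q y * b y * (2%:R * (phi y - phi x) ^+ 2))%R.
    rewrite /C2 /F /=; move: (phi x) (phi y) => s t; field.
    by rewrite andbC -negb_or -mulf_eq0 gt_eqF.
  have -> : (C1 * (q y * b y) = q y * b y * (2%:R * phi x ^+ 2))%R by rewrite /C1; ring.
  rewrite -mulrDr ler_wpM2l ?mulr_ge0//.
  rewrite -subr_ge0 (_ : _ - _ = (phi y - 2%:R * phi x) ^+ 2)%R ?sqr_ge0//.
  by ring.
rewrite AE leye_eq ge0_integralD//; last 4 first.
- by move=> y _; rewrite -EFinM lee_fin mulr_ge0// mulr_ge0.
- apply: measurable_funeM; exact/measurable_EFinP.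
- by move=> y _; rewrite -EFinM lee_fin mulr_ge0.
- apply: measurable_funeM; exact/measurable_EFinP.
rewrite !ge0_integralZl//; last 4 first.
- exact/measurable_EFinP.
- by move=> y _; rewrite lee_fin.
- exact/measurable_EFinP.
- by move=> y _; rewrite lee_fin mulr_ge0.
rewrite HE; move: xfin; case: (\int[nu]_y (F (x, y))%:E) => //= v _.
Qed.

End lagrange_identity.

(** * Order indicators *)

Section chi_algebra.
Context {R : realType}.
Implicit Types (u v x y : R) (ell l : int).

(** The steps allowed by the regime: only 0 in the continuous case, and an
    arbitrary sign in the discrete one. *)
Definition compatible_step (ell l : int) : Prop :=
  ell = 0 /\ l = 0 \/ ell ^+ 2 = 1 /\ (l = -1 \/ l = 1).

Lemma chi0E x y : chi 0 x y = if x <= y then 1 else 0.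
Proof. by rewrite /chi /= subr0. Qed.

Lemma chi1E x y : chi 1 x y = if x <= y - 1 then 1 else 0.
Proof. by []. Qed.

Lemma chiN1E x y : chi (-1) x y = if x <= y then 1 else 0.
Proof. by rewrite /chi /= subr0. Qed.

Lemma chi_order ell l u v : compatible_step ell l -> chi (ell ^+ 2) u v != 0 -> u <= v.
Proof.
move=> [[-> _]|[-> _]]; rewrite ?expr0n ?expr1n ?oppr0 ?opprK ?chi0E ?chi1E ?chiN1E /=;
  case: leP => //; rewrite ?eqxx//.
by move=> h _; lra.
Qed.

(** A point that the kernel places between [u] and [v] forces [u <= v], and
    [u < v] in the discrete case, where one of the two inequalities is strict. *)
Lemma chi_between ell l u x v : compatible_step ell l ->
  chi (ell ^+ 2) u v * (chi l u x * chi (- l) x v) = chi l u x * chi (- l) x v.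
Proof.
by move=> [[-> ->]|[-> [->|->]]]; rewrite ?expr0n ?expr1n ?oppr0 ?opprK ?chi0E ?chi1E ?chiN1E /=;
  do 3? (case: leP => ?; rewrite ?mul1r ?mulr1 ?mul0r ?mulr0//); lra.
Qed.

(** For ordered [x] and [y], the outer indicators [u] to [x] and [y] to [v] imply
    the inner ones [x] to [v] and [u] to [y]. This makes the product of two
    kernels with the same ends, which Lagrange's identity produces, equal to the
    nested chain of indicators in the remainder. *)
Lemma chi_nested ell l u x y v : compatible_step ell l ->
  chi (ell ^+ 2) x y * (chi l u x * chi (- l) y v) =
  chi (ell ^+ 2) x y *
    ((chi l u x * chi (- l) x v) * (chi l u y * chi (- l) y v)).
Proof.
by move=> [[-> ->]|[-> [->|->]]]; rewrite ?expr0n ?expr1n ?oppr0 ?opprK ?chi0E ?chi1E ?chiN1E /=;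
  do 5? (case: leP => ?; rewrite ?mul1r ?mulr1 ?mul0r ?mulr0//); lra.
Qed.

End chi_algebra.

(** * Weights on pairs of points *)

Section pair_law.
Context {R : realType} (nu : probability R R).

Definition pair_law : subprobability (R * R)%type R :=
  product_subprobability (nu : subprobability R R, nu : subprobability R R).

End pair_law.

Section weights.
Context {R : realType} (nu : probability R R) (p : R -> R).
Context (ell : int) (l : nat -> int) (b hh : nat -> R -> R).
Local Open Scope ereal_scope.

Definition link (n : nat) (s z : R * R) : R :=
  (chi (l n) s.1 z.1 * chi (- l n) z.2 s.2)%R.

Definition pair_density (n : nat) (z : R * R) : R :=
  (b n z.1 * b n z.2 / (p z.1 * p z.2))%R.

(** Conditional expectation of the product of kernels and differences in the
    [n]-th remainder, given the innermost pair [z] and up to the order indicator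
    of [z]: the outer pairs are integrated out one by one. *)
Fixpoint weight (n : nat) (z : R * R) : \bar R :=
  if n is m.+1 then
    (pair_density n z)%:E * \int[pair_law nu]_s ((link n s z)%:E * weight m s)
  else 1.

Definition cut (z : R * R) : R := chi (ell ^+ 2) z.1 z.2.

(** The remainder of order [n] as an integral over the innermost pair. *)
Definition dispersion (phi : R -> R) (n : nat) : \bar R :=
  \int[pair_law nu]_z (((phi z.2 - phi z.1) ^+ 2 * cut z)%:E * weight n z).

(** The weight of order [k]. The absolute value makes the integrand nonnegative
    everywhere, so that Tonelli's theorem applies to extended integrals; where
    the kernel does not vanish the increment is nonnegative anyway. *)
Definition Gamma_weight (k : nat) (x : R) : \bar R :=
  \int[pair_law nu]_s
    ((`|hh k s.2 - hh k s.1| * Phi_p p (l k) s.1 x s.2)%:E * weight k.-1 s).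

(** The [k]-th term of the expansion, with [a] in place of the difference of the
    previous function. *)
Definition weighted_energy (a : R -> R) (k : nat) : \bar R :=
  \int[nu]_x ((a x ^+ 2 / b k x)%:E * Gamma_weight k x).

Hypotheses (mp : measurable_fun [set: R] p) (p0 : forall x, (0 <= p x)%R).
Hypotheses (mb : forall k, measurable_fun [set: R] (b k))
  (b0 : forall k x, (0 <= b k x)%R).
Hypothesis mh : forall k, measurable_fun [set: R] (hh k).

Lemma measurable_fst_comp d1 d2 (T1 : measurableType d1) (T2 : measurableType d2)
    d (T : measurableType d) (f : T1 -> T) :
  measurable_fun setT f -> measurable_fun setT (fun z : T1 * T2 => f z.1).
Proof. by move=> mf; exact: measurableT_comp. Qed.

Lemma measurable_snd_comp d1 d2 (T1 : measurableType d1) (T2 : measurableType d2)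
    d (T : measurableType d) (f : T2 -> T) :
  measurable_fun setT f -> measurable_fun setT (fun z : T1 * T2 => f z.2).
Proof. by move=> mf; exact: measurableT_comp. Qed.

Lemma link_ge0 n s z : (0 <= link n s z)%R.
Proof. by rewrite mulr_ge0// chi_ge0. Qed.

Lemma pair_density_ge0 n z : (0 <= pair_density n z)%R.
Proof. by rewrite divr_ge0// mulr_ge0. Qed.

Lemma cut_ge0 z : (0 <= cut z)%R. Proof. exact: chi_ge0. Qed.

Lemma Phi_p_ge0 k u x v : (0 <= Phi_p p k u x v)%R.
Proof. by rewrite /Phi_p divr_ge0// mulr_ge0// chi_ge0. Qed.

Lemma measurable_link n :
  measurable_fun setT (fun zs : (R * R) * (R * R) => link n zs.2 zs.1).
Proof.
apply: measurable_funM; apply: measurable_chi.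
- exact: (measurable_snd_comp (f := fst)).
- exact: (measurable_fst_comp (f := fst)).
- exact: (measurable_fst_comp (f := snd)).
- exact: (measurable_snd_comp (f := snd)).
Qed.

Lemma measurable_pair_density n : measurable_fun setT (pair_density n).
Proof.
apply: measurable_funM; first apply: measurable_funM.
- exact: measurable_fst_comp.
- exact: measurable_snd_comp.
apply: measurable_fun_inv; apply: measurable_funM.
- exact: measurable_fst_comp.
- exact: measurable_snd_comp.
Qed.

Lemma measurable_cut : measurable_fun setT cut.
Proof. exact: measurable_chi. Qed.

Lemma weight_ge0 n z : 0 <= weight n z.
Proof.
elim: n z => [|n IH] z //=; rewrite mule_ge0// ?lee_fin ?pair_density_ge0//.
by apply: integral_ge0 => s _; rewrite mule_ge0// lee_fin link_ge0.
Qed.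

Lemma measurable_weight n : measurable_fun setT (weight n).
Proof.
elim: n => [|n IH] /=; first exact: measurable_cst.
apply: emeasurable_funM; first by apply/measurable_EFinP; exact: measurable_pair_density.
apply: (@measurable_fun_fubini_tonelli_F _ _ _ _ R (pair_law nu)
  (fun zs : (R * R) * (R * R) => (link n.+1 zs.2 zs.1)%:E * weight n zs.2)).
  apply: emeasurable_funM; first by apply/measurable_EFinP; exact: measurable_link.
  exact: measurable_snd_comp.
by move=> zs; rewrite mule_ge0 ?weight_ge0// lee_fin link_ge0.
Qed.

Lemma measurable_Phi_p k :
  measurable_fun setT (fun xs : R * (R * R) => Phi_p p k xs.2.1 xs.1 xs.2.2).
Proof.
apply: measurable_funM; first apply: measurable_funM; first apply: measurable_chi.
- exact: (measurable_snd_comp (f := fst)).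
- exact: measurable_fst.
- apply: measurable_chi; first exact: measurable_fst.
  exact: (measurable_snd_comp (f := snd)).
by apply: measurable_fun_inv; exact: measurable_fst_comp.
Qed.

Let mdh k : measurable_fun setT (fun s : R * R => `|hh k s.2 - hh k s.1|%R).
Proof.
apply: measurableT_comp => //; apply: measurable_funB.
- exact: measurable_snd_comp.
- exact: measurable_fst_comp.
Qed.

Lemma measurable_Gamma_weight k : measurable_fun setT (Gamma_weight k).
Proof.
apply: (@measurable_fun_fubini_tonelli_F _ _ _ _ R (pair_law nu) (fun xs : R * (R * R) =>
  (`|hh k xs.2.2 - hh k xs.2.1| * Phi_p p (l k) xs.2.1 xs.1 xs.2.2)%:E *
  weight k.-1 xs.2)).
  apply: emeasurable_funM; last by apply: measurable_snd_comp; exact: measurable_weight.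
  apply/measurable_EFinP; apply: measurable_funM; last exact: measurable_Phi_p.
  exact: measurable_snd_comp (mdh k).
move=> xs; rewrite mule_ge0 ?weight_ge0// lee_fin mulr_ge0//.
exact: Phi_p_ge0.
Qed.

Lemma Gamma_weight_ge0 k x : 0 <= Gamma_weight k x.
Proof.
apply: integral_ge0 => s _; rewrite mule_ge0 ?weight_ge0// lee_fin mulr_ge0//.
exact: Phi_p_ge0.
Qed.

End weights.

(** * The alternating step *)

Section alternating_step.
Context {R : realType} (nu : probability R R) (p : R -> R).
Context (ell : int) (l : nat -> int) (b hh : nat -> R -> R) (G : set R).
Local Open Scope ereal_scope.

Hypotheses (mp : measurable_fun [set: R] p) (p0 : forall x, (0 <= p x)%R).
Hypotheses (mb : forall k, measurable_fun [set: R] (b k))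
  (b0 : forall k x, (0 <= b k x)%R).
Hypothesis mh : forall k, measurable_fun [set: R] (hh k).
Hypotheses (mG : measurable G) (nG : nu (~` G) = 0).
Hypothesis cut1 : forall x y, G x -> G y -> x != y ->
  (cut ell (x, y) + cut ell (y, x) = 1)%R.

Local Notation weight := (weight nu p l b).
Local Notation dispersion := (dispersion nu p ell l b).
Local Notation Gamma_weight := (Gamma_weight nu p l b hh).
Local Notation weighted_energy := (weighted_energy nu p l b hh).

Lemma pair_lawE (f : R * R -> \bar R) : measurable_fun setT f ->
  (forall z, 0 <= f z) ->
  \int[pair_law nu]_z f z = \int[nu]_x \int[nu]_y f (x, y).
Proof. by move=> mf f0; exact: (@fubini_tonelli1 _ _ _ _ R nu nu f mf f0). Qed.

Lemma ae_pair : {ae pair_law nu, forall z, G z.1 /\ G z.2}.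
Proof.
have mGc : measurable (~` G) by exact: measurableC.
exists ((~` G `*` setT) `|` (setT `*` ~` G)); split.
- by apply: measurableU; exact: measurableX.
- apply/eqP; rewrite eq_le measure_ge0 andbT.
  apply: (@le_trans _ _ (pair_law nu (~` G `*` setT) + pair_law nu (setT `*` ~` G))).
    by apply: measureU2; exact: measurableX.
  have -> : pair_law nu (~` G `*` setT) = nu (~` G) * nu setT.
    by apply: product_measure1E.
  have -> : pair_law nu (setT `*` ~` G) = nu setT * nu (~` G).
    by apply: product_measure1E.
  by rewrite nG mule0 mul0e adde0.
- move=> z /= /not_andP[Gz|Gz]; [left|right] => //.
Qed.

Variables (k : nat) (a g : R -> R).
Hypotheses (k1 : (0 < k)%N) (lk : compatible_step ell (l k)).
Hypotheses (ma : measurable_fun setT a) (mg : measurable_fun setT g).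
Hypothesis bG : forall x, G x -> (0 < b k x)%R.
Hypothesis intb : forall u v, G u -> G v -> (u <= v)%R ->
  nu.-integrable setT (fun x => (Phi_p p (l k) u x v * b k x)%:E) /\
  \int[nu]_x (Phi_p p (l k) u x v * b k x)%:E = (hh k v - hh k u)%:E.
Hypothesis inta : forall u v, G u -> G v -> (u <= v)%R ->
  nu.-integrable setT (fun x => (Phi_p p (l k) u x v * a x)%:E) /\
  \int[nu]_x (Phi_p p (l k) u x v * a x)%:E = (g v - g u)%:E.

Let phi x : R := (a x / b k x)%R.
Let dH (s : R * R) : R := `|hh k s.2 - hh k s.1|%R.
Let Phik (s : R * R) (x : R) : R := Phi_p p (l k) s.1 x s.2.
Let sq (f : R -> R) (z : R * R) : R := ((f z.2 - f z.1) ^+ 2 * cut ell z)%R.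

Let mphi : measurable_fun setT phi.
Proof. by apply: measurable_funM => //; exact: measurable_fun_inv. Qed.

Let mPhik s : measurable_fun setT (Phik s).
Proof.
by have := measurableT_comp (measurable_Phi_p mp (l k)) (pair2_measurable s).
Qed.

Let mdH : measurable_fun setT dH.
Proof.
apply: measurableT_comp => //; apply: measurable_funB.
- exact: measurable_snd_comp.
- exact: measurable_fst_comp.
Qed.

Let msq f : measurable_fun setT f -> measurable_fun setT (sq f).
Proof.
move=> mf; apply: measurable_funM; last exact: measurable_cut.
apply: measurable_funX; apply: measurable_funB.
- exact: measurable_snd_comp.
- exact: measurable_fst_comp.
Qed.

Let sq0 f z : (0 <= sq f z)%R.
Proof. by rewrite mulr_ge0 ?sqr_ge0// cut_ge0. Qed.

Let Phik0 s x : (0 <= Phik s x)%R. Proof. exact: Phi_p_ge0. Qed.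

Let dH0 s : (0 <= dH s)%R. Proof. exact: normr_ge0. Qed.

Let e0 x : (0 <= a x ^+ 2 / b k x)%R. Proof. by rewrite divr_ge0// sqr_ge0. Qed.

Let me : measurable_fun setT (fun x => a x ^+ 2 / b k x)%R.
Proof. by apply: measurable_funM; [exact: measurable_funX|exact: measurable_fun_inv]. Qed.

Let mw : measurable_fun setT (weight k.-1).
Proof. exact: measurable_weight. Qed.

Let w0 z : 0 <= weight k.-1 z. Proof. exact: weight_ge0. Qed.

Let J (s z : R * R) : R := (sq phi z * pair_density p b k z * link l k s z)%R.

Let J0 s z : (0 <= J s z)%R.
Proof.
apply: mulr_ge0; last exact: link_ge0.
by apply: mulr_ge0; [exact: sq0|exact: pair_density_ge0].
Qed.

Let mJ : measurable_fun setT (fun zs : (R * R) * (R * R) => J zs.2 zs.1).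
Proof.
apply: measurable_funM; last exact: measurable_link.
apply: measurable_funM; apply: measurable_fst_comp; first exact: msq.
exact: measurable_pair_density.
Qed.

(** Integrating over [x] first isolates the left side of Lagrange's identity for
    the kernel with ends [s]. *)
Let energyE : weighted_energy a k =
  \int[pair_law nu]_s
    ((dH s)%:E * \int[nu]_x (Phik s x * (a x ^+ 2 / b k x))%:E * weight k.-1 s).
Proof.
pose f (xs : R * (R * R)) :=
  ((dH xs.2 * Phik xs.2 xs.1 * (a xs.1 ^+ 2 / b k xs.1))%:E * weight k.-1 xs.2).
have f0 xs : 0 <= f xs.
  rewrite mule_ge0 ?w0// lee_fin (mulr_ge0 _ (e0 _))//.
  exact: mulr_ge0 (dH0 _) (Phik0 _ _).
have mf : measurable_fun setT f.
  apply: emeasurable_funM; last exact: measurable_snd_comp mw.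
  apply/measurable_EFinP; apply: measurable_funM; last exact: measurable_fst_comp me.
  apply: measurable_funM; first exact: measurable_snd_comp mdH.
  exact: measurable_Phi_p.
transitivity (\int[nu]_x \int[pair_law nu]_s f (x, s)).
  apply: eq_integral => x _; rewrite /Gamma_weight -ge0_integralZl//.
  - by apply: eq_integral => s _; rewrite /f /= muleA -EFinM; congr (EFin _ * _);
      rewrite -/(Phik s x) /dH; ring.
  - apply: emeasurable_funM => //; apply/measurable_EFinP; apply: measurable_funM => //.
    exact: (measurableT_comp (measurable_Phi_p mp (l k)) (pair1_measurable x)).
  - by move=> s _; rewrite mule_ge0// lee_fin mulr_ge0// Phi_p_ge0.
  - by rewrite lee_fin.
apply: (etrans (@fubini_tonelli _ _ _ _ R nu (pair_law nu) f mf f0)).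
apply: eq_integral => s _; rewrite /f /=.
rewrite -ge0_integralZl//; last 3 first.
- by apply/measurable_EFinP; exact: measurable_funM.
- by move=> x _; rewrite lee_fin mulr_ge0.
- by rewrite lee_fin.
rewrite -ge0_integralZr//; last 2 first.
- by apply: emeasurable_funM => //; apply/measurable_EFinP; exact: measurable_funM.
- by move=> x _; rewrite -EFinM lee_fin mulr_ge0// mulr_ge0.
by apply: eq_integral => x _; congr (_ * _); rewrite -EFinM !mulrA.
Qed.

(** The weight of order [k] is one more integral over the outer pair [s]; that
    pair is moved outside. *)
Let dispersionE : dispersion phi k =
  \int[pair_law nu]_s (\int[pair_law nu]_z (J s z)%:E * weight k.-1 s).
Proof.
pose f (zs : (R * R) * (R * R)) := (J zs.2 zs.1)%:E * weight k.-1 zs.2.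
have f0 zs : 0 <= f zs by rewrite mule_ge0// lee_fin.
have mf : measurable_fun setT f.
  apply: emeasurable_funM; last exact: measurable_snd_comp mw.
  exact/measurable_EFinP.
transitivity (\int[pair_law nu]_z \int[pair_law nu]_s f (z, s)).
  apply: eq_integral => z _; rewrite -(prednK k1) /=.
  rewrite muleA -EFinM -ge0_integralZl//.
  - by apply: eq_integral => s _; rewrite /f /J prednK//= muleA -EFinM.
  - apply: emeasurable_funM => //; apply/measurable_EFinP.
    exact: (measurableT_comp (measurable_link l _) (pair1_measurable z)).
  - by move=> s _; rewrite mule_ge0// lee_fin link_ge0.
  - by rewrite lee_fin mulr_ge0 ?sq0// pair_density_ge0.
apply: (etrans (@fubini_tonelli _ _ _ _ R (pair_law nu) (pair_law nu) f mf f0)).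
apply: eq_integral => s _; rewrite /f /= ge0_integralZr//.
- apply/measurable_EFinP.
  exact: (measurableT_comp mJ (pair2_measurable s)).
- by move=> z _; rewrite lee_fin.
Qed.

(** For ordered ends [s] this is Lagrange's identity for the measure with
    density [Phi_p] with respect to the law: the kernel integrates [a] and [b k]
    to the increments of [g] and [hh k]. For other ends everything vanishes,
    because the kernel and the nested indicators do. *)
Let pointwise s : G s.1 -> G s.2 ->
  (sq g s)%:E + \int[pair_law nu]_z (J s z)%:E =
  (dH s)%:E * \int[nu]_x (Phik s x * (a x ^+ 2 / b k x))%:E.
Proof.
move=> G1 G2.
have mJs : measurable_fun setT (J s).
  exact: (measurableT_comp mJ (pair2_measurable s)).
have [cs0|cs0] := eqVneq (cut ell s) 0%R.
  have chi0 x : (chi (l k) s.1 x * chi (- l k) x s.2 = 0)%R.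
    by rewrite -(chi_between _ _ _ lk) -/(cut ell s) cs0 mul0r.
  rewrite [X in _ * X]integral0_eq; last first.
    by move=> x _; rewrite /Phik /Phi_p chi0 !mul0r.
  rewrite mule0 /sq cs0 mulr0 add0e; apply: integral0_eq => z _.
  transitivity (((phi z.2 - phi z.1) ^+ 2 * pair_density p b k z *
      (cut ell z * (chi (l k) s.1 z.1 * chi (- l k) z.2 s.2)))%R)%:E.
    by congr EFin; rewrite /J /sq /link; ring.
  by rewrite /cut (chi_nested _ _ _ _ lk) chi0 mul0r !mulr0.
have s12 : (s.1 <= s.2)%R by apply: chi_order lk cs0.
have [ib bE] := intb G1 G2 s12; have [ia aE] := inta G1 G2 s12.
have H0 : (0 <= hh k s.2 - hh k s.1)%R.
  by rewrite -lee_fin -bE; apply: integral_ge0 => x _; rewrite lee_fin mulr_ge0// Phi_p_ge0.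
have cut_s : cut ell s = 1%R.
  by move: cs0; rewrite /cut /chi; case: ifP => //; rewrite eqxx.
have LI := @lagrange_identity R nu (fun x y => chi (ell ^+ 2) x y) G (Phik s) a (b k)
  _ _ mG nG (measurable_cut ell) (@chi_ge0 R _) cut1 (mPhik s) ma (mb k)
  (Phik0 s) (b0 k) bG ib ia bE aE.
rewrite /dH ger0_norm// LI.
rewrite /sq cut_s mulr1; congr (_ + _).
rewrite (pair_lawE (f := fun z => (J s z)%:E)); last 2 first.
- exact/measurable_EFinP.
- by move=> z; rewrite lee_fin.
apply: eq_integral => x _; apply: eq_integral => y _; congr EFin.
rewrite /J /sq /link /pair_density /Phik /Phi_p /=.
transitivity ((phi y - phi x) ^+ 2 * (b k x * b k y / (p x * p y)) *
  (cut ell (x, y) * (chi (l k) s.1 x * chi (- l k) y s.2)))%R.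
  by move: (phi y - phi x)%R (cut ell (x, y)) (b k x * b k y / _)%R => A B C; ring.
rewrite /cut /= (chi_nested _ _ _ _ lk) invfM.
rewrite -/(phi x) -/(phi y).
by move: (phi x) (phi y) (p x)^-1%R (p y)^-1%R => ? ? ? ?; ring.
Qed.

(** One step of the expansion, obtained by integrating the pointwise identity
    against the weight of the outer pairs; nonnegativity keeps it valid in the
    extended reals. *)
Lemma dispersion_step :
  dispersion g k.-1 + dispersion phi k = weighted_energy a k.
Proof.
have mJint : measurable_fun setT (fun s => \int[pair_law nu]_z (J s z)%:E).
  apply: (@measurable_fun_fubini_tonelli_F _ _ _ _ R (pair_law nu) (fun sz => (J sz.1 sz.2)%:E)).
    by apply/measurable_EFinP; exact: (measurableT_comp mJ (@measurable_swap _ _ _ _)).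
  by move=> sz; rewrite lee_fin.
have mPint : measurable_fun setT (fun s => \int[nu]_x (Phik s x * (a x ^+ 2 / b k x))%:E).
  apply: (@measurable_fun_fubini_tonelli_G _ _ _ _ R nu
    (fun xs : R * (R * R) => (Phik xs.2 xs.1 * (a xs.1 ^+ 2 / b k xs.1))%:E)).
    apply/measurable_EFinP; apply: measurable_funM; last exact: measurable_fst_comp me.
    exact: measurable_Phi_p.
  by move=> xs; rewrite lee_fin mulr_ge0.
rewrite energyE dispersionE -ge0_integralD//; last 4 first.
- by move=> s _; rewrite mule_ge0// lee_fin sq0.
- by apply: emeasurable_funM => //; apply/measurable_EFinP; exact: msq.
- by move=> s _; rewrite mule_ge0//; apply: integral_ge0 => z _; rewrite lee_fin.
- exact: emeasurable_funM.
apply: ge0_ae_eq_integral => //.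
- by apply: emeasurable_funD; apply: emeasurable_funM => //; apply/measurable_EFinP; exact: msq.
- by apply: emeasurable_funM => //; apply: emeasurable_funM => //; exact/measurable_EFinP.
- move=> s _; apply: adde_ge0; rewrite mule_ge0//; first by rewrite lee_fin (sq0 g).
  by apply: integral_ge0 => z _; rewrite lee_fin.
- move=> s _; rewrite mule_ge0// mule_ge0// ?lee_fin//.
  by apply: integral_ge0 => z _; rewrite lee_fin mulr_ge0.
move: ae_pair; apply: filterS => s [G1 G2] _.
transitivity (((sq g s)%:E + \int[pair_law nu]_z (J s z)%:E) * weight k.-1 s).
  rewrite [RHS]ge0_muleDl ?lee_fin ?(sq0 g)//.
  by apply: integral_ge0 => z _; rewrite lee_fin.
by congr (_ * _); exact: pointwise.
Qed.

End alternating_step.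

(** * Independence of the next pair from the past *)

Section image_measure.
Context d1 d2 (T1 : measurableType d1) (T2 : measurableType d2) (R : realType).
Context (f : T1 -> T2) (mf : measurable_fun setT f).

(** The measurability proof is an argument so that the measure structure can be
    inferred from the term. *)
Definition image_measure (mu : {measure set T1 -> \bar R})
    (_ : measurable_fun setT f) : set T2 -> \bar R := pushforward mu f.

Section measure.
Variable mu : {measure set T1 -> \bar R}.

Let image0 : image_measure mu mf set0 = 0%E.
Proof. exact: (measure0 mu). Qed.

Let image_ge0 A : (0 <= image_measure mu mf A)%E.
Proof. exact: (measure_ge0 mu). Qed.

Let image_sigma_additive : semi_sigma_additive (image_measure mu mf).
Proof.
have mpre A : measurable A -> measurable (f @^-1` A).
  by move=> mA; rewrite -[X in measurable X]setTI; exact: mf.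
move=> F mF tF mUF; rewrite /image_measure /pushforward preimage_bigcup.
apply: measure_semi_sigma_additive => [n| |]; first exact: mpre.
  by move=> i j _ _ [x [Fi Fj]]; apply: (tF i j) => //; exists (f x).
by rewrite -preimage_bigcup; exact: mpre.
Qed.

HB.instance Definition _ := isMeasure.Build _ _ _ (image_measure mu mf)
  image0 image_ge0 image_sigma_additive.

End measure.

Section finite.
Variable mu : {finite_measure set T1 -> \bar R}.

Let image_fin : fin_num_fun (image_measure mu mf).
Proof.
move=> A mA; apply: fin_num_measure; rewrite -[X in measurable X]setTI.
exact: mf.
Qed.

HB.instance Definition _ :=
  Measure_isFinite.Build _ _ _ (image_measure mu mf) image_fin.

End finite.

End image_measure.

Section independence.
Context d (T : measurableType d) (R : realType) (P : probability T R).
Context (nu : probability R R) (Xs : nat -> {RV P >-> R}).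
Hypothesis Xs_indep : mutually_independent [set i | (1 <= i)%N] Xs.
Hypothesis Xs_law : forall i, (1 <= i)%N -> forall A : set R, measurable A ->
  distribution P (Xs i) A = nu A.
Local Open Scope ereal_scope.

(** A class of events stable under intersection that generates the sigma-algebra
    of the first [m] copies. *)
Definition past (m : nat) : set (set T) :=
  [set B | exists2 A : nat -> set R, (forall i, measurable (A i)) &
     B = \bigcap_(i in [set` iota 1 m]) (Xs i @^-1` A i)].

(** The sample space with the sigma-algebra of the past only; functions on it
    are measurable when they depend on the first [m] copies. *)
Definition past_type (m : nat) := g_sigma_algebraType (past m).

Let mX i (A : set R) : measurable A -> measurable (Xs i @^-1` A).
Proof. by move=> mA; rewrite -[X in measurable X]setTI; exact: measurable_funPT. Qed.

Let PX i (A : set R) : (1 <= i)%N -> measurable A -> P (Xs i @^-1` A) = nu A.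
Proof. by move=> i1 mA; rewrite -(Xs_law i1 mA). Qed.

Let mpast m : past m `<=` measurable.
Proof.
move=> _ [A mA ->]; apply: fin_bigcap_measurable => [|i _]; last exact: mX.
exact: finite_seq.
Qed.

Let past_setI m : setI_closed (past m).
Proof.
move=> _ _ [A mA ->] [B mB ->]; exists (fun i => A i `&` B i).
  by move=> i; exact: measurableI.
apply/seteqP; split => w.
  by move=> [wA wB] i im; split; [exact: wA|exact: wB].
by move=> wAB; split => i im; have [] := wAB i im.
Qed.

Let past_setT m : past m setT.
Proof. by exists (fun=> setT) => //; rewrite bigcapT. Qed.

Let next_pair m (w : T) : R * R := (Xs m.+1 w, Xs m.+2 w).

Let mnext m : measurable_fun setT (next_pair m).
Proof. exact: measurable_fun_pair. Qed.

Let mnextC m (C : set (R * R)) : measurable C -> measurable (next_pair m @^-1` C).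
Proof. by move=> mC; rewrite -[X in measurable X]setTI; exact: mnext. Qed.

(** Independence of [m + 2] copies, the last two being constrained by [A1] and
    [A2]. *)
Let past_rect m B (A1 A2 : set R) : past m B -> measurable A1 -> measurable A2 ->
  P (B `&` next_pair m @^-1` (A1 `*` A2)) = P B * (nu A1 * nu A2).
Proof.
move=> [A mA ->] m1 m2.
pose A' i := if i == m.+1 then A1 else if i == m.+2 then A2 else A i.
have mA' i : measurable (A' i) by rewrite /A'; case: ifP => // _; case: ifP.
have small i : i \in iota 1 m -> A' i = A i.
  rewrite mem_iota add1n ltnS => /andP[_ im].
  by rewrite /A' !ltn_eqF// ltnS// ltnW.
have iotaE : iota 1 m.+2 = iota 1 m ++ [:: m.+1; m.+2].
  by rewrite -(addn2 m) iotaD add1n addn2.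
have pos (s : seq nat) : {subset s <= iota 1 m.+2} ->
    forall i, i \in s -> [set i | (1 <= i)%N] i.
  by move=> sub i /sub; rewrite mem_iota => /andP[].
have sub1 : {subset iota 1 m <= iota 1 m.+2}.
  by move=> i; rewrite iotaE mem_cat => ->.
have := @Xs_indep (iota 1 m) A (iota_uniq _ _) (pos _ sub1) mA.
have := @Xs_indep (iota 1 m.+2) A' (iota_uniq _ _) (pos _ (fun _ => id)) mA'.
move: iotaE sub1 {pos}; move: (iota 1 m.+2) => s2 iotaE sub1.
rewrite [in RHS]iotaE big_cat /= !big_cons big_nil mule1.
rewrite (eq_big_seq (fun i => P (Xs i @^-1` A i))); last by move=> i /small ->.
move=> E2 E1; rewrite E1 -(PX (ltn0Sn m) m1) -(PX (ltn0Sn m.+1) m2).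
have -> : A1 = A' m.+1 by rewrite /A' eqxx.
have -> : A2 = A' m.+2 by rewrite /A' gtn_eqF// eqxx.
rewrite -E2; congr (P _).
apply/seteqP; split => w.
  move=> [wA [w1 w2]] i; rewrite /mkset iotaE mem_cat => /orP[im|].
    by rewrite small//; exact: wA.
  by rewrite !inE => /orP[/eqP ->|/eqP ->].
move=> wA; split; last by split; apply: wA; rewrite /mkset iotaE mem_cat !inE eqxx ?orbT.
by move=> i im; rewrite -small//; apply: wA; exact: sub1.
Qed.

(** Both sides are measures in [C] that agree on rectangles. *)
Let past_pair m B (C : set (R * R)) : past m B -> measurable C ->
  P (B `&` next_pair m @^-1` C) = P B * pair_law nu C.
Proof.
move=> pB mC; have mB := mpast pB.
have PBfin : P B \is a fin_num by exact: fin_num_measure.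
have PB0 : (0 <= fine (P B))%R by exact: fine_ge0.
pose m2 : {measure set (R * R) -> \bar R} :=
  [the {measure set (R * R) -> \bar R} of mscale (NngNum PB0) (pair_law nu)].
pose m1 : {measure set (R * R) -> \bar R} :=
  [the {measure set (R * R) -> \bar R} of image_measure (mrestr P mB) (@mnext m)].
have : m1 C = m2 C.
  apply: (measure_unique _ (fun=> setT) (@measurable_prod_measurableType _ _ R R)) => //.
  - move=> _ _ [A1 mA1 [A2 mA2 <-]] [B1 mB1 [B2 mB2 <-]]; rewrite -setXI.
    by exists (A1 `&` B1); [exact: measurableI|exists (A2 `&` B2) => //; exact: measurableI].
  - by move=> _; exists setT => //; exists setT => //; rewrite setXTT.
  - by rewrite bigcup_const//; exists 0%N.
  - move=> _ [A1 mA1 [A2 mA2 <-]].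
    rewrite /m1 /m2 /= /mscale /= fineK// /pushforward /mrestr setIC past_rect//.
    by congr (_ * _); apply/esym; exact: product_measure1E.
  - move=> _; apply: (@le_lt_trans _ _ (P setT)); last by rewrite probability_setT ltry.
    by rewrite /m1 /= /pushforward /mrestr preimage_setT setTI; apply: le_measure; rewrite ?inE.
by rewrite /m1 /m2 /= /pushforward /mrestr /mscale /= fineK// setIC.
Qed.

(** Both sides are measures in [B] that agree on a generating class stable under
    intersection. *)
Let past_next m B (C : set (R * R)) : <<s past m >> B -> measurable C ->
  P (B `&` next_pair m @^-1` C) = P B * pair_law nu C.
Proof.
move=> pB mC.
have Cfin : pair_law nu C \is a fin_num by exact: fin_num_measure.
have C0 : (0 <= fine (pair_law nu C))%R by exact: fine_ge0.
pose m2 : {measure set T -> \bar R} :=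
  [the {measure set T -> \bar R} of mscale (NngNum C0) P].
pose m1 : {measure set T -> \bar R} :=
  [the {measure set T -> \bar R} of mrestr P (mnextC m mC)].
have : m1 B = m2 B.
  apply: (@g_sigma_algebra_measure_unique _ R T (past m) (@mpast m) (fun=> setT)) => //.
  - by rewrite bigcup_const//; exists 0%N.
  - move=> A pA; rewrite /m1 /m2 /= /mrestr /mscale /= fineK// past_pair//.
    by rewrite muleC.
  - move=> _; apply: (@le_lt_trans _ _ (P setT)); last by rewrite probability_setT ltry.
    rewrite /m1 /= /mrestr setTI; apply: le_measure; rewrite ?inE//.
    exact: mnextC.
by rewrite /m1 /m2 /= /mrestr /mscale /= fineK// muleC.
Qed.

Let to_past m : T -> past_type m := idfun.

Let mto_past m : measurable_fun setT (@to_past m).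
Proof.
move=> _ B mB; rewrite setTI.
have : <<s past m >> `<=` (measurable : set (set T)).
  by apply: smallest_sub; [exact: sigma_algebra_measurable|exact: mpast].
exact.
Qed.

(** The joint law of the past and the next pair is a product, since it factors
    on product sets; the identity is Tonelli's theorem for it. *)
Lemma independent_next m (f : past_type m * (R * R) -> \bar R) :
  measurable_fun setT f -> (forall z, 0 <= f z) ->
  \int[P]_w f (w, (Xs m.+1 w, Xs m.+2 w)) =
  \int[pair_law nu]_z \int[P]_w f (w, z).
Proof.
move=> mf f0.
pose pw (w : T) : past_type m * (R * R) := (w, (Xs m.+1 w, Xs m.+2 w)).
have mpw : measurable_fun setT pw.
  by apply: measurable_fun_pair; [exact: mto_past|exact: mnext].
have -> : \int[P]_w f (w, (Xs m.+1 w, Xs m.+2 w)) = \int[image_measure P mpw]_z f z.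
  by rewrite [RHS](ge0_integral_pushforward mpw).
transitivity (\int[(image_measure P (@mto_past m) \x pair_law nu)]_z f z).
  apply: eq_measure_integral => A mA _; apply/esym.
  apply: product_measure_unique => // B C mB mC.
  rewrite /= /image_measure /= /pushforward.
  exact: past_next.
rewrite fubini_tonelli1// fubini_tonelli//.
apply: eq_integral => z _.
rewrite [LHS](ge0_integral_pushforward (@mto_past m))//.
exact: (measurableT_comp mf (pair2_measurable z)).
Qed.

Lemma measurable_past m i : (1 <= i <= m)%N ->
  measurable_fun setT (Xs i : past_type m -> R).
Proof.
move=> /andP[i1 im] _ A mA; rewrite setTI; apply: sub_sigma_algebra.
exists (fun j => if j == i then A else setT); first by move=> j; case: ifP.
apply/seteqP; split => w.
  by move=> wA j _; case: eqP => [->|].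
by move=> /(_ i); rewrite /= mem_iota i1 add1n ltnS im eqxx; exact.
Qed.

End independence.

(** * The path weight and its expectation *)

Section path_weights.
Context {R : realType} (p : R -> R) (ell : int) (l : nat -> int) (b : nat -> R -> R).

(** The factors of the remainder grouped by pair rather than by kind, each link
    joining a pair to the next inner one; the order indicator of the innermost
    pair is left out. *)
Definition path_weight (n : nat) (x : nat -> R) : R :=
  \prod_(1 <= i < n.+1)
    (link l i (x (2 * i - 1)%N, x (2 * i)%N) (x (2 * i + 1)%N, x (2 * i + 2)%N) *
     pair_density p b i (x (2 * i + 1)%N, x (2 * i + 2)%N)).

Lemma path_weightS n x : path_weight n.+1 x = path_weight n x *
  (link l n.+1 (x (2 * n + 1)%N, x (2 * n + 2)%N) (x (2 * n + 3)%N, x (2 * n + 4)%N) *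
   pair_density p b n.+1 (x (2 * n + 3)%N, x (2 * n + 4)%N)).
Proof.
rewrite /path_weight big_nat_recr//=.
have -> : (2 * n.+1 - 1 = 2 * n + 1)%N by lia.
have -> : (2 * n.+1 = 2 * n + 2)%N by lia.
have -> : (2 * n + 2 + 1 = 2 * n + 3)%N by lia.
by have -> : (2 * n + 2 + 2 = 2 * n + 4)%N by lia.
Qed.

Lemma path_weightE (h : nat -> R -> R) n (x : nat -> R) :
  (forall i j, (1 <= i <= n)%N -> (1 <= j <= 2 * n + 2)%N ->
     Delta (- l i) (h i) (x j) = b i (x j)) ->
  Phi p ell l n x * hprod l h n x =
  (if n == 0%N then 1 else cut ell (x (2 * n + 1)%N, x (2 * n + 2)%N)) * path_weight n x.
Proof.
move=> hb; rewrite /Phi; case: (eqVneq n 0%N) hb => [->|n0] hb.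
  by rewrite /hprod /path_weight !big_geq.
have -> : \prod_(3 <= i < (2 * n + 3)%N) p (x i) =
    \prod_(1 <= i < n.+1) (p (x (2 * i + 1)%N) * p (x (2 * i + 2)%N)).
  elim: (n) => [|m IH]; first by rewrite !big_geq.
  rewrite [in RHS]big_nat_recr//= -IH.
  have -> : (2 * m.+1 + 3 = (2 * m + 3).+2)%N by lia.
  rewrite !big_nat_recr ?leq_addl//=; last by lia.
  have -> : (2 * m.+1 + 1 = 2 * m + 3)%N by lia.
  have -> : (2 * m.+1 + 2 = (2 * m + 3).+1)%N by lia.
  by rewrite mulrA.
rewrite -prodfV /cut /=.
rewrite [X in X * hprod _ _ _ _]mulrAC mulrC mulrA [LHS]mulrC; congr (_ * _).
rewrite /hprod /path_weight -!big_split /=; apply: eq_big_nat => i /andP[i1 ni].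
rewrite /link /pair_density /= !hb; try lia.
by rewrite invfM; ring.
Qed.

End path_weights.

Section path_expectation.
Context d (T : measurableType d) (R : realType) (P : probability T R).
Context (nu : probability R R) (Xs : nat -> {RV P >-> R}).
Hypothesis Xs_indep : mutually_independent [set i | (1 <= i)%N] Xs.
Hypothesis Xs_law : forall i, (1 <= i)%N -> forall A : set R, measurable A ->
  distribution P (Xs i) A = nu A.
Context (p : R -> R) (l : nat -> int) (b : nat -> R -> R).
Hypotheses (mp : measurable_fun [set: R] p) (p0 : forall x, (0 <= p x)%R).
Hypotheses (mb : forall k, measurable_fun [set: R] (b k))
  (b0 : forall k x, (0 <= b k x)%R).
Local Open Scope ereal_scope.

Let W n w := path_weight p l b n (Xs^~ w).

Let W0 n w : (0 <= W n w)%R.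
Proof.
by apply: prodr_ge0 => i _; rewrite mulr_ge0 ?link_ge0// pair_density_ge0.
Qed.

Let measurable_link_pair k d' (T' : measurableType d') (f1 f2 g1 g2 : T' -> R) :
  measurable_fun setT f1 -> measurable_fun setT f2 ->
  measurable_fun setT g1 -> measurable_fun setT g2 ->
  measurable_fun setT (fun w => link l k (f1 w, f2 w) (g1 w, g2 w)).
Proof. by move=> *; apply: measurable_funM; exact: measurable_chi. Qed.

Lemma measurable_path_weight d' (T' : measurableType d') (Y : nat -> T' -> R) n :
  (forall i, (1 <= i <= 2 * n + 2)%N -> measurable_fun setT (Y i)) ->
  measurable_fun setT (fun w => path_weight p l b n (Y^~ w)).
Proof.
elim: n => [|n IH] mY.
  rewrite [F in measurable_fun _ F](_ : _ = cst 1%R); first exact: measurable_cst.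
  by apply/funext => w; rewrite /path_weight big_geq.
rewrite [F in measurable_fun _ F](_ : _ = (fun w => path_weight p l b n (Y^~ w) *
  (link l n.+1 (Y (2 * n + 1)%N w, Y (2 * n + 2)%N w)
     (Y (2 * n + 3)%N w, Y (2 * n + 4)%N w) *
   pair_density p b n.+1 (Y (2 * n + 3)%N w, Y (2 * n + 4)%N w)))%R); last first.
  by apply/funext => w; rewrite path_weightS.
apply: measurable_funM; first by apply: IH => i ?; apply: mY; lia.
apply: measurable_funM; first by apply: measurable_link_pair; apply: mY; lia.
apply: (measurableT_comp (measurable_pair_density mp mb n.+1)).
by apply: measurable_fun_pair; apply: mY; lia.
Qed.

(** Induction on [n]: given the past, the innermost pair is distributed as two
    independent copies, and the expectation over the past of the link to a fixed
    innermost pair is the same statement one step earlier. *)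
Lemma expectation_path_weight n (f : R * R -> \bar R) :
  measurable_fun setT f -> (forall z, 0 <= f z) ->
  \int[P]_w (f (Xs (2 * n + 1)%N w, Xs (2 * n + 2)%N w) *
     (path_weight p l b n (Xs^~ w))%:E) =
  \int[pair_law nu]_z (f z * weight nu p l b n z).
Proof.
elim: n f => [|n IH] f mf f0.
  have := @independent_next _ _ _ P nu Xs Xs_indep Xs_law 0
    (fun wz => f wz.2) (measurable_snd_comp mf) (fun wz => f0 wz.2).
  rewrite /=; under eq_integral => w _.
    over.
  move=> E; transitivity (\int[P]_w f (Xs 1%N w, Xs 2%N w)).
    by apply: eq_integral => w _; rewrite /path_weight big_geq// mule1.
  rewrite E; apply: eq_integral => z _.
  rewrite mule1; apply: (etrans (integral_cst P measurableT (f z))).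
  by rewrite [X in _ * X](probability_setT P) mule1.
pose W' z w := (link l n.+1 (Xs (2 * n + 1)%N w, Xs (2 * n + 2)%N w) z * W n w)%R.
pose phi (wz : past_type Xs (2 * n + 2) * (R * R)) :=
  f wz.2 * (pair_density p b n.+1 wz.2)%:E * (W' wz.2 wz.1)%:E.
have phi0 wz : 0 <= phi wz.
  apply: mule_ge0; first by apply: mule_ge0 => //; rewrite lee_fin pair_density_ge0.
  by rewrite lee_fin mulr_ge0// link_ge0.
have mphi : measurable_fun setT phi.
  apply: emeasurable_funM; first apply: emeasurable_funM.
  - exact: measurable_snd_comp.
  - by apply/measurable_EFinP; apply: measurable_snd_comp; exact: measurable_pair_density.
  - apply/measurable_EFinP; apply: measurable_funM; last first.
      apply: measurable_fst_comp; apply: measurable_path_weight => i ?.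
      exact: measurable_past.
    apply: measurable_link_pair.
    + by apply: measurable_fst_comp; apply: measurable_past; lia.
    + by apply: measurable_fst_comp; apply: measurable_past; lia.
    + exact: (measurable_snd_comp (f := fst)).
    + exact: (measurable_snd_comp (f := snd)).
have := independent_next Xs_indep Xs_law mphi phi0.
have i1 : ((2 * n + 2).+1 = 2 * n.+1 + 1)%N by lia.
have i2 : ((2 * n + 2).+2 = 2 * n.+1 + 2)%N by lia.
rewrite i2 i1 => E.
transitivity (\int[P]_w phi (w, (Xs (2 * n.+1 + 1)%N w, Xs (2 * n.+1 + 2)%N w))).
  apply: eq_integral => w _; rewrite /phi /W' /W /= path_weightS.
  have -> : (2 * n + 3 = 2 * n.+1 + 1)%N by lia.
  have -> : (2 * n + 4 = 2 * n.+1 + 2)%N by lia.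
  rewrite -!muleA -!EFinM; congr (_ * _%:E).
  by ring.
rewrite E; apply: eq_integral => z _; rewrite /phi /=.
rewrite -(IH (fun s => (link l n.+1 s z)%:E)); last 2 first.
- apply/measurable_EFinP.
  exact: (measurableT_comp (measurable_link l n.+1) (pair1_measurable z)).
- by move=> s; rewrite lee_fin link_ge0.
rewrite muleA ge0_integralZl//; last 3 first.
- apply/measurable_EFinP; apply: measurable_funM; last first.
    exact: measurable_path_weight.
  exact: measurable_link_pair.
- by move=> w _; rewrite lee_fin mulr_ge0// link_ge0.
- by rewrite mule_ge0// lee_fin pair_density_ge0.
Qed.

End path_expectation.

(** * The variance and the alternating sum *)

Section variance_as_dispersion.
Context {R : realType} (nu : probability R R) (p : R -> R).
Context (ell : int) (l : nat -> int) (b : nat -> R -> R) (G : set R).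
Local Open Scope ereal_scope.
Hypotheses (mG : measurable G) (nG : nu (~` G) = 0).
Hypothesis cut1 : forall x y, G x -> G y -> x != y ->
  (cut ell (x, y) + cut ell (y, x) = 1)%R.

(** Lagrange's identity with [q = b = 1]: the variance is half the mean squared
    difference of two independent copies. *)
Lemma variance_dispersion (g : R -> R) : measurable_fun setT g ->
  nu.-integrable setT (EFin \o g) ->
  \int[nu]_x ((g x) ^+ 2)%:E =
  (fine (\int[nu]_x (g x)%:E) ^+ 2)%:E + dispersion nu p ell l b g 0.
Proof.
move=> mg ig; pose K := fine (\int[nu]_x (g x)%:E).
have KE : \int[nu]_x (g x)%:E = K%:E by rewrite fineK//; exact: integrable_fin_num.
have i1 : nu.-integrable setT (EFin \o (cst 1%R \* cst 1%R)%R).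
  have -> : EFin \o (cst 1%R \* cst 1%R)%R = (cst 1%:E : R -> \bar R).
    by apply/funext => x; rewrite /= mulr1.
  exact: finite_measure_integrable_cst.
have ia : nu.-integrable setT (EFin \o (cst 1%R \* g)%R).
  by apply: eq_integrable ig => // x _; rewrite /= mul1r.
have E1 : \int[nu]_x ((cst 1 x : R) * cst 1 x)%:E = 1%:E.
  rewrite /= mulr1; apply: (etrans (integral_cst nu measurableT 1)).
  by rewrite mul1e; exact: (probability_setT nu).
have EK : \int[nu]_x ((cst 1 x : R) * g x)%:E = K%:E.
  by under eq_integral do rewrite /= mul1r.
have LI := @lagrange_identity R nu (fun x y => chi (ell ^+ 2) x y) G (cst 1%R) g (cst 1%R)
  _ _ mG nG (measurable_cut ell) (@chi_ge0 R _) cut1 (measurable_cst _) mg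
  (measurable_cst _) (fun=> ler01) (fun=> ler01) (fun _ _ => ltr01) i1 ia E1 EK.
rewrite mul1e in LI; rewrite -/K.
transitivity (\int[nu]_x (cst 1 x * (g x ^+ 2 / cst 1 x))%:E).
  by apply: eq_integral => x _; rewrite /= mul1r divr1.
rewrite LI; congr (_ + _).
rewrite /dispersion pair_lawE.
- apply: eq_integral => x _; apply: eq_integral => y _; rewrite /= mule1.
  by congr EFin; rewrite /cut /= !divr1 !mul1r mulrC.
- apply: emeasurable_funM; last exact: measurable_cst.
  apply/measurable_EFinP; apply: measurable_funM; last exact: measurable_cut.
  apply: measurable_funX; apply: measurable_funB.
  + exact: measurable_snd_comp.
  + exact: measurable_fst_comp.
- by move=> z; rewrite mule1 lee_fin mulr_ge0 ?sqr_ge0// cut_ge0.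
Qed.

Lemma dispersion_ae (phi psi : R -> R) n :
  measurable_fun setT p -> (forall k, measurable_fun setT (b k)) ->
  (forall x, 0 <= p x)%R -> (forall k x, 0 <= b k x)%R ->
  measurable_fun setT phi -> measurable_fun setT psi ->
  (forall x, G x -> phi x = psi x) ->
  dispersion nu p ell l b phi n = dispersion nu p ell l b psi n.
Proof.
move=> mp mb p0 b0 mphi mpsi GE.
have mf (f : R -> R) : measurable_fun setT f -> measurable_fun setT (fun z : R * R =>
    ((f z.2 - f z.1) ^+ 2 * cut ell z)%:E * weight nu p l b n z).
  move=> mf; apply: emeasurable_funM; last exact: measurable_weight.
  apply/measurable_EFinP; apply: measurable_funM; last exact: measurable_cut.
  apply: measurable_funX; apply: measurable_funB.
  + exact: measurable_snd_comp.
  + exact: measurable_fst_comp.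
have f0 (f : R -> R) (z : R * R) : 0 <= ((f z.2 - f z.1) ^+ 2 * cut ell z)%:E * weight nu p l b n z.
  by rewrite mule_ge0 ?weight_ge0// lee_fin mulr_ge0 ?sqr_ge0// cut_ge0.
apply: ge0_ae_eq_integral => //; try exact: mf.
move: (ae_pair mG nG); apply: filterS => z [z1 z2] _.
by rewrite (GE _ z1) (GE _ z2).
Qed.

End variance_as_dispersion.

Section alternating_sum.
Context {R : realType}.
Local Open Scope ereal_scope.

(** Finiteness of the terms [E k] makes all the remainders finite, since these
    are nonnegative; the sum then telescopes in the reals. *)
Lemma alternating_sum (n : nat) (D E : nat -> \bar R) :
  (forall k, 0 <= D k) ->
  (forall k, (1 <= k <= n)%N -> D k.-1 + D k = E k) ->
  (forall k, (1 <= k <= n)%N -> E k \is a fin_num) ->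
  (0 < n)%N ->
  (fine (D 0%N) = \sum_(1 <= k < n.+1) (-1) ^+ k.-1 * fine (E k) +
     (-1) ^+ n * fine (D n))%R.
Proof.
move=> D0 DE Efin n0.
have Dfin k : (k <= n)%N -> D k \is a fin_num.
  move=> kn; have [->|k0] := posnP k.
    have := Efin 1%N n0; rewrite -DE//= fin_numD; by move=> /andP[].
  have k1n : (1 <= k <= n)%N by rewrite k0.
  by have := Efin k k1n; rewrite -DE//= fin_numD; move=> /andP[].
have step k : (1 <= k <= n)%N -> (fine (E k) = fine (D k.-1) + fine (D k))%R.
  move=> kn; rewrite -DE// fineD// Dfin//.
  + by case/andP: kn => _; apply: leq_trans; exact: leq_pred.
  + by case/andP: kn.
have main m : (m <= n)%N ->
  (fine (D 0%N) = \sum_(1 <= k < m.+1) (-1) ^+ k.-1 * fine (E k) +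
     (-1) ^+ m * fine (D m))%R.
  elim: m => [|m IH] mn; first by rewrite big_geq// add0r expr0 mul1r.
  rewrite [in RHS]big_nat_recr//= (IH (ltnW mn)) (step m.+1)//= exprS.
  by move: (bigop _ _ _) (fine (D m)) (fine (D m.+1)) ((-1) ^+ m)%R => *; ring.
exact: main.
Qed.

End alternating_sum.

(** * Expansion of the covariance of two chains *)

Section covariance_expansion.
Context d (T : measurableType d) (R : realType) (P : probability T R).
Context (X : {RV P >-> R}) (Xs : nat -> {RV P >-> R}) (nu : probability R R).
Hypothesis X_law : forall A : set R, measurable A -> distribution P X A = nu A.
Hypothesis Xs_indep : mutually_independent [set i | (1 <= i)%N] Xs.
Hypothesis Xs_law : forall i, (1 <= i)%N -> forall A : set R, measurable A ->
  distribution P (Xs i) A = nu A.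
Context (p : R -> R) (ell : int) (l : nat -> int) (b hh : nat -> R -> R).
Context (G : set R) (n : nat).
Hypotheses (mp : measurable_fun [set: R] p) (p0 : forall x, (0 <= p x)%R).
Hypotheses (mb : forall k, measurable_fun [set: R] (b k))
  (b0 : forall k x, (0 <= b k x)%R).
Hypothesis mh : forall k, measurable_fun [set: R] (hh k).
Hypotheses (mG : measurable G) (nG : nu (~` G) = 0%E).
Hypothesis cut1 : forall x y, G x -> G y -> x != y ->
  (cut ell (x, y) + cut ell (y, x) = 1)%R.
Hypothesis n1 : (0 < n)%N.
Hypothesis lk : forall k, (1 <= k <= n)%N -> compatible_step ell (l k).
Hypothesis bG : forall k x, (1 <= k <= n)%N -> G x -> (0 < b k x)%R.
Hypothesis intb : forall k u v, (1 <= k <= n)%N -> G u -> G v -> (u <= v)%R ->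
  nu.-integrable setT (fun x => (Phi_p p (l k) u x v * b k x)%:E) /\
  (\int[nu]_x (Phi_p p (l k) u x v * b k x)%:E = (hh k v - hh k u)%:E)%E.
Hypothesis Gamma_fin : forall k, (1 <= k <= n)%N ->
  \forall w \ae P, Gamma_weight nu p l b hh k (X w) \is a fin_num.

Definition mean (Y : T -> R) : R := fine (\int[P]_w (Y w)%:E)%E.

Lemma mean_lin3 (c1 c2 c3 : R) (f1 f2 f3 : T -> R) :
  has_mean P f1 -> has_mean P f2 -> has_mean P f3 ->
  mean (fun w => c1 * f1 w + c2 * f2 w + c3 * f3 w) =
  c1 * mean f1 + c2 * mean f2 + c3 * mean f3.
Proof.
move=> i1 i2 i3.
have fE f : has_mean P f -> (\int[P]_w (f w)%:E = (mean f)%:E)%E.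
  by move=> fi; rewrite /mean fineK//; exact: integrable_fin_num.
by rewrite {1}/mean (integral_lin3 c1 c2 c3 i1 i2 i3 (fE _ i1) (fE _ i2) (fE _ i3)).
Qed.

Lemma integral_law (f : R -> \bar R) : measurable_fun setT f ->
  (forall x, 0 <= f x)%E -> (\int[nu]_x f x = \int[P]_w f (X w))%E.
Proof.
move=> mf f0; rewrite -(ge0_integral_distribution X)//.
by apply: eq_measure_integral => A mA _; exact/esym/X_law.
Qed.

Lemma law_integrable (f : R -> R) : measurable_fun setT f ->
  has_mean P (fun w => f (X w)) ->
  nu.-integrable setT (EFin \o f) /\ (fine (\int[nu]_x (f x)%:E) = mean (f \o X))%E.
Proof.
move=> mf fi.
have mf' : measurable_fun setT (EFin \o f) by exact/measurable_EFinP.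
split.
  apply/integrableP; split => //.
  rewrite integral_law//; last exact: measurableT_comp.
  by case/integrableP : fi.
have -> : (\int[nu]_x (f x)%:E = \int[distribution P X]_x (f x)%:E)%E.
  by apply: eq_measure_integral => A mA _; exact/esym/X_law.
by rewrite (integral_distribution (X := X) mf' fi).
Qed.

Definition energy_coefficient k (x : R) : R :=
  fine (Gamma_weight nu p l b hh k x) / b k x.

Definition chain_remainder (f g : R -> R) (w : T) : R :=
  cut ell (Xs (2 * n + 1)%N w, Xs (2 * n + 2)%N w) * path_weight p l b n (Xs^~ w) *
  ((f (Xs (2 * n + 2)%N w) - f (Xs (2 * n + 1)%N w)) *
   (g (Xs (2 * n + 2)%N w) - g (Xs (2 * n + 1)%N w))).

(** Borel sequences behaving like the iterated differences on [G]: [a k] is the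
    difference of [g k.-1], known through the increments it produces, and its
    quotient by [b k] is [g k]. Unlike the pointwise recursion, these conditions
    are stable under addition of chains. *)
Record difference_chain (a g : nat -> R -> R) : Prop := {
  chain_measurable_diff : forall k, measurable_fun [set: R] (a k);
  chain_measurable : forall k, measurable_fun [set: R] (g k);
  chain_quotient : forall k x, (1 <= k <= n)%N -> G x -> g k x = a k x / b k x;
  chain_integral : forall k u v, (1 <= k <= n)%N -> G u -> G v -> u <= v ->
    nu.-integrable [set: R] (fun x => (Phi_p p (l k) u x v * a k x)%:E) /\
    (\int[nu]_x (Phi_p p (l k) u x v * a k x)%:E = (g k.-1 v - g k.-1 u)%:E)%E }.

Local Notation dispersion := (dispersion nu p ell l b).
Local Notation energy := (weighted_energy nu p l b hh).

Lemma energyE (a : R -> R) k : (1 <= k <= n)%N -> measurable_fun setT a ->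
  energy a k = (\int[P]_w (energy_coefficient k (X w) * (a (X w) * a (X w)))%:E)%E.
Proof.
move=> kn ma; rewrite /weighted_energy.
have mf : measurable_fun setT
    (fun x => (a x ^+ 2 / b k x)%:E * Gamma_weight nu p l b hh k x)%E.
  apply: emeasurable_funM; last exact: measurable_Gamma_weight.
  apply/measurable_EFinP; apply: measurable_funM; first exact: measurable_funX.
  exact: measurable_fun_inv.
rewrite integral_law//; last first.
  by move=> x; rewrite mule_ge0 ?Gamma_weight_ge0// lee_fin divr_ge0 ?sqr_ge0.
apply: ae_eq_integral => //.
- exact: (measurableT_comp mf).
- apply/measurable_EFinP.
  have : measurable_fun setT (fun x => energy_coefficient k x * (a x * a x)).
    apply: measurable_funM; last exact: measurable_funM.
    apply: measurable_funM; last exact: measurable_fun_inv.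
    by apply: measurableT_comp => //; exact: measurable_Gamma_weight.
  by move=> mc; exact: (measurableT_comp mc).
- have := Gamma_fin kn; apply: filterS => w wfin _.
  rewrite /energy_coefficient -{1}(fineK wfin) -EFinM; congr EFin.
  by move: (fine _) ((b k (X w))^-1) (a (X w)) => A B C; ring.
Qed.

Lemma dispersion_remainder (g : R -> R) : measurable_fun setT g ->
  dispersion g n = (\int[P]_w (chain_remainder g g w)%:E)%E.
Proof.
move=> mg; rewrite /dispersion -(expectation_path_weight Xs_indep Xs_law l mp p0 mb b0).
- apply: eq_integral => w _; rewrite -EFinM /chain_remainder /=; congr EFin.
  by rewrite -expr2; move: (path_weight _ _ _ _ _) (cut _ _) => A B; ring.
- apply/measurable_EFinP; apply: measurable_funM; last exact: measurable_cut.
  apply: measurable_funX; apply: measurable_funB.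
  + exact: measurable_snd_comp.
  + exact: measurable_fst_comp.
- by move=> z; rewrite lee_fin mulr_ge0 ?sqr_ge0// cut_ge0.
Qed.

(** Alternating sum of the steps, from the variance, which is the dispersion of
    order 0, down to the dispersion of order [n]. *)
Lemma variance_expansion (a g : nat -> R -> R) : difference_chain a g ->
  has_mean P (g 0%N \o X) ->
  (forall k, (1 <= k <= n)%N -> has_mean P (fun w =>
     energy_coefficient k (X w) * (a k (X w) * a k (X w)))) ->
  mean (fun w => g 0%N (X w) * g 0%N (X w)) - mean (g 0%N \o X) ^+ 2 =
  \sum_(1 <= k < n.+1) (-1) ^+ k.-1 *
     mean (fun w => energy_coefficient k (X w) * (a k (X w) * a k (X w))) +
  (-1) ^+ n * mean (chain_remainder (g n) (g n)).
Proof.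
move=> [ma mg gE inta] ig ie.
have [ig' mE] := law_integrable (mg 0%N) ig.
pose D k := dispersion (g k) k.
pose E k := energy (a k) k.
have D0 k : (0 <= D k)%E.
  apply: integral_ge0 => z _; rewrite mule_ge0 ?weight_ge0//.
  by rewrite lee_fin mulr_ge0 ?sqr_ge0// cut_ge0.
have DE k : (1 <= k <= n)%N -> (D k.-1 + D k = E k)%E.
  move=> kn; have k1 : (0 < k)%N by case/andP: kn.
  rewrite /E -(dispersion_step mp p0 mb b0 mh mG nG cut1 k1 (lk kn) (ma k)
    (mg k.-1) (fun x Gx => bG kn Gx) (fun u v => @intb k u v kn) (fun u v => @inta k u v kn)).
  congr (_ + _)%E; apply: (dispersion_ae _ _ mG nG) => //.
  - by apply: measurable_funM => //; exact: measurable_fun_inv.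
  - by move=> x Gx; exact: gE.
have Efin k : (1 <= k <= n)%N -> E k \is a fin_num.
  by move=> kn; rewrite /E energyE//; exact: integrable_fin_num (ie k kn).
have := alternating_sum D0 DE Efin n1.
have -> : fine (D n) = mean (chain_remainder (g n) (g n)).
  by rewrite /D dispersion_remainder.
have -> : \sum_(1 <= k < n.+1) (-1) ^+ k.-1 * fine (E k) =
  \sum_(1 <= k < n.+1) (-1) ^+ k.-1 *
     mean (fun w => energy_coefficient k (X w) * (a k (X w) * a k (X w))).
  by apply: eq_big_nat => k kn; rewrite /E energyE.
move=> <-.
have D0fin : D 0%N \is a fin_num.
  have n11 : (1 <= 1 <= n)%N by rewrite n1.
  by have := Efin 1%N n11; rewrite -DE// fin_numD => /andP[].
have -> : mean (fun w => g 0%N (X w) * g 0%N (X w)) =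
    fine (\int[nu]_x (g 0%N x ^+ 2)%:E)%E.
  rewrite (@integral_law (fun x => (g 0%N x ^+ 2)%:E)) //.
  - by apply/measurable_EFinP; exact: measurable_funX.
  - by move=> x; rewrite lee_fin sqr_ge0.
rewrite (variance_dispersion p l b mG nG cut1 (mg 0%N) ig') fineD// mE /=.
by rewrite addrAC subrr add0r.
Qed.

Lemma difference_chainD (a1 g1 a2 g2 : nat -> R -> R) :
  difference_chain a1 g1 -> difference_chain a2 g2 ->
  difference_chain (fun k x => a1 k x + a2 k x) (fun k x => g1 k x + g2 k x).
Proof.
move=> [ma1 mg1 gE1 inta1] [ma2 mg2 gE2 inta2]; split.
- by move=> k; exact: measurable_funD.
- by move=> k; exact: measurable_funD.
- by move=> k x kn Gx; rewrite gE1// gE2// mulrDl.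
- move=> k u v kn Gu Gv uv.
  have [i1 e1] := inta1 k u v kn Gu Gv uv.
  have [i2 e2] := inta2 k u v kn Gu Gv uv.
  have -> : (fun x => (Phi_p p (l k) u x v * (a1 k x + a2 k x))%:E) =
      (fun x => (Phi_p p (l k) u x v * a1 k x)%:E + (Phi_p p (l k) u x v * a2 k x)%:E)%E.
    by apply/funext => x; rewrite mulrDr EFinD.
  split; first exact: integrableD.
  by rewrite integralD// e1 e2 -EFinD; congr EFin; ring.
Qed.

(** Both sides are symmetric bilinear in the two chains, and the variance
    expansion is their equality on the diagonal: polarization. *)
Lemma covariance_expansion (a1 g1 a2 g2 : nat -> R -> R) :
  difference_chain a1 g1 -> difference_chain a2 g2 ->
  (forall g g', [\/ g = g1 | g = g2] -> [\/ g' = g1 | g' = g2] ->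
    has_mean P (fun w => g 0%N (X w)) /\
    has_mean P (fun w => g 0%N (X w) * g' 0%N (X w)) /\
    has_mean P (chain_remainder (g n) (g' n))) ->
  (forall a a' k, [\/ a = a1 | a = a2] -> [\/ a' = a1 | a' = a2] ->
    (1 <= k <= n)%N ->
    has_mean P (fun w => energy_coefficient k (X w) * (a k (X w) * a' k (X w)))) ->
  mean (fun w => g1 0%N (X w) * g2 0%N (X w)) -
    mean (g1 0%N \o X) * mean (g2 0%N \o X) =
  \sum_(1 <= k < n.+1) (-1) ^+ k.-1 *
     mean (fun w => energy_coefficient k (X w) * (a1 k (X w) * a2 k (X w))) +
  (-1) ^+ n * mean (chain_remainder (g1 n) (g2 n)).
Proof.
move=> c1 c2 ig ie.
have O1 (A : Type) (x y : A) : [\/ x = x | x = y] by left.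
have O2 (A : Type) (x y : A) : [\/ y = x | y = y] by right.
have [m1 [m11 r11]] := ig _ _ (O1 _ g1 g2) (O1 _ g1 g2).
have [_ [m12 r12]] := ig _ _ (O1 _ g1 g2) (O2 _ g1 g2).
have [m2 [m22 r22]] := ig _ _ (O2 _ g1 g2) (O2 _ g1 g2).
have e11 k := ie _ _ k (O1 _ a1 a2) (O1 _ a1 a2).
have e12 k := ie _ _ k (O1 _ a1 a2) (O2 _ a1 a2).
have e22 k := ie _ _ k (O2 _ a1 a2) (O2 _ a1 a2).
have V1 := variance_expansion c1 m1 e11.
have V2 := variance_expansion c2 m2 e22.
have polar (f11 f12 f22 f : T -> R) :
    has_mean P f11 -> has_mean P f12 -> has_mean P f22 ->
    (forall w, f w = 1 * f11 w + 2 * f12 w + 1 * f22 w) ->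
    has_mean P f /\ mean f = mean f11 + 2 * mean f12 + mean f22.
  move=> i11 i12 i22 /funext ->; split; first exact: integrable_lin3.
  by rewrite mean_lin3// !mul1r.
have eS k (kn : (1 <= k <= n)%N) := polar _ _ _ (fun w => energy_coefficient k (X w) *
    ((a1 k (X w) + a2 k (X w)) * (a1 k (X w) + a2 k (X w))))
  (e11 k kn) (e12 k kn) (e22 k kn).
have {}eS k : (1 <= k <= n)%N ->
    has_mean P (fun w => energy_coefficient k (X w) *
      ((a1 k (X w) + a2 k (X w)) * (a1 k (X w) + a2 k (X w)))) /\
    mean (fun w => energy_coefficient k (X w) *
      ((a1 k (X w) + a2 k (X w)) * (a1 k (X w) + a2 k (X w)))) =
    mean (fun w => energy_coefficient k (X w) * (a1 k (X w) * a1 k (X w))) +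
    2 * mean (fun w => energy_coefficient k (X w) * (a1 k (X w) * a2 k (X w))) +
    mean (fun w => energy_coefficient k (X w) * (a2 k (X w) * a2 k (X w))).
  by move=> kn; apply: eS => // w; ring.
have [|_ gS] := polar _ _ _ (fun w => (g1 0%N (X w) + g2 0%N (X w)) *
    (g1 0%N (X w) + g2 0%N (X w))) m11 m12 m22; first by move=> w; ring.
have [|_ rS] := polar _ _ _
  (chain_remainder (fun x => g1 n x + g2 n x) (fun x => g1 n x + g2 n x))
  r11 r12 r22; first by move=> w; rewrite /chain_remainder; ring.
have mS : has_mean P (fun w => g1 0%N (X w) + g2 0%N (X w)) /\
    mean (fun w => g1 0%N (X w) + g2 0%N (X w)) = mean (g1 0%N \o X) + mean (g2 0%N \o X).
  have -> : (fun w => g1 0%N (X w) + g2 0%N (X w)) =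
      (fun w => 1 * g1 0%N (X w) + 1 * g2 0%N (X w) + 0 * g2 0%N (X w)).
    by apply/funext => w; ring.
  split; first exact: integrable_lin3.
  by rewrite mean_lin3// !mul1r mul0r addr0.
have VS := variance_expansion (difference_chainD c1 c2) mS.1 (fun k kn => (eS k kn).1).
rewrite gS rS mS.2 in VS.
have SE : \sum_(1 <= k < n.+1) (-1) ^+ k.-1 * mean (fun w => energy_coefficient k (X w) *
    ((a1 k (X w) + a2 k (X w)) * (a1 k (X w) + a2 k (X w)))) =
  \sum_(1 <= k < n.+1) (-1) ^+ k.-1 *
     mean (fun w => energy_coefficient k (X w) * (a1 k (X w) * a1 k (X w))) +
  2 * (\sum_(1 <= k < n.+1) (-1) ^+ k.-1 *
     mean (fun w => energy_coefficient k (X w) * (a1 k (X w) * a2 k (X w)))) +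
  \sum_(1 <= k < n.+1) (-1) ^+ k.-1 *
     mean (fun w => energy_coefficient k (X w) * (a2 k (X w) * a2 k (X w))).
  rewrite mulr_sumr -!big_split /=; apply: eq_big_nat => k kn.
  rewrite (eS k kn).2.
  by move: (mean _) (mean _) (mean _) ((-1) ^+ _) => *; ring.
rewrite SE in VS; move: V1 V2 VS.
move: (mean _) (mean _) (mean _) (mean _) (mean _) (mean _) (mean _) (mean _)
  (bigop _ _ _) (bigop _ _ _) (bigop _ _ _) => *; nra.
Qed.

End covariance_expansion.

(** * Full sets and Borel versions *)

Section full_sets.
Context {R : realType} (nu : probability R R).

Definition full_set (G : set R) : Prop := measurable G /\ nu (~` G) = 0%E.

Lemma full_setI (A B : set R) : full_set A -> full_set B -> full_set (A `&` B).
Proof.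
move=> [mA nA] [mB nB]; split; first exact: measurableI.
apply: measure_negligible; first by apply: measurableC; exact: measurableI.
rewrite setCI; apply: negligibleU.
- by exists (~` A); split => //; exact: measurableC.
- by exists (~` B); split => //; exact: measurableC.
Qed.

Lemma full_setT : full_set setT.
Proof. by split; [exact: measurableT|rewrite setCT measure0]. Qed.

Lemma full_set_bigcap (A : nat -> set R) : (forall i, full_set (A i)) ->
  full_set (\bigcap_i A i).
Proof.
move=> fA; have mA : measurable (\bigcap_i A i).
  by apply: bigcapT_measurable => i; exact: (fA i).1.
split=> //; apply: measure_negligible; first exact: measurableC.
rewrite setC_bigcap; apply: negligible_bigcup => k.
have [mk nk] := fA k; exists (~` A k); split => //; exact: measurableC.
Qed.

End full_sets.

Section law_of_a_variable.
Context d (T : measurableType d) (R : realType) (P : probability T R).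
Context (nu : probability R R) (Y : {RV P >-> R}).
Hypothesis Y_law : forall A : set R, measurable A -> distribution P Y A = nu A.

Lemma ae_law (G : set R) : full_set nu G -> \forall w \ae P, G (Y w).
Proof.
move=> [mG nG]; exists (Y @^-1` (~` G)); split => //.
- by have := measurable_funP Y measurableT _ (measurableC mG); rewrite setTI.
- by rewrite -nG -Y_law//; exact: measurableC.
Qed.

Lemma full_set_law (G : set R) : measurable G ->
  (\forall w \ae P, G (Y w)) -> full_set nu G.
Proof.
move=> mG GY; split=> //; have mC : measurable (~` G) by exact: measurableC.
rewrite -Y_law//; apply: (measure_negligible (mu := P)).
  by have := measurable_funP Y measurableT _ mC; rewrite setTI.
by case: GY => N [mN nN sN]; exists N; split => // w; exact: sN.
Qed.

End law_of_a_variable.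

Section versions.
Context d (T : measurableType d) (R : realType) (P : probability T R).
Context (X : {RV P >-> R}) (nu : probability R R).
Hypothesis X_law : forall A : set R, measurable A -> distribution P X A = nu A.
Context (p : R -> R) (ell : int) (l : nat -> int).
Hypothesis supp_p : standing_assumption ell p.
Hypotheses (mp : measurable_fun [set: R] p) (p0 : forall x, 0 <= p x).
Hypothesis nuE : forall A : set R, measurable A ->
  nu A = (\int[refmeas ell]_(x in A) (p x)%:E)%E.
Hypothesis l_val : forall i, (1 <= i)%N ->
  if ell == 0 then l i = 0 else l i = -1 \/ l i = 1.

Lemma exists_kernel_version i (f : R -> R) : (1 <= i)%N -> in_dom p (- l i) f ->
  exists g D G, kernel_version nu p (l i) f g D G.
Proof.
move=> /l_val; case: ifPn => [/eqP ell0 ->|ell0 li _].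
  by rewrite oppr0 => fdom; exact: (continuous_kernel_version supp_p mp p0 nuE ell0 fdom).
exact: (discrete_kernel_version supp_p mp p0 nuE f ell0 li).
Qed.

Lemma full_set_possupp : full_set nu (possupp p).
Proof.
split; first exact: measurable_possupp.
apply: (law_outside_support p0 nuE) => //; apply: measurableC.
exact: measurable_possupp.
Qed.

(** In the discrete case the strict indicator [x <= y - 1] still compares two
    distinct points of the support, as they are integers. *)
Lemma cut_support : [\/ ell = -1, ell = 0 | ell = 1] ->
  forall x y, possupp p x -> possupp p y -> x != y ->
  (cut ell (x, y) + cut ell (y, x) = 1)%R.
Proof.
move=> ell_val x y px py xy; rewrite /cut /=.
have [ell0|ell0] := eqVneq ell 0.
  rewrite ell0 expr0n/= !chi0E; case: (ltgtP x y) xy => //.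
  - by rewrite addr0.
  - by rewrite add0r.
have ell1 : ell ^+ 2 = 1.
  by case: ell_val ell0 => -> //; rewrite ?sqrrN ?expr1n.
have [a [b [_ _ pE]]] : discrete_support p.
  by move: supp_p; rewrite /standing_assumption (negbTE ell0).
have [m _ mE] : integers x by move: px; rewrite pE => -[].
have [k _ kE] : integers y by move: py; rewrite pE => -[].
move: xy; rewrite ell1 !chi1E -mE -kE.
have E (i j : int) : (i%:~R <= j%:~R - 1 :> R) = (i < j)%R.
  by rewrite -[X in _ - X]/(1%:~R) -intrB ler_int lerBrDr; lia.
rewrite !E eqr_int; case: (ltgtP m k) => //.
- by rewrite addr0.
- by rewrite add0r.
Qed.

(** The truncation [Num.max 0 D] makes the versions of the differences of [h k]
    nonnegative everywhere and changes them only on a set that the law does not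
    charge, so the kernel integrals are the same. The index 0 gets dummy
    values. *)
Lemma weight_versions (h : nat -> R -> R) :
  (forall i, (1 <= i)%N -> in_dom p (- l i) (h i)) ->
  (forall i, (1 <= i)%N -> \forall w \ae P, 0 < Delta (- l i) (h i) (X w)) ->
  exists (b hh : nat -> R -> R) (G : set R), [/\ forall k, measurable_fun [set: R] (b k),
    forall k x, 0 <= b k x, forall k, measurable_fun [set: R] (hh k),
    full_set nu G &
    forall k, (1 <= k)%N ->
      (forall x, G x ->
         [/\ 0 < b k x, Delta (- l k) (h k) x = b k x & h k x = hh k x]) /\
      forall u v, G u -> G v -> u <= v ->
        nu.-integrable [set: R] (fun x => (Phi_p p (l k) u x v * b k x)%:E) /\
        (\int[nu]_x (Phi_p p (l k) u x v * b k x)%:E = (hh k v - hh k u)%:E)%E].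
Proof.
move=> hdom hpos.
suff /choice[q qP] : forall k, exists q : (R -> R) * (R -> R) * set R,
    [/\ measurable_fun [set: R] q.1.1, forall x, 0 <= q.1.1 x,
     measurable_fun [set: R] q.1.2, full_set nu q.2 &
     (1 <= k)%N ->
      (forall x, q.2 x -> [/\ 0 < q.1.1 x,
         Delta (- l k) (h k) x = q.1.1 x & h k x = q.1.2 x]) /\
      forall u v, q.2 u -> q.2 v -> u <= v ->
        nu.-integrable [set: R] (fun x => (Phi_p p (l k) u x v * q.1.1 x)%:E) /\
        (\int[nu]_x (Phi_p p (l k) u x v * q.1.1 x)%:E = (q.1.2 v - q.1.2 u)%:E)%E].
  exists (fun k => (q k).1.1), (fun k => (q k).1.2), (\bigcap_k (q k).2); split.
  - by move=> k; have [] := qP k.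
  - by move=> k; have [] := qP k.
  - by move=> k; have [] := qP k.
  - by apply: full_set_bigcap => k; have [] := qP k.
  - move=> k k1; have [_ _ _ _ /(_ k1) [qx quv]] := qP k; split.
    + by move=> x Gx; apply: qx; exact: Gx.
    + by move=> u v Gu Gv uv; apply: quv; [exact: Gu|exact: Gv|].
move=> k; have [->|k1] := posnP k.
  exists (cst 0, cst 0, setT); split => //=; exact: full_setT.
have [g [D [G [mG nG mg mD hE DE int]]]] := exists_kernel_version k1 (hdom _ k1).
pose B x := Num.max 0 (D x).
have mB : measurable_fun [set: R] B by exact: measurable_maxr.
pose S := G `&` (setT `&` D @^-1` `]0, +oo[).
have SP x : S x <-> G x /\ 0 < D x.
  rewrite /S /= in_itv /= andbT; split; first by move=> [? []].
  by move=> [? ?].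
have fS : full_set nu S.
  apply: (full_set_law X_law).
    by apply: measurableI => //; exact: mD.
  move: (ae_law X_law (conj mG nG)) (hpos k k1); apply: filterS2 => w Gw hw.
  by apply/SP; split => //; rewrite -DE.
have BE x : S x -> B x = D x by move=> /SP[_ Dx]; rewrite /B; apply/max_idPr/ltW.
exists (B, g, S); split => //=; first by move=> x; rewrite /B le_max lexx.
move=> _; split.
  move=> x Sx; have /SP[Gx Dx] := Sx; rewrite BE//; split => //; first exact: DE.
  exact: hE.
move=> u v /SP[Gu _] /SP[Gv _] uv; have [iD eD] := int _ _ Gu Gv uv.
have mPhi (f : R -> R) : measurable_fun [set: R] f ->
    measurable_fun [set: R] (fun x => (Phi_p p (l k) u x v * f x)%:E).
  move=> mf; apply/measurable_EFinP; apply: measurable_funM => //.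
  exact: measurableT_comp (measurable_Phi_p mp (l k)) (pair2_measurable (u, v)).
have aeE : ae_eq nu setT (fun x => (Phi_p p (l k) u x v * D x)%:E)
    (fun x => (Phi_p p (l k) u x v * B x)%:E).
  by move: (ae_full fS.1 fS.2); apply: filterS => x Sx _; rewrite BE.
split; first exact: ae_eq_integrable (mPhi _ mB) aeE iD.
rewrite -eD; apply: ae_eq_integral => //; [exact: mPhi|exact: mPhi|].
exact: ae_eq_sym.
Qed.

End versions.

(** * Chains of iterated differences *)

Section component_chains.
Context {R : realType} (nu : probability R R).
Context (p : R -> R) (ell : int) (l : nat -> int).
Hypothesis supp_p : standing_assumption ell p.
Hypotheses (mp : measurable_fun [set: R] p) (p0 : forall x, 0 <= p x).
Hypothesis nuE : forall A : set R, measurable A ->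
  nu A = (\int[refmeas ell]_(x in A) (p x)%:E)%E.
Hypothesis l_val : forall i, (1 <= i)%N ->
  if ell == 0 then l i = 0 else l i = -1 \/ l i = 1.

Lemma full_set_refmeas (A : set R) :
  (\forall x \ae refmeas ell, possupp p x -> A x) ->
  exists G, full_set nu G /\ G `<=` A.
Proof.
move=> [N [mN N0 NA]]; exists (~` N `&` possupp p); split.
  apply: full_setI; last exact: (full_set_possupp mp p0 nuE).
  split; first exact: measurableC.
  by rewrite setCK; exact: (law_negligible mp p0 nuE mN N0).
by move=> x [Nx px]; apply: contrapT => Ax; apply: Nx; apply: NA => /(_ px).
Qed.

(** Versions are chosen separately for each function of the recursion, and they
    fit together on the intersection of their full sets, since on the support
    the recursion itself holds off a null set. *)
Lemma chain_versions (h phi b : nat -> R -> R) (Gh : set R) (n : nat) :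
  (0 < n)%N ->
  (forall k, measurable_fun [set: R] (b k)) ->
  full_set nu Gh ->
  (forall k x, (1 <= k)%N -> Gh x -> Delta (- l k) (h k) x = b k x) ->
  (forall k, (1 <= k <= n)%N -> in_dom p (- l k) (phi k.-1)) ->
  (forall k, (1 <= k)%N -> \forall x \ae refmeas ell, possupp p x ->
     phi k x = (Delta (- l k) (h k) x)^-1 * Delta (- l k) (phi k.-1) x) ->
  exists (a g : nat -> R -> R) (G' : set R), [/\ full_set nu G',
    forall k x, (1 <= k <= n)%N -> G' x -> Delta (- l k) (phi k.-1) x = a k x,
    forall k x, (k <= n)%N -> G' x -> phi k x = g k x &
    forall G : set R, G `<=` G' -> difference_chain nu p l b G n a g].
Proof.
move=> n0 mb fGh hb dom iter.
suff /choice[q qP] : forall k, exists q : (R -> R) * (R -> R) * set R,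
    [/\ measurable_fun [set: R] q.1.1, measurable_fun [set: R] q.1.2,
     full_set nu q.2 &
     (1 <= k <= n)%N ->
      (forall x, q.2 x -> [/\ Delta (- l k) (phi k.-1) x = q.1.1 x,
         phi k.-1 x = q.1.2 x & phi k x = q.1.1 x / b k x]) /\
      forall u v, q.2 u -> q.2 v -> u <= v ->
        nu.-integrable [set: R] (fun x => (Phi_p p (l k) u x v * q.1.1 x)%:E) /\
        (\int[nu]_x (Phi_p p (l k) u x v * q.1.1 x)%:E = (q.1.2 v - q.1.2 u)%:E)%E].
  pose a k := (q k).1.1.
  (* The version of the last function is read off from the recursion, the
     versions of the others come with their own differences. *)
  pose g k := if (k < n)%N then (q k.+1).1.2 else (fun x => a n x / b n x).
  pose G' := \bigcap_k (q k).2.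
  have gE k x : (k <= n)%N -> G' x -> phi k x = g k x.
    move=> kn Gx; rewrite /g; case: ltnP => [kn'|nk].
      have [_ _ _ /(_ kn')[qx _]] := qP k.+1.
      by have [_ -> _] := qx x (Gx _ I).
    have -> : k = n by apply/eqP; rewrite eqn_leq kn.
    have nn : (1 <= n <= n)%N by rewrite n0 leqnn.
    have [_ _ _ /(_ nn)[qx _]] := qP n.
    by have [_ _ ->] := qx x (Gx _ I).
  exists a, g, G'; split => //.
  - by apply: full_set_bigcap => k; have [] := qP k.
  - move=> k x kn Gx; have [_ _ _ /(_ kn)[qx _]] := qP k.
    by have [-> _ _] := qx x (Gx _ I).
  - move=> G GG'; split.
    + by move=> k; have [] := qP k.
    + move=> k; rewrite /g; case: ltnP => _; first by have [] := qP k.+1.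
      apply: measurable_funM; first by have [] := qP n.
      exact: measurable_fun_inv.
    + move=> k x kn Gx; rewrite -gE; [|by case/andP: kn|exact: GG'].
      have [_ _ _ /(_ kn)[qx _]] := qP k.
      by have [_ _ ->] := qx x (GG' _ Gx _ I).
    + move=> k u v kn Gu Gv uv; have [_ _ _ /(_ kn)[_ quv]] := qP k.
      have -> : g k.-1 = (q k).1.2.
        by case/andP: kn => k0 kn; rewrite /g prednK// kn.
      by apply: quv => //; [exact: GG' Gu _ I|exact: GG' Gv _ I].
move=> k; have [kn|kn] := boolP (1 <= k <= n)%N; last first.
  exists (cst 0, cst 0, setT); split => //=; exact: full_setT.
have k1 : (1 <= k)%N by case/andP: kn.
have [g [D [G [mG nG mg mD hE DE int]]]] :=
  exists_kernel_version supp_p mp p0 nuE l_val k1 (dom _ kn).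
have [S [fS SE]] := full_set_refmeas (iter k k1).
exists (D, g, G `&` S `&` Gh); split => //=.
  by apply: full_setI => //; apply: full_setI.
move=> _; split; last by move=> u v [[Gu _] _] [[Gv _] _]; exact: int.
move=> x [[Gx Sx] Hx]; split; [exact: DE|exact: hE|].
by have /= -> := SE _ Sx; rewrite hb// mulrC DE.
Qed.

End component_chains.

Section gamma_kernel.
Context d (T : measurableType d) (R : realType) (P : probability T R).
Context (Xs : nat -> {RV P >-> R}) (nu : probability R R).
Hypothesis Xs_indep : mutually_independent [set i | (1 <= i)%N] Xs.
Hypothesis Xs_law : forall i, (1 <= i)%N -> forall A : set R, measurable A ->
  distribution P (Xs i) A = nu A.
Context (p : R -> R) (ell : int) (l : nat -> int) (h b hh : nat -> R -> R).
Context (G : set R).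
Hypotheses (mp : measurable_fun [set: R] p) (p0 : forall x, (0 <= p x)%R).
Hypotheses (mb : forall k, measurable_fun [set: R] (b k))
  (b0 : forall k x, (0 <= b k x)%R).
Hypothesis mh : forall k, measurable_fun [set: R] (hh k).
Hypothesis fG : full_set nu G.
Hypothesis hb : forall k x, (1 <= k)%N -> G x -> Delta (- l k) (h k) x = b k x.
Hypothesis hhE : forall k x, (1 <= k)%N -> G x -> h k x = hh k x.
Hypothesis intb : forall k u v, (1 <= k)%N -> G u -> G v -> (u <= v)%R ->
  (\int[nu]_x (Phi_p p (l k) u x v * b k x)%:E = (hh k v - hh k u)%:E)%E.

Lemma ae_copies n : \forall w \ae P, forall i, (1 <= i <= n)%N -> G (Xs i w).
Proof.
elim: n => [|n IH]; first by apply/nearW => w [].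
have := ae_law (Xs_law (ltn0Sn n)) fG; move: IH; apply: filterS2 => w IH Gw i.
case/andP => i1; rewrite leq_eqVlt => /orP[/eqP->//|i_n]; apply: IH.
by rewrite i1.
Qed.

Lemma ae_path n : \forall w \ae P,
  Phi p ell l n (Xs^~ w) * hprod l h n (Xs^~ w) =
  (if n == 0%N then 1 else cut ell (Xs (2 * n + 1)%N w, Xs (2 * n + 2)%N w)) *
  path_weight p l b n (Xs^~ w).
Proof.
have := ae_copies (2 * n + 2); apply: filterS => w Gw.
by apply: path_weightE => i j /andP[i1 _] jn; apply: hb => //; exact: Gw.
Qed.

(** The kernel forces its endpoints to be ordered, and between ordered points
    the version of the weight function increases, being the integral of a
    nonnegative difference. *)
Lemma kernel_increment k u x v : (1 <= k)%N -> compatible_step ell (l k) ->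
  G u -> G v ->
  (hh k v - hh k u) * Phi_p p (l k) u x v =
  `|hh k v - hh k u| * Phi_p p (l k) u x v.
Proof.
move=> k1 lk Gu Gv.
have [->|Phi0] := eqVneq (Phi_p p (l k) u x v) 0; first by rewrite !mulr0.
have uv : u <= v.
  apply: (chi_order lk); apply: contra_neq Phi0 => cuv.
  by rewrite /Phi_p -(chi_between _ _ _ lk) cuv !mul0r.
rewrite ger0_norm// -lee_fin -(intb k1 Gu Gv uv); apply: integral_ge0 => y _.
by rewrite lee_fin mulr_ge0// Phi_p_ge0.
Qed.

(** Almost surely the increment of [h k] may be replaced by its absolute value,
    and the order indicator of the innermost pair is absorbed by the kernel, so
    the integrand is the one of [expectation_path_weight]. *)
Lemma Gamma_weightE k x : (1 <= k)%N -> compatible_step ell (l k) ->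
  has_mean P (Gamma_integrand Xs p ell l h k x) ->
  Gamma_weight nu p l b hh k x \is a fin_num /\
  Gamma Xs p ell l h k x = fine (Gamma_weight nu p l b hh k x).
Proof.
move=> k1 lk ig.
suff E : ('E_P[Gamma_integrand Xs p ell l h k x] = Gamma_weight nu p l b hh k x)%E.
  split; last by rewrite /Gamma E.
  by rewrite -E unlock; exact: integrable_fin_num.
pose f (s : R * R) : \bar R := (`|hh k s.2 - hh k s.1| * Phi_p p (l k) s.1 x s.2)%:E.
have mf : measurable_fun setT f.
  apply/measurable_EFinP; apply: measurable_funM.
    apply: measurableT_comp => //; apply: measurable_funB.
    - exact: measurable_snd_comp.
    - exact: measurable_fst_comp.
  have pair1 : measurable_fun setT (fun s : R * R => (x, s)).
    by apply: measurable_fun_pair => //; exact: measurable_cst.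
  exact: measurableT_comp (measurable_Phi_p mp (l k)) pair1.
have f0 s : (0 <= f s)%E by rewrite lee_fin mulr_ge0// Phi_p_ge0.
rewrite /Gamma_weight -[RHS](expectation_path_weight Xs_indep Xs_law l mp p0 mb b0 k.-1 mf f0).
have e1 : (2 * k.-1 + 1 = 2 * k - 1)%N by lia.
have e2 : (2 * k.-1 + 2 = 2 * k)%N by lia.
rewrite e1 e2 unlock; apply: ae_eq_integral => //.
- exact: measurable_int ig.
- apply: emeasurable_funM.
    by apply: (measurableT_comp mf); exact: measurable_fun_pair.
  apply/measurable_EFinP; apply: (@measurable_path_weight _ p l b mp mb _ _ (fun i => Xs i)).
  by move=> i _; exact: measurable_funPT.
have := ae_path k.-1; have := ae_copies (2 * k).
apply: filterS2 => w Gw pw _; rewrite -EFinM; congr EFin.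
have G1 : G (Xs (2 * k - 1)%N w) by apply: Gw; lia.
have G2 : G (Xs (2 * k)%N w) by apply: Gw; lia.
rewrite /Gamma_integrand -mulrA pw e1 e2 !hhE// kernel_increment//.
case: ifP => _; first by rewrite mul1r.
rewrite -[LHS]mulrA [X in _ * X]mulrA -[RHS]mulrA; congr (_ * (_ * _)).
by rewrite /Phi_p /cut /= mulrAC [_ * chi (ell ^+ 2) _ _]mulrC (chi_between _ _ _ lk).
Qed.

End gamma_kernel.

(** * Random vectors *)

Section mean_of_a_version.
Context d (T : measurableType d) (R : realType) (P : probability T R).

Lemma mean_version (Y Z : T -> R) : measurable_fun setT Z ->
  (\forall w \ae P, Y w = Z w) -> has_mean P Y ->
  has_mean P Z /\ mean P Y = mean P Z.
Proof.
move=> mZ YZ iY.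
have mZ' : measurable_fun setT (EFin \o Z) by exact/measurable_EFinP.
have YZ' : ae_eq P setT (EFin \o Y) (EFin \o Z).
  by move: YZ; apply: filterS => w /= ->.
split; first exact: ae_eq_integrable mZ' YZ' iY.
by congr fine; apply: ae_eq_integral => //; exact: measurable_int iY.
Qed.

Lemma fine_expectation (Y : T -> R) : fine 'E_P[Y]%E = mean P Y.
Proof. by rewrite unlock. Qed.

Lemma covariance_mean (Y Z : T -> R) : has_mean P Y -> has_mean P Z ->
  has_mean P (fun w => Y w * Z w) ->
  fine (covariance P Y Z) = mean P (fun w => Y w * Z w) - mean P Y * mean P Z.
Proof.
move=> iY iZ iYZ; rewrite covarianceE; try exact/Lfun1_integrable.
have E f : has_mean P f -> 'E_P[f]%E = (mean P f)%:E.
  by move=> fi; rewrite unlock /mean fineK//; exact: integrable_fin_num.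
by rewrite (E _ iY) (E _ iZ) (E (Y * Z) iYZ) -EFinM -EFinB.
Qed.

End mean_of_a_version.

Theorem theorem2p5 (R : realType) (d : measure_display) (T : measurableType d)
  (P : probability T R) (X : {RV P >-> R}) (Xs : nat -> {RV P >-> R})
  (p : R -> R) (ell : int) (l : nat -> int) (h : nat -> R -> R)
  (ell_val : [\/ ell = -1, ell = 0 | ell = 1])
  (p_supp : standing_assumption ell p)
  (X_p : has_density X (refmeas ell) p)
  (Xs_copies : independent_copies X Xs)
  (l_val : forall i, (1 <= i)%N ->
    if ell == 0 then l i = 0 else l i = -1 \/ l i = 1)
  (h_dom : forall i, (1 <= i)%N -> in_dom p (- l i) (h i))
  (h_pos : forall i, (1 <= i)%N ->
    \forall w \ae P, 0 < Delta (- l i) (h i) (X w))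
  (n : nat) (n_ge1 : (1 <= n)%N)
  (r : nat) (f : R -> 'cV[R]_r) (F : nat -> R -> 'cV[R]_r)
  (F_iter : iterated_differences p ell l h f F)
  (F_dom : forall k, (1 <= k <= n)%N -> in_vdom p (- l k) (F k.-1))
  (cov_ex : has_cov_mx P (fun w => f (X w)))
  (Gamma_ex : forall k, (1 <= k <= n)%N ->
    \forall w \ae P, has_mean P (Gamma_integrand Xs p ell l h k (X w)))
  (terms_ex : forall k, (1 <= k <= n)%N ->
    has_mmean P (expansion_term X Xs p ell l h (F k.-1) k))
  (remainder_ex : has_mmean P (remainder_integrand Xs p ell l h (F n) n)) :
  cov_mx P (fun w => f (X w)) =
  \sum_(1 <= k < n.+1)
     (-1) ^+ k.-1 *: mmean P (expansion_term X Xs p ell l h (F k.-1) k) +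
  (-1) ^+ n *: mmean P (remainder_integrand Xs p ell l h (F n) n).
Proof.
have [mp p0 nuE] := X_p; have [Xs_indep Xs_law] := Xs_copies.
have [F0 Fi] := F_iter.
pose nu : probability R R := distribution P X.
have X_law (A : set R) : measurable A -> distribution P X A = nu A by [].
have lk k : (1 <= k)%N -> compatible_step ell (l k).
  move=> /l_val; case: ifPn => [/eqP ell0 l0|ell0 l1]; first by left.
  by right; split => //; case: ell_val ell0 => -> //; rewrite ?sqrrN ?expr1n.
have [b [hh [Gh [mb b0 mh fGh hhP]]]] :=
  weight_versions X_law p_supp mp p0 nuE l_val h_dom h_pos.
have hb k x : (1 <= k)%N -> Gh x -> Delta (- l k) (h k) x = b k x.
  by move=> k1 Gx; have [/(_ x Gx)[]] := hhP k k1.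
have /choice[q qP] : forall j : 'I_r, exists q : (nat -> R -> R) * (nat -> R -> R) * set R,
    [/\ full_set nu q.2,
     forall k x, (1 <= k <= n)%N -> q.2 x ->
       Delta (- l k) (fun y => F k.-1 y j 0) x = q.1.1 k x,
     forall k x, (k <= n)%N -> q.2 x -> F k x j 0 = q.1.2 k x &
     forall G : set R, G `<=` q.2 -> difference_chain nu p l b G n q.1.1 q.1.2].
  move=> j; have [|k k1|a [g [G' H]]] := chain_versions p_supp mp p0 nuE l_val
    (h := h) (phi := fun k x => F k x j 0) n_ge1 mb fGh hb.
  - by move=> k kn; exact: F_dom.
  - apply: (@filterS _ _ (ae_filter_ringOfSetsType (refmeas ell)) _ _ _ (Fi k k1)).
    by move=> x Fx px; rewrite Fx// !mxE.
  - by exists (a, g, G').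
pose a j := (q j).1.1; pose g j := (q j).1.2.
pose Gc := \bigcap_m (if insub m is Some j then (q j).2 else setT).
have fGc : full_set nu Gc.
  apply: full_set_bigcap => m; case: insubP => [j _ _|_]; last exact: full_setT.
  by have [] := qP j.
have Gcj j x : Gc x -> (q j).2 x.
  by move=> /(_ (val j) I); rewrite valK.
pose G := Gh `&` possupp p `&` Gc.
have fG : full_set nu G.
  by apply: full_setI => //; apply: full_setI => //; exact: full_set_possupp nuE.
have Gq j : G `<=` (q j).2 by move=> x [_ /Gcj].
have chain j : difference_chain nu p l b G n (a j) (g j).
  by have [_ _ _] := qP j; apply.
have aE j k x : (1 <= k <= n)%N -> G x -> vDelta (- l k) (F k.-1) x j 0 = a j k x.
  by move=> kn /Gq Gx; rewrite mxE; have [_ + _ _] := qP j; apply.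
have gE j k x : (k <= n)%N -> G x -> F k x j 0 = g j k x.
  by move=> kn /Gq Gx; have [_ _ + _] := qP j; apply.
have ma j k : measurable_fun setT (a j k) by have [] := chain j.
have mg j k : measurable_fun setT (g j k) by have [] := chain j.
have hbG k x : (1 <= k)%N -> G x -> Delta (- l k) (h k) x = b k x.
  by move=> k1 [[Gx _] _]; exact: hb.
have hhG k x : (1 <= k)%N -> G x -> h k x = hh k x.
  by move=> k1 [[Gx _] _]; have [/(_ x Gx)[]] := hhP k k1.
have intb k u v : (1 <= k)%N -> G u -> G v -> u <= v ->
    nu.-integrable setT (fun x => (Phi_p p (l k) u x v * b k x)%:E) /\
    (\int[nu]_x (Phi_p p (l k) u x v * b k x)%:E = (hh k v - hh k u)%:E)%E.
  by move=> k1 [[Gu _] _] [[Gv _] _]; have [_] := hhP k k1; apply.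
have intb2 k u v k1 Gu Gv uv := (intb k u v k1 Gu Gv uv).2.
have XG := ae_law X_law fG.
have GammaE k : (1 <= k <= n)%N -> \forall w \ae P,
    Gamma_weight nu p l b hh k (X w) \is a fin_num /\
    Gamma Xs p ell l h k (X w) = fine (Gamma_weight nu p l b hh k (X w)).
  move=> kn; have k1 : (1 <= k)%N by case/andP: kn.
  have := Gamma_ex k kn; apply: filterS => w; apply: (Gamma_weightE _ _ _ _ _ _ _ fG) => //.
  exact: lk.
have mX (u : R -> R) : measurable_fun setT u -> measurable_fun setT (u \o X).
  by move=> mu; exact: measurableT_comp.
have mXs i (u : R -> R) : measurable_fun setT u -> measurable_fun setT (u \o Xs i).
  by move=> mu; exact: measurableT_comp.
have [f_ex ff_ex] := cov_ex.
(* Each matrix entry below almost surely equals its Borel version. *)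
have meanE j : has_mean P (g j 0%N \o X) /\
    mean P (fun w => f (X w) j 0) = mean P (g j 0%N \o X).
  apply: mean_version (mX _ (mg j 0%N)) _ (f_ex j 0).
  by move: XG; apply: filterS => w Gw; rewrite -F0 (gE j 0%N).
have ff_mean i j : has_mean P (fun w => f (X w) i 0 * f (X w) j 0).
  by apply: eq_integrable (ff_ex i j) => // w _ /=; rewrite !mxE big_ord1 !mxE.
have prodE i j : has_mean P (fun w => g i 0%N (X w) * g j 0%N (X w)) /\
    mean P (fun w => f (X w) i 0 * f (X w) j 0) =
    mean P (fun w => g i 0%N (X w) * g j 0%N (X w)).
  apply: mean_version (ff_mean i j); first by apply: measurable_funM; exact: mX.
  by move: XG; apply: filterS => w Gw; rewrite -F0 !(gE _ 0%N).
have termE i j k : (1 <= k <= n)%N ->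
    has_mean P (fun w => energy_coefficient nu p l b hh k (X w) *
                         (a i k (X w) * a j k (X w))) /\
    mean P (fun w => expansion_term X Xs p ell l h (F k.-1) k w i j) =
    mean P (fun w => energy_coefficient nu p l b hh k (X w) *
                     (a i k (X w) * a j k (X w))).
  move=> kn; have k1 : (1 <= k)%N by case/andP: kn.
  apply: mean_version (terms_ex k kn i j).
    apply: measurable_funM; last by apply: measurable_funM; exact: mX.
    apply: (mX (energy_coefficient nu p l b hh k)); apply: measurable_funM.
      by apply: measurableT_comp => //; exact: measurable_Gamma_weight.
    exact: measurable_fun_inv.
  move: XG (GammaE k kn); apply: filterS2 => w Gw [_ Gk].
  rewrite /expansion_term mxE [(_ *m _) _ _]mxE big_ord1 [_^T _ _]mxE !aE// Gk hbG//.
have remE i j : has_mean P (chain_remainder Xs p ell l b n (g i n) (g j n)) /\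
    mean P (fun w => remainder_integrand Xs p ell l h (F n) n w i j) =
    mean P (chain_remainder Xs p ell l b n (g i n) (g j n)).
  apply: mean_version (remainder_ex i j).
    apply: measurable_funM.
      apply: measurable_funM; first by apply: measurable_chi; exact: measurable_funPT.
      apply: (measurable_path_weight l mp mb (Y := fun i => Xs i)) => m _.
      exact: measurable_funPT.
    by apply: measurable_funM; apply: measurable_funB; exact: mXs.
  have := ae_path Xs_law p ell fG hbG n.
  have := ae_copies Xs_law fG (2 * n + 2); apply: filterS2 => w Gw pw.
  have G1 : G (Xs (2 * n + 1)%N w) by apply: Gw; lia.
  have G2 : G (Xs (2 * n + 2)%N w) by apply: Gw; lia.
  rewrite /remainder_integrand mxE pw [(_ *m _) _ _]mxE big_ord1 [_^T _ _]mxE.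
  by rewrite 4!mxE !gE// (negbTE (lt0n_neq0 n_ge1)) /chain_remainder; ring.
have Gfin k : (1 <= k <= n)%N ->
    \forall w \ae P, Gamma_weight nu p l b hh k (X w) \is a fin_num.
  by move=> kn; have := GammaE k kn; apply: filterS => w [].
have cutG x y : G x -> G y -> x != y -> cut ell (x, y) + cut ell (y, x) = 1.
  by move=> [[_ px] _] [[_ py] _]; exact: cut_support ell_val _ _ px py.
apply/matrixP => i j.
have key := @covariance_expansion _ _ _ P X Xs nu X_law Xs_indep Xs_law p ell l b hh G n
  mp p0 mb b0 mh fG.1 fG.2 cutG n_ge1 _ _ _ Gfin (a i) (g i) (a j) (g j) (chain i) (chain j).
rewrite !mxE summxE covariance_mean// (meanE i).2 (meanE j).2 (prodE i j).2 key.
- congr (_ + _); last by rewrite fine_expectation (remE i j).2.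
  by apply: eq_big_nat => k kn; rewrite !mxE fine_expectation (termE i j k kn).2.
- by move=> k /andP[k1 _]; exact: lk.
- move=> k x /andP[k1 _] [[Gx _] _].
  by have [/(_ x Gx)[]] := hhP k k1.
- by move=> k u v /andP[k1 _]; exact: intb.
- have ig c c' : has_mean P (fun w => g c 0%N (X w)) /\
      has_mean P (fun w => g c 0%N (X w) * g c' 0%N (X w)) /\
      has_mean P (chain_remainder Xs p ell l b n (g c n) (g c' n)).
    split; first exact: (meanE c).1.
    by split; [exact: (prodE c c').1|exact: (remE c c').1].
  by move=> _ _ [->|->] [->|->].
- by move=> _ _ k [->|->] [->|->] kn; exact: (termE _ _ k kn).1.
Qed.
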